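(* If $M_m$ is a von Mangoldt plane, then the set $A_m$ is open in $M_m$.
   Context: For a smooth function $m\colon[0,\infty)\to[0,\infty)$ with $m(0)=0$, $m'(0)=1$, $m>0$ on $(0,\infty)$ and smooth odd extension, $M_m$ is $\mathbb R^2$ with metric $dr^2+m(r)^2d\theta^2$ (polar coordinates about the origin $o$), curvature $G_m=-m''/m$; it is von Mangoldt if $G_m$ is non-increasing in $r$. A ray is a unit speed geodesic $\gamma\colon[0,\infty)\to M_m$ minimizing between any two of its points. A ray $\gamma$ with $\gamma(0)\neq o$ points away from infinity if $\dot\gamma(0)$ and the segment from $\gamma(0)$ to $o$ make an angle $<\pi/2$ at $\gamma(0)$. $A_m\subset M_m\setminus\{o\}$ is the set of points $q$ from which some ray pointing away from infinity starts. *)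

(* Defs.v *)
From Stdlib Require Import Reals Lra.
From Coquelicot Require Import Coquelicot.
Open Scope R_scope.

(** Points / tangent vectors of R^2 in Cartesian coordinates. *)
Definition pt : Type := (R * R)%type.
Definition dot (p v : pt) : R := fst p * fst v + snd p * snd v.
Definition enorm (p : pt) : R := sqrt (dot p p).
Definition origin : pt := (0, 0).

(** Profile functions m : smooth on R (this is the smooth odd extension),
    odd, m 0 = 0, m'(0) = 1, m > 0 on (0, oo). *)
Definition profile (m : R -> R) : Prop :=
  (forall (n : nat) (x : R), ex_derive_n m n x) /\
  (forall x, m (- x) = - m x) /\
  m 0 = 0 /\ Derive m 0 = 1 /\
  (forall r, 0 < r -> 0 < m r).

Definition Gm (m : R -> R) (r : R) : R := - Derive_n m 2 r / m r.

(** von Mangoldt: G_m non-increasing in r (on r > 0, where it is defined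
    by the formula; by continuity this is the same as on [0,oo)). *)
Definition von_Mangoldt (m : R -> R) : Prop :=
  profile m /\ (forall r1 r2, 0 < r1 -> r1 <= r2 -> Gm m r2 <= Gm m r1).

(** The metric dr^2 + m(r)^2 dtheta^2 written in Cartesian coordinates at
    the point p: radial components multiply with weight 1, tangential
    (Euclidean) components with weight (m(r)/r)^2; at the origin it is the
    Euclidean metric. *)
Definition gm (m : R -> R) (p v w : pt) : R :=
  let r := enorm p in
  if Req_EM_T r 0 then dot v w
  else let a := dot p v / r in
       let b := dot p w / r in
       a * b + (m r / r) ^ 2 * (dot v w - a * b).

Definition vel (c : R -> pt) (t : R) : pt :=
  (Derive (fun s => fst (c s)) t, Derive (fun s => snd (c s)) t).

Definition C1_curve (c : R -> pt) : Prop :=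
  (forall t, ex_derive (fun s => fst (c s)) t) /\
  (forall t, ex_derive (fun s => snd (c s)) t) /\
  (forall t, continuous (Derive (fun s => fst (c s))) t) /\
  (forall t, continuous (Derive (fun s => snd (c s))) t).

Definition curve_length (m : R -> R) (c : R -> pt) : R :=
  RInt (fun t => sqrt (gm m (c t) (vel c t) (vel c t))) 0 1.

Definition dist_m (m : R -> R) (p q : pt) : Rbar :=
  Glb_Rbar (fun L => exists c, C1_curve c /\ c 0 = p /\ c 1 = q /\
                               L = curve_length m c).

Definition rderiv0 (g : R -> pt) (v : pt) : Prop :=
  filterlim (fun h => (fst (g h) - fst (g 0)) / h) (at_right 0) (locally (fst v)) /\
  filterlim (fun h => (snd (g h) - snd (g 0)) / h) (at_right 0) (locally (snd v)).

(** A ray: unit speed curve on [0,oo) minimizing between any two of its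
    points (metric characterization: d(g s, g t) = |t - s|). *)
Definition is_ray (m : R -> R) (g : R -> pt) : Prop :=
  forall s t, 0 <= s -> 0 <= t -> dist_m m (g s) (g t) = Finite (Rabs (t - s)).

Definition is_segment (m : R -> R) (p q : pt) (sg : R -> pt) : Prop :=
  exists l, 0 <= l /\ dist_m m p q = Finite l /\ sg 0 = p /\ sg l = q /\
    forall s t, 0 <= s <= l -> 0 <= t <= l ->
      dist_m m (sg s) (sg t) = Finite (Rabs (t - s)).

Definition angle (m : R -> R) (p v w : pt) : R :=
  acos (gm m p v w / (sqrt (gm m p v v) * sqrt (gm m p w w))).

Definition points_away (m : R -> R) (g : R -> pt) : Prop :=
  g 0 <> origin /\
  exists v sg w, rderiv0 g v /\ is_segment m (g 0) origin sg /\ rderiv0 sg w /\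
    angle m (g 0) v w < PI / 2.

Definition A_m (m : R -> R) (q : pt) : Prop :=
  q <> origin /\ exists g, is_ray m g /\ g 0 = q /\ points_away m g.

(** Openness in M_m (whose topology is the Euclidean one of R^2). *)
Definition open_plane (S : pt -> Prop) : Prop :=
  forall q, S q -> exists eps, 0 < eps /\
    forall p, enorm (fst p - fst q, snd p - snd q) < eps -> S p.

(* Main.v *)
Require Import Defs.
From Stdlib Require Import Reals Lra Psatz Classical ClassicalEpsilon Ranalysis5.
From Coquelicot Require Import Coquelicot.
Open Scope R_scope.

(** A curve which starts at radius [R0], has minimal radius [x], and ends far away after turning by the angle
    [phi] is at least as long as its final radius plus [Fcap c2 phi R0 x]; this follows from calibrating with
    the Clairaut constant [min (cstar x) c2], where [cstar x] is the infimum of [m] over radii [>= x].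

    If for some [phi < PI] and [c2 <= cstar R0] the function [Fcap c2 phi R0] takes on [[0, R0]] a value below
    that at [R0] (condition [crit R0]), then its minimizer is interior and is the turning radius of a geodesic
    of total turn exactly [phi], which is therefore a ray pointing away from infinity. This condition is open
    in [R0], so it remains to deduce it from the existence of such a ray [g].

    Such a ray forces [1/m^2] to be integrable, and [m] to be unbounded by the von Mangoldt condition. Let [phi]
    be an accumulation point of the angles of [g], and let [c2] maximize [Phi phi R0 c R0] over [c]: up to
    errors, the maximum [V] is also an upper bound for the gain of [g], so [Fcap c2 phi R0 rho <= V] for some
    [rho < R0]. If [phi < PI], enlarging [phi] gives [crit R0]. If [phi = PI], either [phi] can be decreased,
    or [V] is the minimum of [Fcap c2 PI R0]. In the latter case one finds an inward geodesic gaining more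
    than [V]. From a radius slightly below [R0] the minimization then yields a ray with smaller Clairaut
    constant gaining at most [V]; but in the von Mangoldt case a Sturm comparison shows that this ray stays
    below the geodesic, so that it gains at least as much, a contradiction. *)

(** A ray is defined metrically, so neither a geodesic equation nor a first variation formula is at
    hand for the given [g]. It enters only through lengths: it reaches a radius below its initial
    one, and its length minus its radius stays bounded while it escapes. This limiting difference,
    the gain, is the quantity compared throughout. Geodesics are built by quadrature instead of
    differential equations, and they are shown to minimize because their gain equals the minimum of
    the calibrated bound.

    The cap [c2] makes the bound at [R0] the value of a route that never goes inward, so that an
    inward ray has a definite rival. The angle PI is the obstacle that shapes the proof: since a
    curve may pass the origin on either side, a point is never more than PI away in angle. Below PI
    there is room to enlarge the angle, which turns a weak inequality into a strict one and cuts the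
    corner at the origin; at PI there is none. Apart from the growth of [m], the von Mangoldt
    condition enters only in that borderline case. *)

Lemma cont_plus (f g : R -> R) (x : R) :
  continuous f x -> continuous g x -> continuous (fun t => f t + g t) x.
Proof. intros; now apply (continuous_plus f g). Qed.

Lemma cont_minus (f g : R -> R) (x : R) :
  continuous f x -> continuous g x -> continuous (fun t => f t - g t) x.
Proof. intros; now apply (continuous_minus f g). Qed.

Lemma cont_opp (f : R -> R) (x : R) :
  continuous f x -> continuous (fun t => - f t) x.
Proof. intros; now apply (continuous_opp f). Qed.

Lemma cont_mult (f g : R -> R) (x : R) :
  continuous f x -> continuous g x -> continuous (fun t => f t * g t) x.
Proof. intros; now apply (continuous_mult f g). Qed.

Lemma cont_inv (f : R -> R) (x : R) :
  continuous f x -> f x <> 0 -> continuous (fun t => / f t) x.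
Proof. intros; now apply continuous_Rinv_comp. Qed.

Lemma cont_div (f g : R -> R) (x : R) :
  continuous f x -> continuous g x -> g x <> 0 -> continuous (fun t => f t / g t) x.
Proof. intros; apply cont_mult; auto; now apply cont_inv. Qed.

Lemma cont_sqrt (f : R -> R) (x : R) :
  continuous f x -> continuous (fun t => sqrt (f t)) x.
Proof. intros; now apply continuous_sqrt_comp. Qed.

Lemma cont_pow (f : R -> R) (n : nat) (x : R) :
  continuous f x -> continuous (fun t => f t ^ n) x.
Proof.
  intros H; induction n as [|n IH]; simpl; [apply continuous_const|].
  now apply cont_mult.
Qed.

Lemma cont_abs (f : R -> R) (x : R) :
  continuous f x -> continuous (fun t => Rabs (f t)) x.
Proof. intros; now apply continuous_Rabs_comp. Qed.

Lemma cont_comp (f g : R -> R) (x : R) :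
  continuous f x -> continuous g (f x) -> continuous (fun t => g (f t)) x.
Proof. intros; now apply (continuous_comp f g). Qed.

Lemma cont_eps (f : R -> R) (x : R) :
  continuous f x <->
  (forall eps, 0 < eps -> exists d, 0 < d /\
     forall y, Rabs (y - x) < d -> Rabs (f y - f x) < eps).
Proof.
  split.
  - intros H eps He.
    destruct (proj1 (filterlim_locally f (f x)) H (mkposreal eps He)) as [d Hd].
    exists d; split; [apply cond_pos|]. intros y Hy. now apply (Hd y).
  - intros H. apply filterlim_locally. intros eps.
    destruct (H eps (cond_pos eps)) as [d [Hd0 Hd]].
    exists (mkposreal d Hd0). intros y Hy. now apply Hd.
Qed.

(** Serves where a curve meets the origin: there the radial component of the velocity need not have
    a limit, but the coefficient in front of it tends to zero. *)
Lemma cont_squeeze (f g k : R -> R) (x : R) :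
  continuous g x -> continuous k x -> k x = 0 -> f x = g x ->
  (forall t, Rabs (f t - g t) <= k t) -> continuous f x.
Proof.
  intros Hg Hk Hk0 Hfg Hb. apply cont_eps. intros e He.
  destruct (proj1 (cont_eps g x) Hg (e / 2) ltac:(lra)) as [d1 [D1 H1]].
  destruct (proj1 (cont_eps k x) Hk (e / 2) ltac:(lra)) as [d2 [D2 H2]].
  exists (Rmin d1 d2). split; [now apply Rmin_glb_lt|]. intros y Hy.
  specialize (H1 y (Rlt_le_trans _ _ _ Hy (Rmin_l _ _))).
  specialize (H2 y (Rlt_le_trans _ _ _ Hy (Rmin_r _ _))).
  specialize (Hb y). rewrite Hk0 in H2. rewrite Hfg.
  assert (Rabs (k y - 0) = k y).
  { rewrite Rabs_pos_eq; [lra|]. pose proof (Rabs_pos (f y - g y)). lra. }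
  replace (f y - g x) with ((f y - g y) + (g y - g x)) by ring.
  eapply Rle_lt_trans; [apply Rabs_triang|]. lra.
Qed.

Lemma deriv_cont (f : R -> R) (x l : R) : is_derive f x l -> continuous f x.
Proof. intros H. apply (ex_derive_continuous (V := R_NormedModule)). now exists l. Qed.

Ltac cont1 :=
  lazymatch goal with
  | |- continuous (fun t => t) ?x => apply continuous_id
  | |- continuous (fun t => @?f t + @?g t) ?x => apply (cont_plus f g x)
  | |- continuous (fun t => @?f t - @?g t) ?x => apply (cont_minus f g x)
  | |- continuous (fun t => - @?f t) ?x => apply (cont_opp f x)
  | |- continuous (fun t => @?f t * @?g t) ?x => apply (cont_mult f g x)
  | |- continuous (fun t => @?f t / @?g t) ?x => apply (cont_div f g x)
  | |- continuous (fun t => / @?f t) ?x => first [ apply continuous_const | apply (cont_inv f x) ]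
  | |- continuous (fun t => sqrt (@?f t)) ?x => apply (cont_sqrt f x)
  | |- continuous (fun t => @?f t ^ ?n) ?x => apply (cont_pow f n x)
  | |- continuous (fun t => Rabs (@?f t)) ?x => apply (cont_abs f x)
  | |- continuous (fun t => ?f t) ?x => first [ apply continuous_const | change (continuous f x) ]
  | |- continuous (fun t => _) ?x => apply continuous_const
  end.
Ltac cont := repeat (first [ assumption | cont1 ]).

(** * Extrema, monotonicity and integrals of continuous functions on intervals *)

Lemma min_attained (f : R -> R) (a b : R) :
  a <= b -> (forall x, a <= x <= b -> continuous f x) ->
  exists x, a <= x <= b /\ forall y, a <= y <= b -> f x <= f y.
Proof.
  intros Hab Hf.
  destruct (continuity_ab_min f a b Hab) as [x [H1 H2]].
  { intros c Hc. apply continuity_pt_filterlim. now apply Hf. }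
  exists x; split; auto.
Qed.

Lemma max_attained (f : R -> R) (a b : R) :
  a <= b -> (forall x, a <= x <= b -> continuous f x) ->
  exists x, a <= x <= b /\ forall y, a <= y <= b -> f y <= f x.
Proof.
  intros Hab Hf.
  destruct (min_attained (fun x => - f x) a b Hab) as [x [H1 H2]].
  { intros; cont; auto. }
  exists x; split; auto. intros y Hy. specialize (H2 y Hy). lra.
Qed.

Lemma ex_RInt_cont (f : R -> R) (a b : R) :
  a <= b -> (forall x, a <= x <= b -> continuous f x) -> ex_RInt f a b.
Proof.
  intros Hab H. apply (ex_RInt_continuous (V := R_CompleteNormedModule)).
  rewrite Rmin_left, Rmax_right by lra. exact H.
Qed.

Lemma le_of_eps (a b : R) : (forall e, 0 < e -> a <= b + e) -> a <= b.
Proof. intros H. apply Rnot_lt_le. intros Hl. specialize (H ((a - b) / 2)). lra. Qed.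

Lemma mono_of_deriv (f df : R -> R) (a b : R) :
  a <= b -> (forall x, a <= x <= b -> is_derive f x (df x)) ->
  (forall x, a <= x <= b -> 0 <= df x) -> f a <= f b.
Proof.
  intros Hab Hd Hp. destruct (MVT_gen f a b df) as [c [Hc1 Hc2]].
  - rewrite Rmin_left, Rmax_right by lra. intros; apply Hd; lra.
  - rewrite Rmin_left, Rmax_right by lra. intros x Hx.
    apply continuity_pt_filterlim. eapply deriv_cont, Hd, Hx.
  - rewrite Rmin_left, Rmax_right in Hc1 by lra.
    specialize (Hp c Hc1). nra.
Qed.

Lemma mono_strict_of_deriv (f df : R -> R) (a b : R) :
  a < b -> (forall x, a <= x <= b -> is_derive f x (df x)) ->
  (forall x, a <= x <= b -> 0 < df x) -> f a < f b.
Proof.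
  intros Hab Hd Hp. destruct (MVT_gen f a b df) as [c [Hc1 Hc2]].
  - rewrite Rmin_left, Rmax_right by lra. intros; apply Hd; lra.
  - rewrite Rmin_left, Rmax_right by lra. intros x Hx.
    apply continuity_pt_filterlim. eapply deriv_cont, Hd, Hx.
  - rewrite Rmin_left, Rmax_right in Hc1 by lra.
    specialize (Hp c Hc1). nra.
Qed.

Lemma RInt_pos (f : R -> R) (a b : R) :
  a <= b -> (forall x, a <= x <= b -> continuous f x) ->
  (forall x, a <= x <= b -> 0 <= f x) -> 0 <= RInt f a b.
Proof.
  intros Hab Hc Hp. apply RInt_ge_0; auto.
  - now apply ex_RInt_cont.
  - intros; apply Hp; lra.
Qed.

Lemma RInt_le_cont (f g : R -> R) (a b : R) :
  a <= b -> (forall x, a <= x <= b -> continuous f x) ->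
  (forall x, a <= x <= b -> continuous g x) ->
  (forall x, a <= x <= b -> f x <= g x) -> RInt f a b <= RInt g a b.
Proof.
  intros. apply RInt_le; auto using ex_RInt_cont. intros; apply H2; lra.
Qed.

Lemma RInt_Chasles_cont (f : R -> R) (a b c : R) :
  a <= b <= c -> (forall x, a <= x <= c -> continuous f x) ->
  RInt f a c = RInt f a b + RInt f b c.
Proof.
  intros [H1 H2] Hc. symmetry.
  apply (RInt_Chasles (V := R_CompleteNormedModule)); apply ex_RInt_cont; auto; intros; apply Hc; lra.
Qed.

Lemma RInt_const_R (k a b : R) : RInt (fun _ => k) a b = k * (b - a).
Proof. rewrite RInt_const. unfold scal; simpl; unfold mult; simpl; ring. Qed.

Lemma RInt_scal_cont (f : R -> R) (k a b : R) :
  a <= b -> (forall x, a <= x <= b -> continuous f x) ->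
  RInt (fun x => k * f x) a b = k * RInt f a b.
Proof.
  intros. apply (RInt_scal (V := R_CompleteNormedModule) f a b k). now apply ex_RInt_cont.
Qed.

Lemma RInt_plus_cont (f g : R -> R) (a b : R) :
  a <= b -> (forall x, a <= x <= b -> continuous f x) ->
  (forall x, a <= x <= b -> continuous g x) ->
  RInt (fun x => f x + g x) a b = RInt f a b + RInt g a b.
Proof.
  intros. apply (RInt_plus (V := R_CompleteNormedModule)); now apply ex_RInt_cont.
Qed.

Lemma RInt_minus_cont (f g : R -> R) (a b : R) :
  a <= b -> (forall x, a <= x <= b -> continuous f x) ->
  (forall x, a <= x <= b -> continuous g x) ->
  RInt (fun x => f x - g x) a b = RInt f a b - RInt g a b.
Proof.
  intros. apply (RInt_minus (V := R_CompleteNormedModule)); now apply ex_RInt_cont.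
Qed.

Lemma RInt_ext_le (f g : R -> R) (a b : R) :
  a <= b -> (forall x, a < x < b -> f x = g x) -> RInt f a b = RInt g a b.
Proof.
  intros H E. apply RInt_ext. rewrite Rmin_left, Rmax_right by lra. exact E.
Qed.

Lemma RInt_deriv (f df : R -> R) (a b : R) :
  a <= b -> (forall x, a <= x <= b -> is_derive f x (df x)) ->
  (forall x, a <= x <= b -> continuous df x) -> RInt df a b = f b - f a.
Proof.
  intros Hab Hd Hc. apply is_RInt_unique.
  apply (is_RInt_derive (V := R_CompleteNormedModule) f df);
  rewrite Rmin_left, Rmax_right by lra; auto.
Qed.

Lemma is_derive_RInt_cont (f : R -> R) (a x : R) :
  (forall t, continuous f t) -> is_derive (fun y => RInt f a y) x (f x).
Proof.
  intros H. apply (is_derive_RInt f (fun y => RInt f a y) a x).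
  - apply filter_forall. intros y. apply (RInt_correct (V := R_CompleteNormedModule)).
    apply (ex_RInt_continuous (V := R_CompleteNormedModule)). auto.
  - apply H.
Qed.

Lemma div_le (a b c : R) : 0 < b -> a <= c * b -> a / b <= c.
Proof.
  intros Hb H. apply (Rmult_le_reg_r b); auto.
  replace (a / b * b) with a by (field; lra). exact H.
Qed.

Lemma le_div (a b c : R) : 0 < b -> c * b <= a -> c <= a / b.
Proof.
  intros Hb H. apply (Rmult_le_reg_r b); auto.
  replace (a / b * b) with a by (field; lra). exact H.
Qed.

Lemma RInt_comp_lin_R (f : R -> R) (u v a b : R) : (forall t, continuous f t) ->
  RInt (fun y => u * f (u * y + v)) a b = RInt f (u * a + v) (u * b + v).
Proof.
  intros H. apply (RInt_comp_lin (V := R_CompleteNormedModule) f u v a b).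
  apply (ex_RInt_continuous (V := R_CompleteNormedModule)). auto.
Qed.

Lemma RInt_comp_R (f g dg : R -> R) (a b : R) : a <= b ->
  (forall t, a <= t <= b -> continuous f (g t)) ->
  (forall t, a <= t <= b -> is_derive g t (dg t)) ->
  (forall t, a <= t <= b -> continuous dg t) ->
  RInt (fun t => dg t * f (g t)) a b = RInt f (g a) (g b).
Proof.
  intros Hab H1 H2 H3. apply (RInt_comp (V := R_CompleteNormedModule) f g dg a b);
  rewrite Rmin_left, Rmax_right by lra; auto.
Qed.

Ltac ringR := match goal with |- @eq _ ?a ?b => change (@eq R a b); ring end.
Ltac fieldR := match goal with |- @eq _ ?a ?b => change (@eq R a b); field end.

(** * Lengths of curves *)

(** The value 1 is m'(0), so this is the continuous extension of m(r)/r, the factor by which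
    tangential lengths differ from Euclidean ones. *)
Definition mu (m : R -> R) (r : R) : R := if Req_EM_T r 0 then 1 else m r / r.

Definition speed (m : R -> R) (c : R -> pt) (t : R) : R :=
  sqrt (gm m (c t) (vel c t) (vel c t)).

Lemma profile_derive m (Hm : profile m) x : is_derive m x (Derive m x).
Proof. apply Derive_correct. exact (proj1 Hm 1%nat x). Qed.

Lemma profile_cont m (Hm : profile m) x : continuous m x.
Proof. eapply deriv_cont, profile_derive; auto. Qed.

Lemma profile_derive2 m (Hm : profile m) x : is_derive (Derive m) x (Derive_n m 2 x).
Proof. apply Derive_correct. exact (proj1 Hm 2%nat x). Qed.

Lemma profile_cont1 m (Hm : profile m) x : continuous (Derive m) x.
Proof. eapply deriv_cont, profile_derive2; auto. Qed.

Lemma profile_cont2 m (Hm : profile m) x : continuous (Derive_n m 2) x.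
Proof.
  apply (ex_derive_continuous (V := R_NormedModule)). exact (proj1 Hm 3%nat x).
Qed.

Lemma profile_0 m (Hm : profile m) : m 0 = 0.
Proof. apply Hm. Qed.

Lemma profile_pos m (Hm : profile m) x : 0 < x -> 0 < m x.
Proof. apply Hm. Qed.

Lemma mu_cont m (Hm : profile m) x : continuous (mu m) x.
Proof.
  destruct (Req_dec x 0) as [->|Hx].
  - apply cont_eps. intros e He.
    pose proof (profile_derive m Hm 0) as Hd.
    replace (Derive m 0) with 1 in Hd by (symmetry; apply Hm).
    apply is_derive_Reals in Hd. destruct (Hd e He) as [d H].
    exists d; split; [apply cond_pos|]. intros y Hy. unfold mu at 2.
    destruct (Req_EM_T 0 0) as [_|n]; [|lra].
    unfold mu. destruct (Req_EM_T y 0) as [_|n].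
    + rewrite Rminus_diag, Rabs_R0; auto.
    + rewrite Rminus_0_r in Hy. specialize (H y n Hy).
      rewrite Rplus_0_l, (profile_0 m Hm), Rminus_0_r in H. exact H.
  - apply (continuous_ext_loc _ (fun r => m r / r)).
    + exists (mkposreal (Rabs x) (Rabs_pos_lt _ Hx)). intros y Hy.
      simpl in Hy. unfold ball in Hy; simpl in Hy.
      unfold AbsRing_ball, abs, minus, plus, opp in Hy; simpl in Hy.
      unfold mu. destruct (Req_EM_T y 0) as [->|_]; auto.
      rewrite Rplus_0_l, Rabs_Ropp in Hy. lra.
    + cont; auto. now apply profile_cont.
Qed.

Lemma dot_ge0 p : 0 <= dot p p.
Proof. unfold dot. nra. Qed.

Lemma enorm_ge0 p : 0 <= enorm p.
Proof. apply sqrt_pos. Qed.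

Lemma enorm_sq p : enorm p * enorm p = dot p p.
Proof. apply sqrt_sqrt, dot_ge0. Qed.

Lemma dot_cs p v : (dot p v) ^ 2 <= dot p p * dot v v.
Proof.
  unfold dot. pose proof (pow2_ge_0 (fst p * snd v - snd p * fst v)). nra.
Qed.

Lemma enorm_eq0 p : enorm p = 0 -> p = origin.
Proof.
  intros H. pose proof (enorm_sq p) as E. rewrite H in E. unfold dot in E.
  destruct p as [x y]; simpl in E. unfold origin. f_equal; nra.
Qed.

Lemma radial_le p v : enorm p <> 0 -> (dot p v / enorm p) ^ 2 <= dot v v.
Proof.
  intros H0. pose proof (enorm_sq p) as H. pose proof (enorm_ge0 p). pose proof (dot_cs p v).
  assert (0 < enorm p) by lra.
  replace ((dot p v / enorm p) ^ 2) with ((dot p v) ^ 2 / (enorm p * enorm p)) by (field; lra).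
  apply div_le; [nra|]. rewrite H. lra.
Qed.

(** A form of the metric that is valid at the origin too: the factor [1 - mu^2] vanishes there and
    removes the ill-defined radial component. *)
Lemma gm_eq m p v : gm m p v v =
  (mu m (enorm p)) ^ 2 * dot v v + (1 - (mu m (enorm p)) ^ 2) * (dot p v / enorm p) ^ 2.
Proof.
  unfold gm, mu. destruct (Req_EM_T (enorm p) 0) as [E|n]; [ring|]. cbv zeta. ring.
Qed.

Lemma gm_ge0 m p v : 0 <= gm m p v v.
Proof.
  rewrite gm_eq. unfold mu. destruct (Req_EM_T (enorm p) 0) as [E|n].
  - pose proof (dot_ge0 v). nra.
  - pose proof (radial_le p v n). pose proof (pow2_ge_0 (m (enorm p) / enorm p)).
    pose proof (pow2_ge_0 (dot p v / enorm p)). nra.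
Qed.

Lemma gm_ge_radial m p v : enorm p <> 0 -> (dot p v / enorm p) ^ 2 <= gm m p v v.
Proof.
  intros n. rewrite gm_eq. pose proof (radial_le p v n).
  pose proof (pow2_ge_0 (mu m (enorm p))). nra.
Qed.

Section Curve.
Context (m : R -> R) (Hm : profile m) (c : R -> pt) (Hc : C1_curve c).

Let x := fun t => fst (c t).
Let y := fun t => snd (c t).
Let dx := Derive x.
Let dy := Derive y.

Lemma curve_dx t : is_derive x t (dx t).
Proof. apply Derive_correct, Hc. Qed.
Lemma curve_dy t : is_derive y t (dy t).
Proof. apply Derive_correct, Hc. Qed.
Lemma curve_cdx t : continuous dx t.
Proof. exact (proj1 (proj2 (proj2 Hc)) t). Qed.
Lemma curve_cdy t : continuous dy t.
Proof. exact (proj2 (proj2 (proj2 Hc)) t). Qed.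
Lemma curve_cx t : continuous x t.
Proof. eapply deriv_cont, curve_dx. Qed.
Lemma curve_cy t : continuous y t.
Proof. eapply deriv_cont, curve_dy. Qed.

Lemma enorm_curve_cont t : continuous (fun t => enorm (c t)) t.
Proof.
  pose proof (curve_cx t); pose proof (curve_cy t).
  apply (continuous_ext (fun t => sqrt (x t * x t + y t * y t))); [reflexivity|].
  cont.
Qed.

Lemma speed_ge0 t : 0 <= speed m c t.
Proof. apply sqrt_pos. Qed.

Lemma speed_cont t : continuous (speed m c) t.
Proof.
  pose proof (curve_cx t); pose proof (curve_cy t).
  pose proof (curve_cdx t); pose proof (curve_cdy t).
  assert (Hr := enorm_curve_cont t).
  assert (Hmu : continuous (fun t => mu m (enorm (c t))) t)
    by (apply (cont_comp (fun t => enorm (c t)) (mu m)); auto; now apply mu_cont).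
  assert (Hv : continuous (fun t => dot (vel c t) (vel c t)) t).
  { apply (continuous_ext (fun t => dx t * dx t + dy t * dy t)); [reflexivity|]. cont. }
  apply (cont_sqrt (fun t => gm m (c t) (vel c t) (vel c t))).
  apply (continuous_ext (fun t => (mu m (enorm (c t))) ^ 2 * dot (vel c t) (vel c t)
    + (1 - (mu m (enorm (c t))) ^ 2) * (dot (c t) (vel c t) / enorm (c t)) ^ 2)).
  { intros; now rewrite gm_eq. }
  destruct (Req_dec (enorm (c t)) 0) as [E|n].
  - apply (cont_squeeze _ (fun t => mu m (enorm (c t)) ^ 2 * dot (vel c t) (vel c t))
      (fun t => Rabs (1 - mu m (enorm (c t)) ^ 2) * dot (vel c t) (vel c t))).
    + cont.
    + cont.
    + rewrite E. unfold mu. destruct (Req_EM_T 0 0); [|lra].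
      replace (1 - 1 ^ 2) with 0 by ring. rewrite Rabs_R0. ring.
    + rewrite E. unfold mu. destruct (Req_EM_T 0 0); [|lra]. ring.
    + intros s.
      replace (_ - _) with ((1 - mu m (enorm (c s)) ^ 2) * (dot (c s) (vel c s) / enorm (c s)) ^ 2) by ring.
      rewrite Rabs_mult. apply Rmult_le_compat_l; [apply Rabs_pos|].
      rewrite Rabs_pos_eq by apply pow2_ge_0.
      destruct (Req_dec (enorm (c s)) 0) as [E'|n'].
      (* Division by zero yields 0, so the bound is trivial where the curve is at the origin. *)
      * rewrite E'. unfold Rdiv. rewrite Rinv_0. pose proof (dot_ge0 (vel c s)). nra.
      * now apply radial_le.
  - assert (continuous (fun t => dot (c t) (vel c t)) t).
    { apply (continuous_ext (fun t => x t * dx t + y t * dy t)); [reflexivity|]. cont. }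
    cont.
Qed.

Lemma ex_RInt_speed a b : ex_RInt (speed m c) a b.
Proof.
  apply (ex_RInt_continuous (V := R_CompleteNormedModule)). intros; apply speed_cont.
Qed.

Lemma RInt_speed_ge0 a b : a <= b -> 0 <= RInt (speed m c) a b.
Proof.
  intros. apply RInt_pos; auto; intros; [apply speed_cont|apply speed_ge0].
Qed.

Lemma radial_speed t : Rabs (dot (c t) (vel c t)) <= enorm (c t) * speed m c t.
Proof.
  destruct (Req_dec (enorm (c t)) 0) as [E|n].
  - rewrite E, Rmult_0_l. pose proof (dot_cs (c t) (vel c t)).
    rewrite <- enorm_sq, E in H. rewrite !Rmult_0_l in H.
    assert (dot (c t) (vel c t) = 0) as -> by nra. rewrite Rabs_R0; lra.
  - pose proof (enorm_ge0 (c t)).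
    pose proof (gm_ge_radial m (c t) (vel c t) n).
    replace (Rabs (dot (c t) (vel c t))) with
      (enorm (c t) * Rabs (dot (c t) (vel c t) / enorm (c t))).
    + apply Rmult_le_compat_l; auto. unfold speed. rewrite <- sqrt_Rsqr_abs.
      apply sqrt_le_1_alt. unfold Rsqr. simpl in H0. lra.
    + rewrite Rabs_div by lra. rewrite (Rabs_pos_eq (enorm _)) by lra. field; lra.
Qed.

(** Smoothing the radius to [sqrt (r^2 + e^2)] handles curves through the origin. *)
Lemma length_radial a b : a <= b ->
  Rabs (enorm (c b) - enorm (c a)) <= RInt (speed m c) a b.
Proof.
  intros Hab.
  set (L := RInt (speed m c) a b).
  assert (HL : forall e, 0 < e ->
    Rabs (sqrt (dot (c b) (c b) + e ^ 2) - sqrt (dot (c a) (c a) + e ^ 2)) <= L).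
  { intros e He.
    set (N := fun t => sqrt (dot (c t) (c t) + e ^ 2)).
    set (dN := fun t => dot (c t) (vel c t) / N t).
    assert (HNpos : forall t, 0 < N t).
    { intros t. apply sqrt_lt_R0. pose proof (dot_ge0 (c t)). nra. }
    assert (HN : forall t, is_derive N t (dN t)).
    { intros t. unfold dN.
      apply (is_derive_ext (fun t => sqrt (x t * x t + y t * y t + e ^ 2))); [reflexivity|].
      pose proof (curve_dx t) as Dx. pose proof (curve_dy t) as Dy.
      pose proof (dot_ge0 (c t)) as Hd. unfold dot in Hd.
      fold (x t) (y t) in Hd.
      assert (Hp : 0 < x t * x t + y t * y t + e ^ 2) by nra.
      auto_derive.
      - repeat split; try (eexists; eassumption). simpl in Hp. lra.
      - change (Derive (fun x0 => x x0) t) with (dx t).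
        change (Derive (fun x0 => y x0) t) with (dy t).
        change (dot (c t) (vel c t)) with (x t * dx t + y t * dy t).
        change (N t) with (sqrt (x t * x t + y t * y t + e ^ 2)).
        replace (e * (e * 1)) with (e ^ 2) by ring.
        field. apply Rgt_not_eq, sqrt_lt_R0, Hp. }
    assert (HNr : forall t, enorm (c t) <= N t).
    { intros t. apply sqrt_le_1_alt. nra. }
    assert (HdN : forall t, Rabs (dN t) <= speed m c t).
    { intros t. unfold dN. rewrite Rabs_div by (apply Rgt_not_eq, HNpos).
      rewrite (Rabs_pos_eq (N t)) by (apply Rlt_le, HNpos).
      apply div_le; [apply HNpos|].
      eapply Rle_trans; [apply radial_speed|]. rewrite Rmult_comm.
      apply Rmult_le_compat_l; [apply speed_ge0|apply HNr]. }
    assert (HdNc : forall t, continuous dN t).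
    { intros t. pose proof (curve_cx t); pose proof (curve_cy t).
      pose proof (curve_cdx t); pose proof (curve_cdy t).
      assert (continuous N t) by (eapply deriv_cont, HN).
      assert (continuous (fun t => dot (c t) (vel c t)) t).
      { apply (continuous_ext (fun t => x t * dx t + y t * dy t)); [reflexivity|]. cont. }
      unfold dN. cont. apply Rgt_not_eq, HNpos. }
    fold (N b) (N a). rewrite <- (RInt_deriv N dN a b) by auto.
    eapply Rle_trans; [apply abs_RInt_le; auto; apply ex_RInt_cont; auto|].
    apply RInt_le_cont; auto; intros; [cont; auto|apply speed_cont]. }
  apply le_of_eps. intros e He.
  specialize (HL (e / 2) ltac:(lra)).
  assert (Hs : forall p, enorm p <= sqrt (dot p p + (e / 2) ^ 2) <= enorm p + e / 2).
  { intros p. pose proof (enorm_ge0 p). pose proof (enorm_sq p). split.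
    - apply sqrt_le_1_alt. nra.
    - rewrite <- (sqrt_Rsqr (enorm p + e / 2)) by lra. apply sqrt_le_1_alt.
      unfold Rsqr. nra. }
  pose proof (Hs (c a)). pose proof (Hs (c b)).
  revert HL. unfold Rabs. do 2 destruct Rcase_abs; lra.
Qed.

End Curve.

(** [1 - sqrt (1 - (k/m)^2)]: the deficit of the radial speed of a geodesic with Clairaut constant [k]. *)
Definition wdef (m : R -> R) (k x : R) : R := 1 - sqrt (1 - (k / m x) ^ 2).

Lemma wdef_cont m (Hm : profile m) k x : 0 < x -> continuous (wdef m k) x.
Proof.
  intros Hx. pose proof (profile_cont m Hm x). pose proof (profile_pos m Hm x Hx).
  unfold wdef. cont. lra.
Qed.

Lemma wdef_range m k x : 0 <= wdef m k x <= 1.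
Proof.
  unfold wdef. pose proof (sqrt_pos (1 - (k / m x) ^ 2)).
  assert (sqrt (1 - (k / m x) ^ 2) <= 1).
  { rewrite <- sqrt_1 at 2. apply sqrt_le_1_alt. pose proof (pow2_ge_0 (k / m x)). lra. }
  lra.
Qed.

(** The Cauchy-Schwarz inequality behind the calibration by [a k dtheta + b sqrt (1 - (k/m)^2) dr]. *)
Lemma speed_lower (P Q k M a b s : R) :
  0 < M -> 0 <= k <= M -> 0 <= s -> s ^ 2 = P ^ 2 + M ^ 2 * Q ^ 2 ->
  Rabs a <= 1 -> Rabs b <= 1 ->
  a * k * Q + b * (sqrt (1 - (k / M) ^ 2) * P) <= s.
Proof.
  intros HM [Hk1 Hk2] Hs E Ha Hb.
  set (u := k / M). assert (Hu : 0 <= u <= 1).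
  { unfold u; split; [apply Rdiv_le_0_compat; lra | apply div_le; lra]. }
  assert (Hv : 0 <= sqrt (1 - u ^ 2)) by apply sqrt_pos.
  assert (Hv2 : sqrt (1 - u ^ 2) ^ 2 = 1 - u ^ 2) by (rewrite <- Rsqr_pow2; apply Rsqr_sqrt; nra).
  set (v := sqrt (1 - u ^ 2)) in *.
  replace (a * k * Q) with (a * u * (M * Q)) by (unfold u; field; lra).
  set (q := M * Q). assert (E' : s ^ 2 = P ^ 2 + q ^ 2) by (unfold q; rewrite E; ring).
  assert (Ha2 : a ^ 2 <= 1) by (rewrite <- (pow2_abs a); pose proof (Rabs_pos a); nra).
  assert (Hb2 : b ^ 2 <= 1) by (rewrite <- (pow2_abs b); pose proof (Rabs_pos b); nra).
  assert (H : (a * u * q + b * (v * P)) ^ 2 <= s ^ 2).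
  { assert ((a * u * q + b * (v * P)) ^ 2 <= ((a * u) ^ 2 + (b * v) ^ 2) * (q ^ 2 + P ^ 2)).
    { pose proof (pow2_ge_0 (a * u * P - b * v * q)). nra. }
    assert ((a * u) ^ 2 + (b * v) ^ 2 <= 1).
    { pose proof (pow2_ge_0 u). pose proof (pow2_ge_0 v). rewrite !Rpow_mult_distr. nra. }
    pose proof (pow2_ge_0 q). pose proof (pow2_ge_0 P). nra. }
  apply Rnot_lt_le. intros Hl. nra.
Qed.

(** * Calibrated lower bounds for curves that avoid the origin *)

Section Cal.
Context (m : R -> R) (Hm : profile m) (c : R -> pt) (Hc : C1_curve c).
Let x := fun t => fst (c t).
Let y := fun t => snd (c t).
Let dx := Derive x.
Let dy := Derive y.
Let r := fun t => enorm (c t).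

(** Angular velocity, with the denominator truncated so that it is defined on the whole line. *)
Definition omega (d : R) (t : R) : R :=
  (fst (c t) * snd (vel c t) - snd (c t) * fst (vel c t)) / Rmax (dot (c t) (c t)) d.

Lemma omega_cont d t : 0 < d -> continuous (omega d) t.
Proof.
  intros Hd.
  pose proof (curve_cx c Hc t) as H1. pose proof (curve_cy c Hc t) as H2.
  pose proof (curve_cdx c Hc t) as H3. pose proof (curve_cdy c Hc t) as H4.
  fold x in H1. fold y in H2.
  apply (continuous_ext (fun t => (x t * dy t - y t * dx t) /
    ((x t * x t + y t * y t + d + Rabs (x t * x t + y t * y t - d)) / 2))).
  - intros s. unfold omega. f_equal. change (dot (c s) (c s)) with (x s * x s + y s * y s).
    unfold Rmax. destruct Rle_dec as [Hl|Hl].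
    + rewrite Rabs_left1 by lra. field.
    + rewrite Rabs_pos_eq by lra. field.
  - assert (0 <= x t * x t + y t * y t) by nra.
    pose proof (Rabs_pos (x t * x t + y t * y t - d)).
    cont; lra.
Qed.

Lemma r_derive t : 0 < r t -> is_derive r t (dot (c t) (vel c t) / r t).
Proof.
  intros Hp. unfold r.
  apply (is_derive_ext (fun t => sqrt (x t * x t + y t * y t))); [reflexivity|].
  pose proof (curve_dx c Hc t) as Dx. pose proof (curve_dy c Hc t) as Dy.
  fold x in Dx. fold y in Dy.
  assert (Hq : 0 < x t * x t + y t * y t).
  { pose proof (enorm_sq (c t)) as E. unfold dot in E. fold (x t) (y t) in E.
    rewrite <- E. fold (r t). nra. }
  auto_derive.
  - repeat split; try (eexists; eassumption). lra.
  - change (Derive (fun x0 => x x0) t) with (dx t).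
    change (Derive (fun x0 => y x0) t) with (dy t).
    change (dot (c t) (vel c t)) with (x t * dx t + y t * dy t).
    change (enorm (c t)) with (sqrt (x t * x t + y t * y t)).
    field. apply Rgt_not_eq, sqrt_lt_R0, Hq.
Qed.

Lemma speed_polar d t : 0 < r t -> d <= dot (c t) (c t) ->
  speed m c t ^ 2 = (dot (c t) (vel c t) / r t) ^ 2 + m (r t) ^ 2 * omega d t ^ 2.
Proof.
  intros Hp Hd. unfold speed. rewrite <- Rsqr_pow2, Rsqr_sqrt by apply gm_ge0.
  unfold omega. rewrite Rmax_left by exact Hd.
  unfold gm. fold (r t). destruct (Req_EM_T (r t) 0) as [E|_]; [lra|]. cbv zeta.
  pose proof (enorm_sq (c t)) as E. fold (r t) in E.
  rewrite <- E.
  set (A := dot (c t) (vel c t)).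
  (* Lagrange's identity: |c|^2 |v|^2 is the sum of the squares of the scalar product and the cross
     product. *)
  assert (EA : dot (vel c t) (vel c t) * (r t * r t) =
     A * A + (fst (c t) * snd (vel c t) - snd (c t) * fst (vel c t)) ^ 2).
  { rewrite E. unfold A, dot. ring. }
  set (B := fst (c t) * snd (vel c t) - snd (c t) * fst (vel c t)) in *.
  assert (EV : dot (vel c t) (vel c t) = (A * A + B ^ 2) / (r t * r t)).
  { rewrite <- EA. field. lra. }
  rewrite EV. field. lra.
Qed.

Section Interval.
Context (a b d : R) (Hab : a <= b) (Hd : 0 < d)
  (Hlow : forall t, a <= t <= b -> d <= dot (c t) (c t)).

Lemma r_pos t : a <= t <= b -> 0 < r t.
Proof.
  intros Ht. specialize (Hlow t Ht). apply sqrt_lt_R0. lra.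
Qed.

(** Integrates [speed_lower] over time. The calibrating form is closed, so its radial part depends
    only on the end radii. The factor [e1] takes care of the direction of rotation, [e2] of inward
    or outward motion. *)
Lemma calibration (k e1 e2 : R) :
  0 <= k -> (forall t, a <= t <= b -> k <= m (r t)) ->
  Rabs e1 <= 1 -> Rabs e2 <= 1 ->
  e1 * k * RInt (omega d) a b + e2 * RInt (fun z => 1 - wdef m k z) (r a) (r b)
  <= RInt (speed m c) a b.
Proof.
  intros Hk Hkm He1 He2.
  set (dr := fun t => dot (c t) (vel c t) / r t).
  assert (Hrc : forall t, continuous r t) by (intros; now apply enorm_curve_cont).
  assert (Hdrc : forall t, a <= t <= b -> continuous dr t).
  { intros t Ht.
    pose proof (curve_cx c Hc t) as H1. pose proof (curve_cy c Hc t) as H2.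
    pose proof (curve_cdx c Hc t) as H3. pose proof (curve_cdy c Hc t) as H4.
    assert (continuous (fun t => dot (c t) (vel c t)) t).
    { apply (continuous_ext (fun t => x t * dx t + y t * dy t)); [reflexivity|].
      fold x in H1. fold y in H2. cont. }
    pose proof (r_pos t Ht). pose proof (Hrc t). unfold dr. cont. lra. }
  assert (Hgc : forall t, a <= t <= b -> continuous (fun t => 1 - wdef m k (r t)) t).
  { intros t Ht. cont. apply (cont_comp r (wdef m k)); auto.
    apply wdef_cont; auto. now apply r_pos. }
  assert (E : RInt (fun z => 1 - wdef m k z) (r a) (r b) =
              RInt (fun t => (1 - wdef m k (r t)) * dr t) a b).
  { rewrite <- (RInt_comp (V := R_CompleteNormedModule) (fun z => 1 - wdef m k z) r dr a b).
    - apply RInt_ext. intros; unfold scal; simpl; unfold mult; simpl; ring.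
    - rewrite Rmin_left, Rmax_right by lra. intros t Ht. cont.
      apply wdef_cont; auto. now apply r_pos.
    - rewrite Rmin_left, Rmax_right by lra. intros t Ht. split; auto.
      apply r_derive. now apply r_pos. }
  rewrite E.
  assert (Hoc : forall t, continuous (fun t => e1 * k * omega d t) t).
  { intros t. cont. now apply omega_cont. }
  assert (Hg1 : forall t, a <= t <= b -> continuous (fun t => (1 - wdef m k (r t)) * dr t) t).
  { intros t Ht. apply (cont_mult (fun t => 1 - wdef m k (r t)) dr); auto. }
  assert (Hg2 : forall t, a <= t <= b -> continuous (fun t => e2 * ((1 - wdef m k (r t)) * dr t)) t).
  { intros t Ht. apply (cont_mult (fun _ => e2)); [apply continuous_const|auto]. }
  rewrite <- (RInt_scal_cont (omega d)) by (auto; intros; now apply omega_cont).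
  rewrite <- RInt_scal_cont by auto.
  rewrite <- RInt_plus_cont by auto.
  apply RInt_le_cont; auto.
  - intros; apply cont_plus; auto.
  - intros; now apply speed_cont.
  - intros t Ht. pose proof (r_pos t Ht) as Hp.
    unfold wdef. replace (1 - (1 - sqrt (1 - (k / m (r t)) ^ 2))) with (sqrt (1 - (k / m (r t)) ^ 2)) by ring.
    apply speed_lower; auto.
    + now apply profile_pos.
    + apply speed_ge0.
    + apply speed_polar; auto.
Qed.

(** [P] and [Q] are the coordinates of the unit vector c/r rotated back by the accumulated angle
    [th]; their derivatives vanish. So the integral of [omega] is an angle between the end points,
    and no branch of the polar angle has to be chosen. *)
Lemma angle_lift :
  dot (c a) (c b) = r a * r b * cos (RInt (omega d) a b).
Proof.
  set (th := fun t => RInt (omega d) a t).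
  assert (Hth : forall t, is_derive th t (omega d t)).
  { intros t. apply is_derive_RInt_cont. intros; now apply omega_cont. }
  set (P := fun t => (x t * cos (th t) + y t * sin (th t)) / r t).
  set (Q := fun t => (- x t * sin (th t) + y t * cos (th t)) / r t).
  assert (HP : forall t, a <= t <= b -> is_derive P t 0 /\ is_derive Q t 0).
  { intros t Ht. pose proof (r_pos t Ht) as Hp.
    pose proof (curve_dx c Hc t) as Dx. pose proof (curve_dy c Hc t) as Dy.
    fold x in Dx. fold y in Dy. pose proof (r_derive t Hp) as Dr. pose proof (Hth t) as Dt.
    pose proof (is_derive_unique _ _ _ Dr) as Er. pose proof (is_derive_unique _ _ _ Dt) as Et.
    assert (Eo : omega d t = (x t * dy t - y t * dx t) / (r t * r t)).
    { unfold omega. rewrite Rmax_left by auto. rewrite <- enorm_sq. reflexivity. }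
    change (dot (c t) (vel c t)) with (x t * dx t + y t * dy t) in Er.
    assert (Rsq : r t * r t = x t * x t + y t * y t) by apply enorm_sq.
    split; unfold P, Q.
    - auto_derive.
      + repeat split; try (eexists; eassumption). lra.
      + change (Derive (fun x0 => x x0) t) with (dx t).
        change (Derive (fun x0 => y x0) t) with (dy t).
        change (Derive (fun x0 => r x0) t) with (Derive r t).
        change (Derive (fun x0 => th x0) t) with (Derive th t).
        rewrite Er, Et, Eo. set (R0 := r t) in *. set (cs := cos (th t)). set (sn := sin (th t)).
        apply (Rmult_eq_reg_r (R0 ^ 3)); [|apply pow_nonzero; lra].
        rewrite Rmult_0_l.
        transitivity ((cs * dx t + sn * dy t) * (R0 * R0)
          + (x t * dy t - y t * dx t) * (y t * cs - x t * sn)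
          - (x t * dx t + y t * dy t) * (x t * cs + y t * sn)); [field; lra|].
        rewrite Rsq. ring.
    - auto_derive.
      + repeat split; try (eexists; eassumption). lra.
      + change (Derive (fun x0 => x x0) t) with (dx t).
        change (Derive (fun x0 => y x0) t) with (dy t).
        change (Derive (fun x0 => r x0) t) with (Derive r t).
        change (Derive (fun x0 => th x0) t) with (Derive th t).
        rewrite Er, Et, Eo. set (R0 := r t) in *. set (cs := cos (th t)). set (sn := sin (th t)).
        apply (Rmult_eq_reg_r (R0 ^ 3)); [|apply pow_nonzero; lra].
        rewrite Rmult_0_l.
        transitivity ((- sn * dx t + cs * dy t) * (R0 * R0)
          + (x t * dy t - y t * dx t) * (- x t * cs - y t * sn)
          - (x t * dx t + y t * dy t) * (- x t * sn + y t * cs)); [field; lra|].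
        rewrite Rsq. ring. }
  assert (EP : P a = P b).
  { apply Rle_antisym.
    - apply (mono_of_deriv P (fun _ => 0)); auto; [apply HP|intros; lra].
    - assert (- P a <= - P b); [|lra].
      apply (mono_of_deriv (fun t => - P t) (fun _ => 0)); auto; [|intros; lra].
      intros t Ht. rewrite <- Ropp_0. apply (is_derive_opp P t 0). now apply HP. }
  assert (EQ : Q a = Q b).
  { apply Rle_antisym.
    - apply (mono_of_deriv Q (fun _ => 0)); auto; [apply HP|intros; lra].
    - assert (- Q a <= - Q b); [|lra].
      apply (mono_of_deriv (fun t => - Q t) (fun _ => 0)); auto; [|intros; lra].
      intros t Ht. rewrite <- Ropp_0. apply (is_derive_opp Q t 0). now apply HP. }
  assert (T0 : th a = 0) by (unfold th; rewrite RInt_point; reflexivity).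
  unfold P in EP; unfold Q in EQ. rewrite T0, cos_0, sin_0 in EP, EQ.
  fold (th b). pose proof (r_pos a ltac:(lra)) as Pa. pose proof (r_pos b ltac:(lra)) as Pb.
  assert (Rsq : r b * r b = x b * x b + y b * y b) by apply enorm_sq.
  set (cs := cos (th b)) in *. set (sn := sin (th b)) in *.
  change (dot (c a) (c b)) with (x a * x b + y a * y b).
  assert (Ex : x a = r a * ((x b * cs + y b * sn) / r b)).
  { rewrite <- EP. field. lra. }
  assert (Ey : y a = r a * ((- x b * sn + y b * cs) / r b)).
  { rewrite <- EQ. field. lra. }
  rewrite Ex, Ey.
  transitivity (r a * cs * (x b * x b + y b * y b) / r b); [field; lra|].
  rewrite <- Rsq. field. lra.
Qed.

End Interval.
End Cal.

Lemma C1_intro (x y dx dy : R -> R) :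
  (forall t, is_derive x t (dx t)) -> (forall t, is_derive y t (dy t)) ->
  (forall t, continuous dx t) -> (forall t, continuous dy t) ->
  C1_curve (fun t => (x t, y t)) /\ forall t, vel (fun t => (x t, y t)) t = (dx t, dy t).
Proof.
  intros Hx Hy Cx Cy. simpl.
  assert (Ex : forall t, Derive (fun s => fst (x s, y s)) t = dx t)
    by (intros; now apply is_derive_unique, Hx).
  assert (Ey : forall t, Derive (fun s => snd (x s, y s)) t = dy t)
    by (intros; now apply is_derive_unique, Hy).
  split.
  - split; [|split; [|split]]; intros t.
    + exists (dx t). apply Hx.
    + exists (dy t). apply Hy.
    + apply (continuous_ext dx); [intros; now rewrite Ex|apply Cx].
    + apply (continuous_ext dy); [intros; now rewrite Ey|apply Cy].
  - intros t. unfold vel. now rewrite Ex, Ey.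
Qed.

(** * The distance *)

Definition smul (l : R) (v : pt) : pt := (l * fst v, l * snd v).

Lemma gm_smul m p v l : gm m p (smul l v) (smul l v) = l ^ 2 * gm m p v v.
Proof.
  unfold gm, smul, dot; simpl. destruct Req_EM_T; [ring|]. unfold Rdiv. ring.
Qed.

Lemma speed_ext m (c1 c2 : R -> pt) t l s : c2 t = c1 s -> vel c2 t = smul l (vel c1 s) -> 0 <= l ->
  speed m c2 t = l * speed m c1 s.
Proof.
  intros E1 E2 Hl. unfold speed. rewrite E1, E2, gm_smul.
  rewrite sqrt_mult_alt by apply pow2_ge_0. f_equal. now apply sqrt_pow2.
Qed.

Lemma curve_comp (c : R -> pt) (f df : R -> R) : C1_curve c ->
  (forall t, is_derive f t (df t)) -> (forall t, continuous df t) ->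
  C1_curve (fun t => c (f t)) /\ forall t, vel (fun t => c (f t)) t = smul (df t) (vel c (f t)).
Proof.
  intros Hc Hf Hdf.
  set (x := fun t => fst (c t)). set (y := fun t => snd (c t)).
  assert (Hx : forall t, is_derive (fun t => x (f t)) t (df t * Derive x (f t))).
  { intros t. apply (is_derive_comp x f); auto. now apply curve_dx. }
  assert (Hy : forall t, is_derive (fun t => y (f t)) t (df t * Derive y (f t))).
  { intros t. apply (is_derive_comp y f); auto. now apply curve_dy. }
  assert (Cf : forall t, continuous f t) by (intros; eapply deriv_cont, Hf).
  destruct (C1_intro (fun t => x (f t)) (fun t => y (f t)) _ _ Hx Hy) as [H1 H2].
  - intros t. apply cont_mult; auto. apply cont_comp; auto. apply curve_cdx; auto.
  - intros t. apply cont_mult; auto. apply cont_comp; auto. apply curve_cdy; auto.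
  - split.
    + exact H1.
    + intros t. exact (H2 t).
Qed.

Section Dist.
Context (m : R -> R) (Hm : profile m).

(** [real] loses nothing, since [dist_finite] excludes infinite distances. *)
Definition dr (p q : pt) : R := real (dist_m m p q).

Definition lengths (p q : pt) : R -> Prop :=
  fun L => exists c, C1_curve c /\ c 0 = p /\ c 1 = q /\ L = curve_length m c.

Lemma curve_length_speed c : curve_length m c = RInt (speed m c) 0 1.
Proof. reflexivity. Qed.

Lemma lengths_ge0 p q L : lengths p q L -> 0 <= L.
Proof.
  intros [c [Hc [_ [_ ->]]]]. rewrite curve_length_speed. apply RInt_speed_ge0; auto. lra.
Qed.

Lemma straight_C1 (p q : pt) :
  C1_curve (fun t => (fst p + t * (fst q - fst p), snd p + t * (snd q - snd p))) /\
  forall t, vel (fun t => (fst p + t * (fst q - fst p), snd p + t * (snd q - snd p))) t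
            = (fst q - fst p, snd q - snd p).
Proof.
  apply C1_intro with (dx := fun _ => fst q - fst p) (dy := fun _ => snd q - snd p);
    intros; try apply continuous_const; auto_derive; auto; ring.
Qed.

Lemma lengths_nonempty p q : exists L, lengths p q L.
Proof.
  destruct (straight_C1 p q) as [H _]. eexists. eexists. split; [exact H|].
  split; [|split; [|reflexivity]].
  - destruct p; simpl; f_equal; ring.
  - destruct q; simpl; f_equal; ring.
Qed.

Lemma dist_glb p q : is_glb_Rbar (lengths p q) (dist_m m p q).
Proof. apply Glb_Rbar_correct. Qed.

Lemma dist_finite p q : dist_m m p q = Finite (dr p q).
Proof.
  destruct (dist_glb p q) as [H1 H2]. unfold dr.
  destruct (lengths_nonempty p q) as [L HL]. specialize (H1 L HL).
  assert (H0 : Rbar_le 0 (dist_m m p q)).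
  { apply H2. intros x Hx. simpl. eapply lengths_ge0; eauto. }
  destruct (dist_m m p q); simpl in *; tauto.
Qed.

Lemma dr_le_length c : C1_curve c -> dr (c 0) (c 1) <= RInt (speed m c) 0 1.
Proof.
  intros Hc. destruct (dist_glb (c 0) (c 1)) as [H1 _]. rewrite dist_finite in H1.
  apply (H1 (curve_length m c)). exists c; auto.
Qed.

Lemma dr_ge p q L : (forall c, C1_curve c -> c 0 = p -> c 1 = q -> L <= RInt (speed m c) 0 1) ->
  L <= dr p q.
Proof.
  intros H. destruct (dist_glb p q) as [_ H2]. rewrite dist_finite in H2.
  apply (H2 (Finite L)). intros x [c [Hc [H0 [H1 ->]]]]. simpl. now apply H.
Qed.

Lemma dr_approx p q e : 0 < e ->
  exists c, C1_curve c /\ c 0 = p /\ c 1 = q /\ RInt (speed m c) 0 1 < dr p q + e.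
Proof.
  intros He. apply NNPP. intros Hn.
  assert (dr p q + e <= dr p q); [|lra].
  apply dr_ge. intros c H1 H2 H3. apply Rnot_lt_le. intros Hl. apply Hn. exists c; auto.
Qed.

Lemma dr_le_seg c a b : C1_curve c -> a <= b -> dr (c a) (c b) <= RInt (speed m c) a b.
Proof.
  intros Hc Hab.
  destruct (curve_comp c (fun t => (b - a) * t + a) (fun _ => b - a) Hc) as [H1 H2].
  { intros t. auto_derive; auto; ring. }
  { intros; apply continuous_const. }
  pose proof (dr_le_length _ H1) as H. simpl in H.
  replace ((b - a) * 0 + a) with a in H by ring.
  replace ((b - a) * 1 + a) with b in H by ring.
  eapply Rle_trans; [exact H|]. apply Req_le.
  transitivity (RInt (fun t => (b - a) * speed m c ((b - a) * t + a)) 0 1).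
  - apply RInt_ext_le; [lra|]. intros t _. apply speed_ext; auto. lra.
  - rewrite (RInt_comp_lin_R (speed m c)) by (intros; now apply speed_cont). f_equal; ring.
Qed.

Lemma dr_sym_le p q : dr q p <= dr p q.
Proof.
  apply dr_ge. intros c Hc E0 E1.
  destruct (curve_comp c (fun t => 1 - t) (fun _ => - 1) Hc) as [H1 H2].
  { intros t. auto_derive; auto; ring. }
  { intros; apply continuous_const. }
  pose proof (dr_le_length _ H1) as H. simpl in H.
  rewrite Rminus_0_r, Rminus_diag in H. rewrite E0, E1 in H.
  eapply Rle_trans; [exact H|]. apply Req_le.
  transitivity (RInt (fun t => (- 1) * ((- 1) * speed m c ((- 1) * t + 1))) 0 1).
  - apply RInt_ext_le; [lra|]. intros t _. unfold speed. rewrite H2, gm_smul.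
    replace ((- 1) ^ 2) with 1 by ring. rewrite Rmult_1_l.
    replace (- 1 * t + 1) with (1 - t) by ring. ring.
  - rewrite RInt_scal_cont; [|lra|].
    + rewrite (RInt_comp_lin_R (speed m c)) by (intros; now apply speed_cont).
      replace (- 1 * 0 + 1) with 1 by ring. replace (- 1 * 1 + 1) with 0 by ring.
      rewrite <- (opp_RInt_swap (V := R_CompleteNormedModule)) by (apply ex_RInt_speed; auto).
      unfold opp; simpl. ring.
    + intros. cont. apply (cont_comp (fun t => - 1 * t + 1) (speed m c)); [cont|].
      now apply speed_cont.
Qed.

Lemma dr_sym p q : dr p q = dr q p.
Proof. apply Rle_antisym; apply dr_sym_le. Qed.

(** A C^1 step: constant outside [0, 1/2], so that curves reparametrized by it can be glued. *)
Definition bump (x : R) : R := 48 * ((x * (/ 2 - x) + Rabs (x * (/ 2 - x))) / 2).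
Definition step (t : R) : R := RInt bump 0 t.

Lemma bump_cont t : continuous bump t.
Proof. unfold bump. cont; try lra. Qed.

Lemma bump_ge0 t : 0 <= bump t.
Proof. unfold bump. pose proof (Rle_abs (- (t * (/ 2 - t)))). rewrite Rabs_Ropp in H. lra. Qed.

Lemma step_derive t : is_derive step t (bump t).
Proof. apply is_derive_RInt_cont, bump_cont. Qed.

Lemma bump_out t : t <= 0 \/ / 2 <= t -> bump t = 0.
Proof. intros H. unfold bump. rewrite Rabs_left1; [field|nra]. Qed.

Lemma step_0 : step 0 = 0.
Proof. unfold step. now rewrite RInt_point. Qed.

Lemma step_neg t : t <= 0 -> step t = 0.
Proof.
  intros Ht. assert (E : RInt bump t 0 = RInt (fun _ => 0) t 0).
  { apply RInt_ext_le; auto. intros; apply bump_out; lra. }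
  rewrite RInt_const_R in E. pose proof (RInt_deriv step bump t 0 Ht) as H.
  rewrite H in E; [|intros; apply step_derive|intros; apply bump_cont].
  rewrite step_0 in E. lra.
Qed.

Lemma step_half : step (/ 2) = 1.
Proof.
  unfold step.
  rewrite (RInt_ext_le bump (fun x => 48 * (x * (/ 2 - x)))); [|lra|].
  (* The factor 48 in [bump] comes from here: x (1/2 - x) has integral 1/48 over [0, 1/2]. *)
  - rewrite (RInt_deriv (fun x => 12 * x ^ 2 - 16 * x ^ 3) (fun x => 48 * (x * (/ 2 - x))) 0 (/ 2)); [field|lra| |].
    + intros z _. auto_derive; auto. field.
    + intros z _. cont.
  - intros z Hz. unfold bump. rewrite Rabs_pos_eq; [field|nra].
Qed.

Lemma step_pos t : / 2 <= t -> step t = 1.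
Proof.
  intros Ht. assert (E : RInt bump (/ 2) t = RInt (fun _ => 0) (/ 2) t).
  { apply RInt_ext_le; auto. intros; apply bump_out; lra. }
  rewrite RInt_const_R in E. pose proof (RInt_deriv step bump (/ 2) t Ht) as H.
  rewrite H in E; [|intros; apply step_derive|intros; apply bump_cont].
  rewrite step_half in E. lra.
Qed.

(** Since [step] is constant outside [0, 1/2], [k1] rests at the junction point for t >= 1/2 and
    [k2] rests there for t <= 1/2. Their sum minus the junction point is the concatenation, and it
    is C^1 without a case distinction. The value at 1/2 is recorded so that a curve can later be
    forced through a given point. *)
Lemma concat (c1 c2 : R -> pt) : C1_curve c1 -> C1_curve c2 -> c1 1 = c2 0 ->
  exists c, C1_curve c /\ c 0 = c1 0 /\ c 1 = c2 1 /\ c (/ 2) = c1 1 /\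
    RInt (speed m c) 0 1 = RInt (speed m c1) 0 1 + RInt (speed m c2) 0 1.
Proof.
  intros H1 H2 E.
  destruct (curve_comp c1 step bump H1 step_derive bump_cont) as [K1 V1].
  destruct (curve_comp c2 (fun t => step (t - / 2)) (fun t => bump (t - / 2)) H2) as [K2 V2].
  { intros t. apply (is_derive_ext (fun t => step (t - / 2))); [reflexivity|].
    replace (bump (t - / 2)) with (1 * bump (t - / 2)) by ring.
    apply (is_derive_comp step (fun t => t - / 2)); [apply step_derive|].
    auto_derive; auto; ring. }
  { intros t. apply (cont_comp (fun t => t - / 2) bump); [cont|apply bump_cont]. }
  set (k1 := fun t => c1 (step t)) in *. set (k2 := fun t => c2 (step (t - / 2))) in *.
  set (x := fun t => fst (k1 t) + (fst (k2 t) - fst (c1 1))).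
  set (y := fun t => snd (k1 t) + (snd (k2 t) - snd (c1 1))).
  assert (HD : C1_curve (fun t => (x t, y t)) /\ forall t, vel (fun t => (x t, y t)) t =
     (Derive (fun t => fst (k1 t)) t + Derive (fun t => fst (k2 t)) t,
      Derive (fun t => snd (k1 t)) t + Derive (fun t => snd (k2 t)) t)).
  { apply C1_intro.
    - intros t. apply (is_derive_plus (fun t => fst (k1 t))); [now apply curve_dx|].
      replace (Derive (fun t => fst (k2 t)) t) with (Derive (fun t => fst (k2 t)) t - 0) by ring.
      apply (is_derive_minus (fun t => fst (k2 t))); [now apply curve_dx|].
      apply (is_derive_const (fst (c1 1))).
    - intros t. apply (is_derive_plus (fun t => snd (k1 t))); [now apply curve_dy|].
      replace (Derive (fun t => snd (k2 t)) t) with (Derive (fun t => snd (k2 t)) t - 0) by ring.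
      apply (is_derive_minus (fun t => snd (k2 t))); [now apply curve_dy|].
      apply (is_derive_const (snd (c1 1))).
    - intros t. apply (cont_plus (Derive (fun t => fst (k1 t)))); now apply curve_cdx.
    - intros t. apply (cont_plus (Derive (fun t => snd (k1 t)))); now apply curve_cdy. }
  destruct HD as [HC HV]. set (c := fun t => (x t, y t)) in *.
  assert (Vsum : forall t, vel c t = (fst (vel k1 t) + fst (vel k2 t), snd (vel k1 t) + snd (vel k2 t))).
  { intros t. rewrite HV. reflexivity. }
  assert (F1 : forall t, t <= / 2 -> c t = k1 t).
  { intros t Ht. unfold c, x, y, k2. rewrite (step_neg (t - / 2)) by lra. rewrite <- E.
    destruct (k1 t); simpl; f_equal; ring. }
  assert (F2 : forall t, / 2 <= t -> c t = k2 t).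
  { intros t Ht. unfold c, x, y, k1. rewrite (step_pos t) by lra.
    destruct (k2 t); simpl; f_equal; ring. }
  exists c. split; [exact HC|]. split; [|split; [|split]].
  - rewrite F1 by lra. unfold k1. now rewrite step_0.
  - rewrite F2 by lra. unfold k2. rewrite (step_pos (1 - / 2)); auto. lra.
  - rewrite F1 by lra. unfold k1. now rewrite step_half.
  - rewrite (RInt_Chasles_cont _ 0 (/ 2) 1) by (try lra; intros; now apply speed_cont). f_equal.
    + transitivity (RInt (fun t => bump t * speed m c1 (step t)) 0 (/ 2)).
      * apply RInt_ext_le; [lra|]. intros t Ht. apply speed_ext; [apply F1; lra| |apply bump_ge0].
        rewrite Vsum, V2, V1, (bump_out (t - / 2)) by lra.
        unfold smul; simpl. f_equal; ring.
      * rewrite (RInt_comp_R (speed m c1) step bump); [now rewrite step_0, step_half|lra| | |].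
        -- intros; now apply speed_cont.
        -- intros; apply step_derive.
        -- intros; apply bump_cont.
    + transitivity (RInt (fun t => bump (t - / 2) * speed m c2 (step (t - / 2))) (/ 2) 1).
      * apply RInt_ext_le; [lra|]. intros t Ht. apply speed_ext; [apply F2; lra| |apply bump_ge0].
        rewrite Vsum, V2, V1, (bump_out t) by lra.
        unfold smul; simpl. f_equal; ring.
      * rewrite (RInt_comp_R (speed m c2) (fun t => step (t - / 2)) (fun t => bump (t - / 2))); [|lra| | |].
        -- replace (/ 2 - / 2) with 0 by ring. replace (1 - / 2) with (/ 2) by field.
           now rewrite step_0, step_half.
        -- intros; now apply speed_cont.
        -- intros t _. replace (bump (t - / 2)) with (1 * bump (t - / 2)) by ring.
           apply (is_derive_comp step (fun t => t - / 2)); [apply step_derive|].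
           auto_derive; auto; ring.
        -- intros; apply (cont_comp (fun t => t - / 2) bump); [cont|apply bump_cont].
Qed.

Lemma dr_triangle p q s : dr p s <= dr p q + dr q s.
Proof.
  apply le_of_eps. intros e He.
  destruct (dr_approx p q (e / 2) ltac:(lra)) as [c1 [A1 [A2 [A3 A4]]]].
  destruct (dr_approx q s (e / 2) ltac:(lra)) as [c2 [B1 [B2 [B3 B4]]]].
  destruct (concat c1 c2 A1 B1) as [c [C1 [C2 [C3 [_ C5]]]]]; [congruence|].
  pose proof (dr_le_length c C1) as H. rewrite C2, C3, A2, B3 in H. lra.
Qed.

Lemma dr_radial p q : Rabs (enorm q - enorm p) <= dr p q.
Proof.
  apply dr_ge. intros c Hc <- <-. apply length_radial; auto. lra.
Qed.

Definition polar (r t : R) : pt := (r * cos t, r * sin t).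

Lemma enorm_polar r t : 0 <= r -> enorm (polar r t) = r.
Proof.
  intros Hr. unfold enorm, dot, polar; simpl.
  replace (_ + _) with (r ^ 2 * (sin t ^ 2 + cos t ^ 2)) by ring.
  rewrite <- (sqrt_pow2 r Hr) at 2. f_equal. pose proof (sin2_cos2 t). unfold Rsqr in H. nra.
Qed.

Lemma dot_polar r1 t1 r2 t2 : dot (polar r1 t1) (polar r2 t2) = r1 * r2 * cos (t1 - t2).
Proof. unfold dot, polar; simpl. rewrite cos_minus. ring. Qed.

Lemma polar_repr p : p <> origin -> exists t, p = polar (enorm p) t.
Proof.
  intros Hp. pose proof (enorm_ge0 p). pose proof (enorm_sq p) as E.
  assert (Hr : enorm p <> 0) by (intros H0; now apply Hp, enorm_eq0).
  destruct p as [x y]. set (r := enorm (x, y)) in *. unfold dot in E; simpl in E.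
  assert (Hu : -1 <= x / r <= 1).
  { split; [apply le_div|apply div_le]; try lra; nra. }
  assert (Es : sin (acos (x / r)) = Rabs (y / r)).
  { rewrite sin_acos by auto. rewrite <- sqrt_Rsqr_abs. f_equal. unfold Rsqr.
    apply (Rmult_eq_reg_r (r * r)); [|nra].
    transitivity (r * r - x * x); [field; auto|].
    transitivity (y * y); [lra|field; auto]. }
  destruct (Rle_dec 0 y) as [Hy|Hy].
  - exists (acos (x / r)). unfold polar. rewrite cos_acos, Es by auto.
    rewrite Rabs_pos_eq by (apply Rdiv_le_0_compat; lra). f_equal; field; auto.
  - exists (- acos (x / r)). unfold polar. rewrite cos_neg, sin_neg, cos_acos, Es by auto.
    rewrite Rabs_left1.
    + f_equal; field; auto.
    + apply div_le; lra.
Qed.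

Section Polar.
Context (r th rd td : R -> R)
  (Hr : forall t, is_derive r t (rd t)) (Ht : forall t, is_derive th t (td t))
  (Crd : forall t, continuous rd t) (Ctd : forall t, continuous td t).

Lemma polar_C1 : C1_curve (fun t => polar (r t) (th t)) /\
  forall t, vel (fun t => polar (r t) (th t)) t =
   (rd t * cos (th t) - r t * sin (th t) * td t, rd t * sin (th t) + r t * cos (th t) * td t).
Proof.
  assert (Cr : forall t, continuous r t) by (intros; eapply deriv_cont, Hr).
  assert (Ct : forall t, continuous th t) by (intros; eapply deriv_cont, Ht).
  assert (Cc : forall t, continuous (fun t => cos (th t)) t).
  { intros. apply (cont_comp th cos); auto. apply continuous_cos. }
  assert (Cs : forall t, continuous (fun t => sin (th t)) t).
  { intros. apply (cont_comp th sin); auto. apply continuous_sin. }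
  apply C1_intro; intros t.
  - auto_derive.
    + repeat split; eexists; eauto.
    + replace (Derive (fun x => r x) t) with (rd t) by (symmetry; apply is_derive_unique, Hr).
      replace (Derive (fun x => th x) t) with (td t) by (symmetry; apply is_derive_unique, Ht). ring.
  - auto_derive.
    + repeat split; eexists; eauto.
    + replace (Derive (fun x => r x) t) with (rd t) by (symmetry; apply is_derive_unique, Hr).
      replace (Derive (fun x => th x) t) with (td t) by (symmetry; apply is_derive_unique, Ht). ring.
  - cont; auto.
  - cont; auto.
Qed.

Lemma polar_speed t : 0 < r t ->
  speed m (fun t => polar (r t) (th t)) t = sqrt (rd t ^ 2 + m (r t) ^ 2 * td t ^ 2).
Proof.
  intros Hp. unfold speed. rewrite (proj2 polar_C1). f_equal.
  unfold gm. rewrite enorm_polar by lra. destruct Req_EM_T; [lra|]. cbv zeta.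
  unfold dot, polar; simpl fst; simpl snd.
  pose proof (sin2_cos2 (th t)) as E. unfold Rsqr in E.
  set (s := sin (th t)) in *. set (k := cos (th t)) in *.
  replace (r t * k * (rd t * k - r t * s * td t) + r t * s * (rd t * s + r t * k * td t))
    with (r t * rd t * (s * s + k * k)) by ring.
  replace ((rd t * k - r t * s * td t) * (rd t * k - r t * s * td t) +
     (rd t * s + r t * k * td t) * (rd t * s + r t * k * td t)) with
    ((rd t ^ 2 + r t ^ 2 * td t ^ 2) * (s * s + k * k)) by ring.
  rewrite E. field. lra.
Qed.

Lemma dr_polar_curve a b : a <= b -> (forall t, a <= t <= b -> 0 < r t) ->
  dr (polar (r a) (th a)) (polar (r b) (th b)) <=
  RInt (fun t => sqrt (rd t ^ 2 + m (r t) ^ 2 * td t ^ 2)) a b.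
Proof.
  intros Hab Hp.
  eapply Rle_trans; [apply (dr_le_seg (fun t => polar (r t) (th t)) a b); auto; apply polar_C1|].
  apply Req_le, RInt_ext_le; auto. intros t Hx. apply polar_speed. apply Hp. lra.
Qed.

End Polar.

Lemma dr_arc R0 t1 t2 : 0 < R0 -> dr (polar R0 t1) (polar R0 t2) <= m R0 * Rabs (t2 - t1).
Proof.
  intros HR. pose proof (dr_polar_curve (fun _ => R0) (fun t => t1 + t * (t2 - t1)) (fun _ => 0)
    (fun _ => t2 - t1)) as H.
  specialize (H ltac:(intros; apply (is_derive_const R0)) ltac:(intros; auto_derive; auto; ring)
   ltac:(intros; apply continuous_const) ltac:(intros; apply continuous_const) 0 1 ltac:(lra)
   ltac:(intros; lra)). simpl in H.
  replace (t1 + 0 * (t2 - t1)) with t1 in H by ring.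
  replace (t1 + 1 * (t2 - t1)) with t2 in H by ring.
  eapply Rle_trans; [exact H|]. rewrite RInt_const_R. apply Req_le.
  replace (0 * (0 * 1) + m R0 * (m R0 * 1) * ((t2 - t1) * ((t2 - t1) * 1)))
    with (Rsqr (m R0 * (t2 - t1))) by (unfold Rsqr; ring).
  rewrite sqrt_Rsqr_abs, Rabs_mult. rewrite (Rabs_pos_eq (m R0)) by (apply Rlt_le, profile_pos; auto).
  ring.
Qed.

Lemma dr_radial_line t a b : 0 <= a <= b -> dr (polar a t) (polar b t) = b - a.
Proof.
  intros [Ha Hab]. apply Rle_antisym.
  - apply le_of_eps. intros e He.
    assert (Hpos : forall a', 0 < a' <= b -> dr (polar a' t) (polar b t) <= b - a').
    { intros a' Ha'. pose proof (dr_polar_curve (fun x => x) (fun _ => t) (fun _ => 1) (fun _ => 0)) as H.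
      specialize (H ltac:(intros; auto_derive; auto) ltac:(intros; apply (is_derive_const t))
       ltac:(intros; apply continuous_const) ltac:(intros; apply continuous_const) a' b ltac:(lra)
       ltac:(intros; lra)). simpl in H.
      eapply Rle_trans; [exact H|]. apply Req_le.
      rewrite (RInt_ext_le _ (fun _ => 1)); [rewrite RInt_const_R; ring|lra|].
      intros x _. transitivity (sqrt 1); [f_equal; ring|apply sqrt_1]. }
    destruct (Rle_lt_or_eq_dec 0 a Ha) as [H|<-].
    + specialize (Hpos a ltac:(lra)). lra.
    (* Polar curves need a positive radius. From the origin the Euclidean segment is used; its
       velocity is radial, so its speed is [b]. *)
    + destruct (straight_C1 (polar 0 t) (polar b t)) as [HC HV].
      pose proof (dr_le_length _ HC) as H. cbv beta in H.
      set (c := fun t0 => (fst (polar 0 t) + t0 * (fst (polar b t) - fst (polar 0 t)),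
            snd (polar 0 t) + t0 * (snd (polar b t) - snd (polar 0 t)))) in *.
      replace (fst (polar 0 t) + 0 * (fst (polar b t) - fst (polar 0 t)),
               snd (polar 0 t) + 0 * (snd (polar b t) - snd (polar 0 t))) with (polar 0 t) in H
        by (unfold polar; simpl; f_equal; ring).
      replace (fst (polar 0 t) + 1 * (fst (polar b t) - fst (polar 0 t)),
               snd (polar 0 t) + 1 * (snd (polar b t) - snd (polar 0 t))) with (polar b t) in H
        by (unfold polar; simpl; f_equal; ring).
      eapply Rle_trans; [exact H|].
      rewrite (RInt_ext_le _ (fun _ => b)); [rewrite RInt_const_R; lra|lra|].
      intros s Hs. unfold speed. rewrite HV.
      assert (Ec : c s = polar (s * b) t) by (unfold c, polar; simpl; f_equal; ring).
      rewrite Ec. unfold gm. rewrite enorm_polar by nra.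
      transitivity (sqrt (b ^ 2)); [f_equal|apply sqrt_pow2; lra].
      pose proof (sin2_cos2 t) as E. unfold Rsqr in E.
      unfold dot, polar; simpl fst; simpl snd.
      set (sn := sin t) in *. set (k := cos t) in *.
      destruct Req_EM_T as [E0|n].
      * transitivity (b ^ 2 * (sn * sn + k * k)); [ring|]. rewrite E; ring.
      * cbv zeta. rewrite !Rmult_0_l, !Rminus_0_r.
        replace (s * b * k * (b * k) + s * b * sn * (b * sn)) with (s * b * b * (sn * sn + k * k)) by ring.
        replace (b * k * (b * k) + b * sn * (b * sn)) with (b * b * (sn * sn + k * k)) by ring.
        rewrite E. field. split; intros ->; apply n; ring.
  - pose proof (dr_radial (polar a t) (polar b t)) as H. rewrite !enorm_polar in H by lra.
    pose proof (Rle_abs (b - a)). lra.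
Qed.

End Dist.

Lemma one_minus_sqrt_le x : 0 <= x -> 1 - sqrt (1 - x) <= x.
Proof.
  intros Hx. destruct (Rle_dec x 1) as [H|H].
  - assert (1 - x <= sqrt (1 - x)); [|lra].
    rewrite <- (sqrt_pow2 (1 - x)) at 1 by lra. apply sqrt_le_1_alt. nra.
  - pose proof (sqrt_pos (1 - x)). lra.
Qed.

Lemma wdef_le m k x : wdef m k x <= (k / m x) ^ 2.
Proof. apply one_minus_sqrt_le, pow2_ge_0. Qed.

Lemma wdef_RInt_range m (Hm : profile m) k a b : 0 < a <= b ->
  0 <= RInt (wdef m k) a b <= b - a.
Proof.
  intros [Ha Hab].
  assert (Hc : forall x, a <= x <= b -> continuous (wdef m k) x) by (intros; apply wdef_cont; auto; lra).
  split.
  - apply RInt_pos; auto. intros; apply wdef_range.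
  - rewrite <- (Rmult_1_l (b - a)), <- RInt_const_R.
    apply RInt_le_cont; auto; [intros; apply continuous_const|intros; apply wdef_range].
Qed.

Lemma RInt_one_minus m (Hm : profile m) k a b : 0 < a <= b ->
  RInt (fun x => 1 - wdef m k x) a b = b - a - RInt (wdef m k) a b.
Proof.
  intros [Ha Hab]. rewrite (RInt_minus_cont (fun _ => 1)); auto.
  - rewrite RInt_const_R. ringR.
  - intros; apply continuous_const.
  - intros; apply wdef_cont; auto; lra.
Qed.

Lemma cos_eq_le (u a : R) : 0 <= a <= PI -> cos u = cos a -> a <= Rabs u.
Proof.
  intros [H1 H2] E. apply Rnot_lt_le. intros Hl.
  assert (cos a < cos (Rabs u)).
  { pose proof (Rabs_pos u). apply cos_decreasing_1; lra. }
  assert (cos (Rabs u) = cos u); [|lra].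
  unfold Rabs. destruct Rcase_abs; auto. now rewrite cos_neg.
Qed.

(** * Global lower bounds for lengths, and competitors *)

Section S.
Context (m : R -> R) (Hm : profile m).
Notation dr := (dr m).

(** The curve is cut at a point of minimal radius and calibrated with [e2 = -1] before it and
    [e2 = 1] after it, with a common sign [e] for the rotation. The accumulated rotation has
    absolute value at least [a], because its cosine is that of [a] and [a] lies in [0, PI]. The
    bound without [k] also covers curves through the origin. *)
Lemma curve_lower c : C1_curve c -> exists t0, 0 <= t0 <= 1 /\
  (forall t, 0 <= t <= 1 -> enorm (c t0) <= enorm (c t)) /\
  enorm (c 0) + enorm (c 1) - 2 * enorm (c t0) <= RInt (speed m c) 0 1 /\
  (0 < enorm (c t0) -> forall k a, 0 <= k -> 0 <= a <= PI ->
     (forall t, 0 <= t <= 1 -> k <= m (enorm (c t))) ->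
     dot (c 0) (c 1) = enorm (c 0) * enorm (c 1) * cos a ->
     k * a + (enorm (c 0) - enorm (c t0) - RInt (wdef m k) (enorm (c t0)) (enorm (c 0)))
           + (enorm (c 1) - enorm (c t0) - RInt (wdef m k) (enorm (c t0)) (enorm (c 1)))
       <= RInt (speed m c) 0 1).
Proof.
  intros Hc.
  destruct (min_attained (fun t => enorm (c t)) 0 1) as [t0 [Ht0 Hmin]]; [lra|..].
  { intros; now apply enorm_curve_cont. }
  exists t0. split; auto. split; auto.
  assert (Hsplit : RInt (speed m c) 0 1 = RInt (speed m c) 0 t0 + RInt (speed m c) t0 1).
  { apply RInt_Chasles_cont; auto. intros; now apply speed_cont. }
  split.
  - pose proof (length_radial m Hm c Hc 0 t0 ltac:(lra)) as H1.
    pose proof (length_radial m Hm c Hc t0 1 ltac:(lra)) as H2.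
    pose proof (Rle_abs (- (enorm (c t0) - enorm (c 0)))) as H3. rewrite Rabs_Ropp in H3.
    pose proof (Rle_abs (enorm (c 1) - enorm (c t0))). lra.
  - intros Hp k a Hk Ha Hkm Hdot.
    set (r0 := enorm (c t0)) in *. set (d := r0 * r0).
    assert (Hd : 0 < d) by (unfold d; nra).
    assert (Hlow : forall t, 0 <= t <= 1 -> d <= dot (c t) (c t)).
    { intros t Ht. rewrite <- enorm_sq. specialize (Hmin t Ht). cbv beta in Hmin. unfold d. nra. }
    set (T := RInt (omega c d) 0 1).
    assert (HT : a <= Rabs T).
    { apply cos_eq_le; auto. pose proof (angle_lift c Hc 0 1 d ltac:(lra) Hd Hlow) as HL.
      fold T in HL. pose proof (Hmin 0 ltac:(lra)). pose proof (Hmin 1 ltac:(lra)). cbv beta in *.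
      apply (Rmult_eq_reg_l (enorm (c 0) * enorm (c 1))); [lra|nra]. }
    assert (Hoc : forall t, continuous (omega c d) t) by (intros; now apply omega_cont).
    assert (HTs : T = RInt (omega c d) 0 t0 + RInt (omega c d) t0 1)
      by (apply RInt_Chasles_cont; auto).
    set (e := if Rle_dec 0 T then 1 else - 1).
    assert (He : Rabs e <= 1 /\ e * T = Rabs T).
    { unfold e. destruct Rle_dec.
      - rewrite Rabs_R1, Rabs_pos_eq by auto. split; lra.
      - rewrite (Rabs_left (-1)), (Rabs_left T) by lra. split; lra. }
    destruct He as [He1 He2].
    pose proof (calibration m Hm c Hc 0 t0 d ltac:(lra) Hd
      ltac:(intros; apply Hlow; lra) k e (-1) Hk ltac:(intros; apply Hkm; lra) He1
      ltac:(rewrite Rabs_left; lra)) as C1.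
    pose proof (calibration m Hm c Hc t0 1 d ltac:(lra) Hd
      ltac:(intros; apply Hlow; lra) k e 1 Hk ltac:(intros; apply Hkm; lra) He1
      ltac:(rewrite Rabs_R1; lra)) as C2.
    pose proof (Hmin 0 ltac:(lra)) as M0. pose proof (Hmin 1 ltac:(lra)) as M1. cbv beta in M0, M1.
    cbv beta in C1, C2. fold r0 in C1, C2.
    assert (Hswap : RInt (fun z => 1 - wdef m k z) (enorm (c 0)) r0 =
      - RInt (fun z => 1 - wdef m k z) r0 (enorm (c 0))).
    { symmetry. apply (opp_RInt_swap (V := R_CompleteNormedModule)).
      apply ex_RInt_cont; [exact M0|]. intros z Hz.
      apply (cont_minus (fun _ => 1)); [apply continuous_const|]. apply wdef_cont; auto. lra. }
    rewrite Hswap in C1.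
    rewrite RInt_one_minus in C1, C2 by (auto; lra).
    assert (Hka : k * a <= k * (e * T)) by (rewrite He2; now apply Rmult_le_compat_l).
    rewrite HTs in Hka. rewrite Hsplit.
    replace (k * (e * (RInt (omega c d) 0 t0 + RInt (omega c d) t0 1))) with
      (e * k * RInt (omega c d) 0 t0 + e * k * RInt (omega c d) t0 1) in Hka by ring.
    lra.
Qed.

Lemma clamp_cont a b x : a <= b -> continuous (fun x => Rmax a (Rmin x b)) x.
Proof.
  intros Hab. apply cont_eps. intros e He. exists e; split; auto. intros y Hy.
  eapply Rle_lt_trans; [|exact Hy].
  unfold Rmax, Rmin, Rabs. repeat destruct Rle_dec; repeat destruct Rcase_abs; lra.
Qed.

Lemma clamp_id a b x : a <= x <= b -> Rmax a (Rmin x b) = x.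
Proof. intros. rewrite Rmin_left, Rmax_right; lra. Qed.

Lemma clamp_in a b x : a <= b -> a <= Rmax a (Rmin x b) <= b.
Proof. intros. unfold Rmax, Rmin. repeat destruct Rle_dec; lra. Qed.

(** The angular speed is extended by clamping the radius to [[ra, rb]], because [C1_curve] asks for
    differentiability on the whole line. *)
Lemma dr_graph (om : R -> R) ra rb t0 : 0 < ra <= rb ->
  (forall x, ra <= x <= rb -> continuous om x) ->
  dr (polar ra t0) (polar rb (t0 + RInt om ra rb)) <=
  RInt (fun x => sqrt (1 + m x ^ 2 * om x ^ 2)) ra rb.
Proof.
  intros [Ha Hab] Ho.
  set (oc := fun x => om (Rmax ra (Rmin x rb))).
  assert (Hoc : forall x, continuous oc x).
  { intros x. apply (cont_comp (fun x => Rmax ra (Rmin x rb)) om); [now apply clamp_cont|].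
    apply Ho. now apply clamp_in. }
  assert (E : forall x, ra <= x <= rb -> oc x = om x) by (intros; unfold oc; now rewrite clamp_id).
  pose proof (dr_polar_curve m Hm (fun x => x) (fun x => t0 + RInt oc ra x) (fun _ => 1) oc) as H.
  specialize (H ltac:(intros; auto_derive; auto)
    ltac:(intros t; rewrite <- (Rplus_0_l (oc t)); apply (is_derive_plus (fun _ => t0));
       [apply (is_derive_const t0)|now apply is_derive_RInt_cont])
    ltac:(intros; apply continuous_const) Hoc ra rb Hab ltac:(intros; lra)).
  cbv beta in H. rewrite RInt_point in H. unfold zero in H; simpl in H. rewrite Rplus_0_r in H.
  rewrite (RInt_ext_le oc om) in H by (auto; intros; apply E; lra).
  eapply Rle_trans; [exact H|]. apply Req_le, RInt_ext_le; auto.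
  intros x Hx. rewrite E by lra. f_equal. ring.
Qed.

(** Cutting the corner at the origin shortens a broken geodesic with angle less than [PI]. *)
Lemma corner_cut phi R0 : 0 <= phi < PI -> 0 < R0 ->
  exists e, 0 < e < R0 /\ forall t, dr (polar e t) (polar e (t + phi)) < 2 * e.
Proof.
  intros Hphi HR.
  assert (Hc : -1 < cos phi) by (rewrite <- cos_PI; apply cos_decreasing_1; lra).
  (* [g] is sin^2 (phi/2), so the Euclidean chord between the two points has length 2 e sqrt g, less
     than 2 e. Near the origin lengths are stretched by at most 1 + dl, and [dl] is small enough to
     keep the inequality strict. *)
  set (g := (1 - cos phi) / 2).
  assert (Hg : 0 <= g < 1) by (unfold g; pose proof (COS_bound phi); lra).
  assert (Hd : exists dl, 0 < dl /\ (1 + dl) ^ 2 * g < 1).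
  { exists ((1 - g) / 4). split; [lra|]. nra. }
  destruct Hd as [dl [Hdl1 Hdl2]].
  destruct (proj1 (cont_eps (mu m) 0) (mu_cont m Hm 0) dl Hdl1) as [d [Hd1 Hd2]].
  set (e := Rmin (d / 2) (R0 / 2)).
  assert (He : 0 < e /\ e <= d / 2 /\ e <= R0 / 2).
  { unfold e. split; [apply Rmin_glb_lt; lra|split; [apply Rmin_l|apply Rmin_r]]. }
  exists e. split; [lra|]. intros t.
  destruct (straight_C1 (polar e t) (polar e (t + phi))) as [HC HV].
  pose proof (dr_le_length m Hm _ HC) as H. cbv beta in H.
  set (c := fun t1 => (fst (polar e t) + t1 * (fst (polar e (t + phi)) - fst (polar e t)),
    snd (polar e t) + t1 * (snd (polar e (t + phi)) - snd (polar e t)))) in *.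
  replace (_, _) with (polar e t) in H by (unfold polar; simpl; f_equal; ring).
  replace (fst (polar e t) + 1 * (fst (polar e (t + phi)) - fst (polar e t)),
    snd (polar e t) + 1 * (snd (polar e (t + phi)) - snd (polar e t))) with (polar e (t + phi)) in H
    by (unfold polar; simpl; f_equal; ring).
  eapply Rle_lt_trans; [exact H|].
  set (v := (fst (polar e (t + phi)) - fst (polar e t), snd (polar e (t + phi)) - snd (polar e t))) in *.
  assert (Ev : dot v v = 4 * e ^ 2 * g).
  { transitivity (dot (polar e (t + phi)) (polar e (t + phi)) + dot (polar e t) (polar e t)
       - 2 * dot (polar e (t + phi)) (polar e t)); [unfold v, dot; simpl; ring|].
    rewrite !dot_polar, !Rminus_diag, cos_0.
    replace (t + phi - t) with phi by ring. unfold g. field. }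
  assert (Hs : forall s, 0 <= s <= 1 -> speed m c s <= (1 + dl) * sqrt (dot v v)).
  { intros s Hs. unfold speed. rewrite HV. fold v.
    rewrite <- (sqrt_pow2 (1 + dl)) by lra. rewrite <- sqrt_mult_alt by apply pow2_ge_0.
    apply sqrt_le_1_alt. rewrite gm_eq.
    assert (Hn : enorm (c s) <= e).
    { rewrite <- (sqrt_pow2 e) by lra. apply sqrt_le_1_alt.
      assert (dot (c s) (c s) = (1 - s) ^ 2 * dot (polar e t) (polar e t)
        + s ^ 2 * dot (polar e (t + phi)) (polar e (t + phi)) + 2 * s * (1 - s) * dot (polar e (t + phi)) (polar e t)) as ->
        by (unfold c, dot; simpl; ring).
      rewrite !dot_polar, !Rminus_diag, cos_0. pose proof (COS_bound (t + phi - t)).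
      assert (0 <= s * (1 - s) * e ^ 2) by (apply Rmult_le_pos; nra).
      replace (e ^ 2) with ((1 - s) ^ 2 * (e * e * 1) + s ^ 2 * (e * e * 1) + 2 * (s * (1 - s) * e ^ 2)) by ring.
      nra. }
    pose proof (enorm_ge0 (c s)) as Hn0.
    assert (Hmu : 0 <= mu m (enorm (c s)) <= 1 + dl).
    { split.
      - unfold mu. destruct Req_EM_T; [lra|]. apply Rlt_le, Rdiv_lt_0_compat; [|lra].
        apply profile_pos; auto. lra.
      - specialize (Hd2 (enorm (c s))). rewrite Rminus_0_r, Rabs_pos_eq in Hd2 by auto.
        specialize (Hd2 ltac:(lra)). unfold mu at 2 in Hd2. destruct (Req_EM_T 0 0); [|lra].
        pose proof (Rle_abs (mu m (enorm (c s)) - 1)). lra. }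
    set (u := mu m (enorm (c s))) in *.
    pose proof (dot_ge0 v).
    assert (Ha : 0 <= (dot (c s) v / enorm (c s)) ^ 2 <= dot v v).
    { split; [apply pow2_ge_0|].
      destruct (Req_dec (enorm (c s)) 0) as [E|n].
      - rewrite E. unfold Rdiv. rewrite Rinv_0. nra.
      - now apply radial_le. }
    set (A := (dot (c s) v / enorm (c s)) ^ 2) in *.
    assert (u ^ 2 <= (1 + dl) ^ 2) by nra.
    assert (1 <= (1 + dl) ^ 2) by nra.
    destruct (Rle_dec (u ^ 2) 1); nra. }
  apply Rle_lt_trans with (RInt (fun _ => (1 + dl) * sqrt (dot v v)) 0 1).
  - apply RInt_le_cont; [lra|intros; now apply speed_cont|intros; apply continuous_const|apply Hs].
  - rewrite RInt_const_R. rewrite Ev.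
    assert (Hq : (1 + dl) * sqrt (4 * e ^ 2 * g) < 2 * e); [|lra].
    rewrite <- (sqrt_pow2 (2 * e)) by lra. rewrite <- (sqrt_pow2 (1 + dl)) by lra.
    rewrite <- sqrt_mult_alt by apply pow2_ge_0.
    assert (He2 : 0 < 4 * e ^ 2) by (assert (0 < e * e) by nra; simpl; lra).
    apply sqrt_lt_1_alt.
    replace ((1 + dl) ^ 2 * (4 * e ^ 2 * g)) with ((1 + dl) ^ 2 * g * (4 * e ^ 2)) by ring.
    replace ((2 * e) ^ 2) with (1 * (4 * e ^ 2)) by ring. split.
    + apply Rmult_le_pos; [|lra]. apply Rmult_le_pos; [apply pow2_ge_0|lra].
    + now apply Rmult_lt_compat_r.
Qed.

Lemma profile_lower_bound a b : 0 < a <= b -> exists k, 0 < k /\ forall x, a <= x <= b -> k <= m x.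
Proof.
  intros [Ha Hab]. destruct (min_attained m a b Hab) as [x [Hx H]].
  { intros; now apply profile_cont. }
  exists (m x). split; auto. apply profile_pos; auto. lra.
Qed.

(** If the two points were separated by an angle [al > 0], a small Clairaut constant [k] would give
    a contradiction: the angular term [k al] is of first order in [k], the loss in the radial term
    of second order. This identifies the segment to the origin in [points_away] with the
    meridian. *)
Lemma meridian_unique R0 t a s : 0 < a < R0 -> dr (polar R0 t) (polar a s) = R0 - a ->
  polar a s = polar a t.
Proof.
  intros Ha Hd.
  assert (Hcb := COS_bound (t - s)).
  set (al := acos (cos (t - s))).
  assert (Hal : 0 <= al <= PI) by (apply acos_bound).
  assert (Hcos : cos al = cos (t - s)) by (apply cos_acos; auto).
  destruct (Req_dec al 0) as [E0|n].
  - rewrite E0, cos_0 in Hcos. pose proof (sin2_cos2 (t - s)) as E. unfold Rsqr in E.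
    rewrite <- Hcos in E. assert (Es : sin (t - s) = 0) by nra.
    unfold polar. set (d := t - s) in *. replace s with (t - d) by (unfold d; ring).
    rewrite cos_minus, sin_minus, Es, <- Hcos.
    f_equal; ring.
  - exfalso.
    destruct (profile_lower_bound (a / 2) (2 * R0 + 2) ltac:(lra)) as [k0 [Hk0 Hk0m]].
    (* This choice makes the second-order loss at most half of [k al]. *)
    set (k := Rmin k0 (k0 ^ 2 * al / (2 * (R0 - a)))).
    assert (Hq : 0 < k0 ^ 2 * al / (2 * (R0 - a))).
    { apply Rdiv_lt_0_compat; [|lra]. apply Rmult_lt_0_compat; [nra|lra]. }
    assert (Hk : 0 < k /\ k <= k0 /\ k <= k0 ^ 2 * al / (2 * (R0 - a))).
    { unfold k. split; [now apply Rmin_glb_lt|split; [apply Rmin_l|apply Rmin_r]]. }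
    destruct Hk as [Hk1 [Hk2 Hk3]].
    assert (Hk4 : k / k0 ^ 2 * (R0 - a) <= al / 2).
    { apply (Rmult_le_compat_r ((R0 - a) / k0 ^ 2)) in Hk3;
        [|apply Rdiv_le_0_compat; nra].
      replace (k0 ^ 2 * al / (2 * (R0 - a)) * ((R0 - a) / k0 ^ 2)) with (al / 2) in Hk3
        by (field; lra).
      unfold Rdiv in *. lra. }
    (* [e <= a] keeps the minimal radius above a/2, [e <= 1] keeps the curve inside radius 2 R0 + 2,
       and [k al / 4] stays below the net gain [k al / 2]. *)
    set (e := Rmin (Rmin (k * al / 4) a) 1).
    assert (He : 0 < e /\ e <= k * al / 4 /\ e <= a /\ e <= 1).
    { unfold e. repeat split.
      - repeat apply Rmin_glb_lt; try lra. assert (0 < k * al) by (apply Rmult_lt_0_compat; lra). lra.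
      - eapply Rle_trans; [apply Rmin_l|apply Rmin_l].
      - eapply Rle_trans; [apply Rmin_l|apply Rmin_r].
      - apply Rmin_r. }
    destruct (dr_approx m Hm (polar R0 t) (polar a s) e ltac:(lra)) as [c [Hc [E0 [E1 HL]]]].
    rewrite Hd in HL.
    destruct (curve_lower c Hc) as [t0 [Ht0 [Hmin [HA HB]]]].
    rewrite E0, E1, !enorm_polar in HA, HB by lra.
    set (r0 := enorm (c t0)) in *.
    assert (Hr0 : a / 2 <= r0) by lra.
    assert (Hr0a : r0 <= a).
    { specialize (Hmin 1 ltac:(lra)). rewrite E1, enorm_polar in Hmin by lra. exact Hmin. }
    specialize (HB ltac:(lra) k al ltac:(lra) Hal).
    assert (Hm' : forall t1, 0 <= t1 <= 1 -> k <= m (enorm (c t1))).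
    { intros t1 Ht1. eapply Rle_trans; [exact Hk2|]. apply Hk0m. split.
      - specialize (Hmin t1 Ht1). lra.
      - pose proof (length_radial m Hm c Hc 0 t1 ltac:(lra)) as H.
        rewrite E0, enorm_polar in H by lra.
        pose proof (Rle_abs (enorm (c t1) - R0)).
        pose proof (RInt_speed_ge0 m Hm c Hc t1 1 ltac:(lra)).
        pose proof (RInt_Chasles_cont (speed m c) 0 t1 1 ltac:(lra) ltac:(intros; now apply speed_cont)).
        lra. }
    specialize (HB Hm'). rewrite dot_polar, Hcos in HB. specialize (HB eq_refl).
    assert (Hw1 : RInt (wdef m k) r0 R0 <= (a - r0) + (k / k0 ) ^ 2 * (R0 - a)).
    { rewrite (RInt_Chasles_cont _ r0 a R0); [|lra|intros; apply wdef_cont; auto; lra].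
      pose proof (wdef_RInt_range m Hm k r0 a ltac:(lra)).
      assert (RInt (wdef m k) a R0 <= RInt (fun _ => (k / k0) ^ 2) a R0).
      { apply RInt_le_cont; [lra|intros; apply wdef_cont; auto; lra|intros; apply continuous_const|].
        intros x Hx. eapply Rle_trans; [apply wdef_le|].
        specialize (Hk0m x ltac:(lra)).
        assert (0 <= k / m x <= k / k0).
        { split; [apply Rdiv_le_0_compat; lra|].
          apply Rmult_le_compat_l; [lra|]. apply Rinv_le_contravar; lra. }
        nra. }
      rewrite RInt_const_R in H0. lra. }
    pose proof (wdef_RInt_range m Hm k r0 a ltac:(lra)) as Hw2.
    assert ((k / k0) ^ 2 * (R0 - a) <= k * (al / 2)).
    { replace ((k / k0) ^ 2 * (R0 - a)) with (k * (k / k0 ^ 2 * (R0 - a))) by (field; lra).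
      apply Rmult_le_compat_l; lra. }
    assert (0 < k * al) by (apply Rmult_lt_0_compat; lra).
    lra.
Qed.

End S.

(** * Integrals to infinity *)

(** The improper integral, taken as a supremum of partial integrals because all integrands will be
    nonnegative; [has_tail] collects the conditions under which it is finite. *)
Definition tail (g : R -> R) (x : R) : R :=
  real (Lub_Rbar (fun v => exists y, x <= y /\ v = RInt g x y)).

Definition has_tail (g : R -> R) (x : R) : Prop :=
  (forall t, x <= t -> continuous g t) /\ (forall t, x <= t -> 0 <= g t) /\
  exists B, forall y, x <= y -> RInt g x y <= B.

Section Tail.
Context (g : R -> R) (x : R) (Hg : has_tail g x).

Lemma tail_lub : is_lub_Rbar (fun v => exists y, x <= y /\ v = RInt g x y) (Finite (tail g x)).
Proof.
  destruct Hg as [H1 [H2 [B H3]]]. unfold tail.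
  pose proof (Lub_Rbar_correct (fun v => exists y, x <= y /\ v = RInt g x y)) as H.
  destruct (Lub_Rbar _) as [l| |]; auto.
  - exfalso. destruct H as [_ H].
    assert (Hb : Rbar_le p_infty (Finite B)); [|exact Hb].
    apply H. intros v [y [Hy ->]]. simpl. auto.
  - exfalso. destruct H as [H _].
    specialize (H 0). apply H. exists x. split; [lra|]. now rewrite RInt_point.
Qed.

Lemma RInt_le_tail y : x <= y -> RInt g x y <= tail g x.
Proof. intros Hy. apply (proj1 tail_lub). eauto. Qed.

Lemma tail_le B : (forall y, x <= y -> RInt g x y <= B) -> tail g x <= B.
Proof.
  intros H. apply (proj2 tail_lub (Finite B)). intros v [y [Hy ->]]. simpl; auto.
Qed.

Lemma tail_ge0 : 0 <= tail g x.
Proof.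
  pose proof (RInt_le_tail x ltac:(lra)) as H. rewrite RInt_point in H. exact H.
Qed.

Lemma RInt_mono_end y z : x <= y <= z -> RInt g x y <= RInt g x z.
Proof.
  intros [H1 H2]. destruct Hg as [Hc [Hp _]].
  rewrite (RInt_Chasles_cont g x y z) by (auto; intros; apply Hc; lra).
  pose proof (RInt_pos g y z H2 ltac:(intros; apply Hc; lra) ltac:(intros; apply Hp; lra)). lra.
Qed.

Lemma tail_approx e : 0 < e -> exists Y, x <= Y /\ forall y, Y <= y -> tail g x - e < RInt g x y.
Proof.
  intros He. apply NNPP. intros Hn.
  assert (tail g x <= tail g x - e); [|lra].
  apply tail_le. intros y Hy. apply Rnot_lt_le. intros Hl. apply Hn. exists y. split; auto.
  intros z Hz. eapply Rlt_le_trans; [exact Hl|]. apply RInt_mono_end. lra.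
Qed.

Lemma has_tail_shift y : x <= y -> has_tail g y.
Proof.
  intros Hy. destruct Hg as [Hc [Hp [B HB]]]. split; [|split].
  - intros; apply Hc; lra.
  - intros; apply Hp; lra.
  - exists B. intros z Hz.
    pose proof (RInt_Chasles_cont g x y z ltac:(lra) ltac:(intros; apply Hc; lra)).
    pose proof (RInt_pos g x y Hy ltac:(intros; apply Hc; lra) ltac:(intros; apply Hp; lra)).
    specialize (HB z ltac:(lra)). lra.
Qed.

End Tail.

Lemma tail_small g x e : has_tail g x -> 0 < e ->
  exists Y, x <= Y /\ forall y, Y <= y -> tail g y < e.
Proof.
  intros Hg He. destruct (tail_approx g x Hg (e / 2) ltac:(lra)) as [Y [H1 H2]].
  exists Y. split; auto. intros y Hy.
  assert (tail g y <= e / 2); [|lra].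
  apply (tail_le g y (has_tail_shift g x Hg y ltac:(lra))). intros z Hz.
  pose proof (RInt_Chasles_cont g x y z ltac:(lra) ltac:(intros; apply (proj1 Hg); lra)).
  pose proof (RInt_le_tail g x Hg z ltac:(lra)). specialize (H2 y Hy). lra.
Qed.

Lemma tail_Chasles g x y : has_tail g x -> x <= y -> tail g x = RInt g x y + tail g y.
Proof.
  intros Hg Hy. pose proof (has_tail_shift g x Hg y Hy) as Hy'.
  pose proof (proj1 Hg) as Hc.
  apply Rle_antisym.
  - apply (tail_le g x Hg). intros z Hz.
    destruct (Rle_dec y z) as [Hyz|Hyz].
    + rewrite (RInt_Chasles_cont g x y z) by (try lra; intros; apply Hc; lra).
      pose proof (RInt_le_tail g y Hy' z Hyz). lra.
    + pose proof (RInt_mono_end g x Hg z y ltac:(lra)). pose proof (tail_ge0 g y Hy'). lra.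
  - assert (tail g y <= tail g x - RInt g x y); [|lra].
    apply (tail_le g y Hy'). intros z Hz.
    pose proof (RInt_Chasles_cont g x y z ltac:(lra) ltac:(intros; apply Hc; lra)).
    pose proof (RInt_le_tail g x Hg z ltac:(lra)). lra.
Qed.

Lemma tail_mono g1 g2 x : has_tail g1 x -> has_tail g2 x -> (forall t, x <= t -> g1 t <= g2 t) ->
  tail g1 x <= tail g2 x.
Proof.
  intros H1 H2 H. apply (tail_le g1 x H1). intros y Hy.
  eapply Rle_trans; [|apply (RInt_le_tail g2 x H2 y Hy)].
  apply RInt_le_cont; auto; intros; [apply H1|apply H2|apply H]; lra.
Qed.

Lemma has_tail_lin g1 g2 k x : has_tail g1 x -> has_tail g2 x -> 0 <= k ->
  has_tail (fun t => g1 t + k * g2 t) x /\ tail (fun t => g1 t + k * g2 t) x = tail g1 x + k * tail g2 x.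
Proof.
  intros H1 H2 Hk.
  assert (Hc : forall t, x <= t -> continuous (fun t => g1 t + k * g2 t) t).
  { intros t Ht. apply cont_plus; [apply H1; auto|].
    apply (cont_mult (fun _ => k)); [apply continuous_const|apply H2; auto]. }
  assert (HI : forall y, x <= y -> RInt (fun t => g1 t + k * g2 t) x y = RInt g1 x y + k * RInt g2 x y).
  { intros y Hy. rewrite (RInt_plus_cont g1 (fun t => k * g2 t)); auto.
    - rewrite RInt_scal_cont; auto. intros; apply H2; lra.
    - intros; apply H1; lra.
    - intros. apply (cont_mult (fun _ => k)); [apply continuous_const|apply H2; lra]. }
  assert (Ht : has_tail (fun t => g1 t + k * g2 t) x).
  { split; [exact Hc|]. split.
    - intros t Ht. pose proof (proj1 (proj2 H1) t Ht). pose proof (proj1 (proj2 H2) t Ht). nra.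
    - exists (tail g1 x + k * tail g2 x). intros y Hy. rewrite HI by auto.
      pose proof (RInt_le_tail g1 x H1 y Hy). pose proof (RInt_le_tail g2 x H2 y Hy). nra. }
  split; [exact Ht|]. apply Rle_antisym.
  - apply tail_le; auto. intros y Hy. rewrite HI by auto.
    pose proof (RInt_le_tail g1 x H1 y Hy). pose proof (RInt_le_tail g2 x H2 y Hy). nra.
  - apply le_of_eps. intros e He.
    destruct (tail_approx g1 x H1 (e / 2) ltac:(lra)) as [Y1 [A1 B1]].
    destruct (tail_approx g2 x H2 (e / (2 * (k + 1)))) as [Y2 [A2 B2]].
    { apply Rdiv_lt_0_compat; lra. }
    set (y := Rmax Y1 Y2). pose proof (Rmax_l Y1 Y2). pose proof (Rmax_r Y1 Y2). fold y in H, H0.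
    specialize (B1 y H). specialize (B2 y H0).
    pose proof (RInt_le_tail _ x Ht y ltac:(lra)) as HH. rewrite HI in HH by lra.
    assert (k * (e / (2 * (k + 1))) <= e / 2).
    { replace (k * (e / (2 * (k + 1)))) with (e * k / (2 * (k + 1))) by (field; lra).
      apply div_le; [lra|]. nra. }
    nra.
Qed.

(** This is dtheta/dr along a geodesic of Clairaut constant [c], and at the same time the derivative
    of [wdef m c x] in [c]. The double role turns optimality in [c] into statements about angles. *)
Definition hdef (m : R -> R) (c x : R) : R := c / (m x * sqrt (m x ^ 2 - c ^ 2)).
Definition invsq (m : R -> R) (x : R) : R := / m x ^ 2.

Lemma sqrt_diff_le a b : Rabs (sqrt a - sqrt b) <= sqrt (Rabs (a - b)).
Proof.
  assert (H : forall a b, b <= a -> sqrt a <= sqrt b + sqrt (a - b)).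
  { clear. intros a b Hab. destruct (Rle_dec 0 b) as [Hb|Hb].
    - pose proof (sqrt_pos b). pose proof (sqrt_pos (a - b)).
      rewrite <- (sqrt_pow2 (sqrt b + sqrt (a - b))) by lra. apply sqrt_le_1_alt.
      pose proof (sqrt_sqrt b Hb). pose proof (sqrt_sqrt (a - b) ltac:(lra)). nra.
    - rewrite (sqrt_neg_0 b) by lra. rewrite Rplus_0_l. apply sqrt_le_1_alt. lra. }
  destruct (Rle_dec b a) as [Hab|Hab].
  - rewrite (Rabs_pos_eq (a - b)) by lra. pose proof (sqrt_le_1_alt b a Hab).
    rewrite Rabs_pos_eq by lra. specialize (H a b Hab). lra.
  - rewrite (Rabs_left1 (a - b)) by lra. pose proof (sqrt_le_1_alt a b ltac:(lra)).
    rewrite Rabs_left1 by lra. specialize (H b a ltac:(lra)).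
    replace (- (a - b)) with (b - a) by ring. lra.
Qed.

(** A Hoelder estimate of exponent 1/2, chosen because the derivative in [k] blows up at [k = m x].
    It holds for constants beyond [m x] as well, where the square root of a negative number is 0. *)
Lemma wdef_diff m k k' x : 0 < m x ->
  Rabs (wdef m k x - wdef m k' x) <= sqrt (Rabs (k ^ 2 - k' ^ 2)) / m x.
Proof.
  intros Hx. unfold wdef.
  replace (1 - _ - _) with (sqrt (1 - (k' / m x) ^ 2) - sqrt (1 - (k / m x) ^ 2)) by ring.
  eapply Rle_trans; [apply sqrt_diff_le|]. apply Req_le.
  replace (1 - (k' / m x) ^ 2 - (1 - (k / m x) ^ 2)) with ((k ^ 2 - k' ^ 2) / m x ^ 2) by (field; lra).
  rewrite Rabs_div by (apply pow_nonzero; lra).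
  rewrite (Rabs_pos_eq (m x ^ 2)) by apply pow2_ge_0.
  rewrite sqrt_div_alt by (apply pow_lt; auto). now rewrite sqrt_pow2 by lra.
Qed.

(** The tangent line inequality for the convex function [k |-> wdef m k x]. *)
Lemma wdef_subgrad m c c' x : 0 <= c < m x -> 0 <= c' <= m x ->
  (c' - c) * hdef m c x <= wdef m c' x - wdef m c x.
Proof.
  intros [H1 H2] [H3 H4]. unfold wdef, hdef. set (M := m x) in *.
  assert (HM : 0 < M) by lra.
  set (a := c / M). set (b := c' / M).
  assert (Ha : 0 <= a < 1).
  { unfold a. split; [apply Rdiv_le_0_compat; lra|].
    apply (Rmult_lt_reg_r M); auto. replace (c / M * M) with c by (field; lra). lra. }
  assert (Hb : 0 <= b <= 1).
  { unfold b. split; [apply Rdiv_le_0_compat; lra|apply div_le; lra]. }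
  replace (M ^ 2 - c ^ 2) with (M ^ 2 * (1 - a ^ 2)) by (unfold a; field; lra).
  rewrite sqrt_mult_alt, sqrt_pow2 by (try apply pow2_ge_0; lra).
  set (A := sqrt (1 - a ^ 2)). set (B := sqrt (1 - b ^ 2)).
  assert (HA : 0 < A) by (apply sqrt_lt_R0; nra).
  assert (HA2 : A * A = 1 - a ^ 2) by (apply sqrt_sqrt; nra).
  assert (HB : 0 <= B) by apply sqrt_pos.
  assert (HB2 : B * B = 1 - b ^ 2) by (apply sqrt_sqrt; nra).
  replace ((c' - c) * (c / (M * (M * A)))) with ((b - a) * a / A) by (unfold a, b; field; lra).
  apply div_le; auto.
  assert (A * B <= 1 - a * b).
  { apply Rnot_lt_le. intros Hl.
    assert (0 <= 1 - a * b) by nra.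
    assert ((1 - a * b) ^ 2 < (A * B) ^ 2) by nra.
    replace ((A * B) ^ 2) with ((A * A) * (B * B)) in H0 by ring.
    rewrite HA2, HB2 in H0. pose proof (pow2_ge_0 (a - b)). nra. }
  nra.
Qed.

(** * Radial deficits up to infinity, the infimum of [m], and continuity of the lower bound *)

Section Main.
Context (m : R -> R) (Hm : profile m).

Definition fin_invsq : Prop := exists B, forall y, 1 <= y -> RInt (invsq m) 1 y <= B.
(** Divergence of [m] to infinity, which is more than the name says; it makes the infimum in [cstar]
    attained. *)
Definition unbounded : Prop := forall B, exists A, 0 < A /\ forall x, A <= x -> B <= m x.

Context (HJ : fin_invsq) (Hinf : unbounded).

Lemma invsq_cont x : 0 < x -> continuous (invsq m) x.
Proof.
  intros Hx. pose proof (profile_cont m Hm x). pose proof (profile_pos m Hm x Hx).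
  unfold invsq. apply (cont_inv (fun x => m x ^ 2)); [cont|]. apply pow_nonzero; lra.
Qed.

Lemma invsq_pos x : 0 < x -> 0 < invsq m x.
Proof. intros Hx. apply Rinv_0_lt_compat, pow_lt, profile_pos; auto. Qed.

Lemma has_tail_dom g x K A : 0 < x -> (forall t, x <= t -> continuous g t) ->
  (forall t, x <= t -> 0 <= g t) -> (forall t, A <= t -> x <= t -> g t <= K * invsq m t) -> has_tail g x.
Proof.
  intros Hx Hc Hp Hd. split; [auto|split; [auto|]].
  destruct HJ as [B HB].
  assert (HK : 0 <= K).
  { specialize (Hd (Rmax A x) (Rmax_l _ _) (Rmax_r _ _)). pose proof (Rmax_r A x).
    specialize (Hp _ H). pose proof (invsq_pos (Rmax A x) ltac:(lra)). nra. }
  set (A' := Rmax (Rmax A x) 1).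
  assert (HA' : A <= A' /\ x <= A' /\ 1 <= A').
  { unfold A'. pose proof (Rmax_l (Rmax A x) 1). pose proof (Rmax_r (Rmax A x) 1).
    pose proof (Rmax_l A x). pose proof (Rmax_r A x). lra. }
  exists (RInt g x A' + K * B). intros y Hy.
  assert (Hbig : RInt g x (Rmax y A') <= RInt g x A' + K * B).
  { pose proof (Rmax_r y A') as Hr. set (z := Rmax y A') in *.
    rewrite (RInt_Chasles_cont g x A' z) by (try lra; intros; apply Hc; lra).
    assert (RInt g A' z <= K * RInt (invsq m) A' z).
    { rewrite <- RInt_scal_cont by (try lra; intros; apply invsq_cont; lra).
      apply RInt_le_cont; try lra.
      - intros; apply Hc; lra.
      - intros; cont; apply invsq_cont; lra.
      - intros; apply Hd; lra. }
    specialize (HB z ltac:(lra)).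
    pose proof (RInt_Chasles_cont (invsq m) 1 A' z ltac:(lra) ltac:(intros; apply invsq_cont; lra)).
    pose proof (RInt_pos (invsq m) 1 A' ltac:(lra) ltac:(intros; apply invsq_cont; lra)
       ltac:(intros; apply Rlt_le, invsq_pos; lra)).
    nra. }
  eapply Rle_trans; [|exact Hbig].
  pose proof (Rmax_l y A'). set (z := Rmax y A') in *.
  rewrite (RInt_Chasles_cont g x y z) by (try lra; intros; apply Hc; lra).
  pose proof (RInt_pos g y z ltac:(lra) ltac:(intros; apply Hc; lra) ltac:(intros; apply Hp; lra)). lra.
Qed.

Lemma has_tail_invsq x : 0 < x -> has_tail (invsq m) x.
Proof.
  intros Hx. apply (has_tail_dom _ x 1 x); auto.
  - intros; apply invsq_cont; lra.
  - intros; apply Rlt_le, invsq_pos; lra.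
  - intros; lra.
Qed.

Lemma wdef_le_invsq c x : 0 < x -> wdef m c x <= c ^ 2 * invsq m x.
Proof.
  intros Hx. eapply Rle_trans; [apply wdef_le|]. unfold invsq. apply Req_le.
  pose proof (profile_pos m Hm x Hx). field. lra.
Qed.

Lemma has_tail_wdef c x : 0 < x -> has_tail (wdef m c) x.
Proof.
  intros Hx. apply (has_tail_dom _ x (c ^ 2) x); auto.
  - intros; apply wdef_cont; auto; lra.
  - intros; apply wdef_range.
  - intros; apply wdef_le_invsq; lra.
Qed.

Lemma hdef_cont c x : 0 <= c < m x -> 0 < x -> continuous (hdef m c) x.
Proof.
  intros Hc Hx. pose proof (profile_cont m Hm x). unfold hdef.
  assert (0 < sqrt (m x ^ 2 - c ^ 2)) by (apply sqrt_lt_R0; nra).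
  apply (cont_div (fun _ => c) (fun x => m x * sqrt (m x ^ 2 - c ^ 2))).
  - cont.
  - cont.
  - assert (0 < m x * sqrt (m x ^ 2 - c ^ 2)) by (apply Rmult_lt_0_compat; lra). lra.
Qed.

Lemma hdef_ge0 c x : 0 <= c < m x -> 0 <= hdef m c x.
Proof.
  intros Hc. unfold hdef. assert (0 < sqrt (m x ^ 2 - c ^ 2)) by (apply sqrt_lt_R0; nra).
  apply Rdiv_le_0_compat; [lra|]. apply Rmult_lt_0_compat; lra.
Qed.

Lemma hdef_le_far c x : 0 <= c -> 0 < m x -> 2 * c <= m x -> hdef m c x <= 2 * c * invsq m x.
Proof.
  intros Hc Hx H. unfold hdef, invsq.
  assert (m x / 2 <= sqrt (m x ^ 2 - c ^ 2)).
  { rewrite <- (sqrt_pow2 (m x / 2)) by lra. apply sqrt_le_1_alt. nra. }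
  assert (0 < m x * sqrt (m x ^ 2 - c ^ 2)) by (apply Rmult_lt_0_compat; lra).
  apply div_le; auto.
  replace (2 * c * / m x ^ 2 * (m x * sqrt (m x ^ 2 - c ^ 2))) with
    (c * (2 * sqrt (m x ^ 2 - c ^ 2) / m x)) by (field; lra).
  rewrite <- (Rmult_1_r c) at 1. apply Rmult_le_compat_l; auto. apply le_div; lra.
Qed.

Lemma has_tail_hdef c x : 0 <= c -> 0 < x -> (forall t, x <= t -> c < m t) -> has_tail (hdef m c) x.
Proof.
  intros Hc Hx H. destruct (Hinf (2 * c)) as [A [HA1 HA2]].
  apply (has_tail_dom _ x (2 * c) A); auto.
  - intros; apply hdef_cont; [split; auto|lra].
  - intros; apply hdef_ge0; auto.
  - intros; apply hdef_le_far; auto. specialize (H t H1). lra.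
Qed.

(** For a geodesic of Clairaut constant [c] going outward from radius [x], the length minus [c]
    times the angle falls short of the increase in radius by an amount that tends to [W c x]. *)
Definition W (c x : R) : R := tail (wdef m c) x.

Lemma W_ge0 c x : 0 < x -> 0 <= W c x.
Proof. intros. now apply tail_ge0, has_tail_wdef. Qed.

Lemma W_Chasles c x y : 0 < x <= y -> W c x = RInt (wdef m c) x y + W c y.
Proof. intros [H1 H2]. apply tail_Chasles; auto. now apply has_tail_wdef. Qed.

Lemma W_lip c x y : 0 < x -> 0 < y -> Rabs (W c x - W c y) <= Rabs (x - y).
Proof.
  assert (H : forall x y, 0 < x <= y -> Rabs (W c x - W c y) <= Rabs (x - y)).
  { intros a b Hab. rewrite (W_Chasles c a b Hab).
    pose proof (wdef_RInt_range m Hm c a b Hab). rewrite Rabs_pos_eq by lra.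
    rewrite Rabs_left1 by lra. lra. }
  intros Hx Hy. destruct (Rle_dec x y) as [E|E].
  - apply H; lra.
  - rewrite (Rabs_minus_sym (W c x)), (Rabs_minus_sym x). apply H; lra.
Qed.

Lemma W_le_invsq c x : 0 < x -> W c x <= c ^ 2 * tail (invsq m) x.
Proof.
  intros Hx. unfold W. pose proof (has_tail_invsq x Hx) as H.
  apply (tail_le _ x (has_tail_wdef c x Hx)). intros y Hy.
  apply Rle_trans with (RInt (fun t => c ^ 2 * invsq m t) x y).
  - apply RInt_le_cont; auto.
    + intros; apply wdef_cont; auto; lra.
    + intros. apply (cont_mult (fun _ => c ^ 2)); [apply continuous_const|apply invsq_cont; lra].
    + intros; apply wdef_le_invsq; lra.
  - rewrite RInt_scal_cont by (auto; intros; apply invsq_cont; lra).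
    apply Rmult_le_compat_l; [apply pow2_ge_0|]. now apply RInt_le_tail.
Qed.

(** Beyond [A] the deficits are at most e/8 uniformly in [c], by the tail of 1/m^2. On [[x0, A]] the
    estimate [wdef_diff] is uniform because [m] is bounded below there. In [x] the deficit is
    1-Lipschitz. *)
Lemma W_cont_eps c0 x0 e : 0 < x0 -> 0 < e -> exists d, 0 < d /\ forall c x,
  Rabs (c - c0) < d -> Rabs (x - x0) < d -> Rabs (W c x - W c0 x0) < e.
Proof.
  intros Hx0 He.
  set (C := Rabs c0 + 1). assert (HC : 1 <= C) by (unfold C; pose proof (Rabs_pos c0); lra).
  pose proof (has_tail_invsq x0 Hx0) as HT.
  destruct (tail_small _ x0 (e / (8 * C ^ 2)) HT) as [A [HA1 HA2]].
  { apply Rdiv_lt_0_compat; auto. assert (0 < C * C) by nra. simpl; lra. }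
  specialize (HA2 A ltac:(lra)).
  assert (HA3 : C ^ 2 * tail (invsq m) A < e / 8).
  { apply (Rmult_lt_compat_l (C ^ 2)) in HA2; [|nra].
    replace (C ^ 2 * (e / (8 * C ^ 2))) with (e / 8) in HA2 by (field; lra). exact HA2. }
  destruct (profile_lower_bound m Hm x0 A ltac:(lra)) as [k [Hk1 Hk2]].
  assert (Hs : exists d1, 0 < d1 /\ forall c, Rabs (c - c0) < d1 ->
     sqrt (Rabs (c ^ 2 - c0 ^ 2)) / k * (A - x0) < e / 4).
  { assert (Hcont : continuous (fun c => sqrt (Rabs (c ^ 2 - c0 ^ 2)) / k * (A - x0)) c0) by (cont; lra).
    destruct (proj1 (cont_eps _ _) Hcont (e / 4) ltac:(lra)) as [d1 [D1 D2]].
    exists d1. split; auto. intros c Hc. specialize (D2 c Hc). cbv beta in D2.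
    rewrite (Rminus_diag (c0 ^ 2)), Rabs_R0, sqrt_0 in D2.
    replace (0 / k * (A - x0)) with 0 in D2 by (field; lra).
    rewrite Rminus_0_r in D2. eapply Rle_lt_trans; [apply Rle_abs|exact D2]. }
  destruct Hs as [d1 [D1 D2]].
  exists (Rmin (Rmin d1 1) (Rmin (e / 4) (x0 / 2))). split.
  { repeat apply Rmin_glb_lt; lra. }
  intros c x Hc Hx.
  assert (Hc1 : Rabs (c - c0) < d1) by (eapply Rlt_le_trans; [exact Hc|];
    eapply Rle_trans; [apply Rmin_l|apply Rmin_l]).
  assert (Hc2 : Rabs (c - c0) < 1) by (eapply Rlt_le_trans; [exact Hc|];
    eapply Rle_trans; [apply Rmin_l|apply Rmin_r]).
  assert (Hx1 : Rabs (x - x0) < e / 4) by (eapply Rlt_le_trans; [exact Hx|];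
    eapply Rle_trans; [apply Rmin_r|apply Rmin_l]).
  assert (Hx2 : Rabs (x - x0) < x0 / 2) by (eapply Rlt_le_trans; [exact Hx|];
    eapply Rle_trans; [apply Rmin_r|apply Rmin_r]).
  assert (Hxp : 0 < x) by (apply Rabs_def2 in Hx2; lra).
  pose proof (W_lip c x x0 Hxp Hx0) as HL.
  assert (Hcc : Rabs (W c x0 - W c0 x0) < e / 2).
  { rewrite (W_Chasles c x0 A), (W_Chasles c0 x0 A) by lra.
    assert (HWA : forall c', Rabs c' <= C -> 0 <= W c' A <= e / 8).
    { intros c' Hc'. split; [apply W_ge0; lra|].
      pose proof (W_le_invsq c' A ltac:(lra)).
      assert (c' ^ 2 <= C ^ 2) by (rewrite <- (pow2_abs c'); pose proof (Rabs_pos c'); nra).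
      pose proof (tail_ge0 _ A (has_tail_shift _ _ HT A HA1)). nra. }
    assert (B1 : 0 <= W c A <= e / 8).
    { apply HWA. unfold C. pose proof (Rabs_triang (c - c0) c0).
      replace (c - c0 + c0) with c in H by ring. lra. }
    assert (B2 : 0 <= W c0 A <= e / 8) by (apply HWA; unfold C; lra).
    assert (Hcw : forall c' t, x0 <= t <= A -> continuous (wdef m c') t)
      by (intros; apply wdef_cont; auto; lra).
    assert (B3 : Rabs (RInt (wdef m c) x0 A - RInt (wdef m c0) x0 A) < e / 4).
    { rewrite <- RInt_minus_cont by auto.
      eapply Rle_lt_trans; [|exact (D2 c Hc1)].
      eapply Rle_trans; [apply abs_RInt_le; [lra|]; apply ex_RInt_cont; [lra|];
        intros; apply cont_minus; auto|].
      rewrite <- RInt_const_R. apply RInt_le_cont; [lra| |intros; apply continuous_const|].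
      - intros. apply (cont_abs (fun t => wdef m c t - wdef m c0 t)). apply cont_minus; auto.
      - intros t Ht. pose proof (profile_pos m Hm t ltac:(lra)).
        eapply Rle_trans; [apply wdef_diff; auto|].
        apply Rmult_le_compat_l; [apply sqrt_pos|].
        apply Rinv_le_contravar; auto. }
    revert B3. unfold Rabs. do 2 destruct Rcase_abs; lra. }
  replace (W c x - W c0 x0) with ((W c x - W c x0) + (W c x0 - W c0 x0)) by ring.
  eapply Rle_lt_trans; [apply Rabs_triang|]. lra.
Qed.

Lemma cont_W (f g : R -> R) t : continuous f t -> continuous g t -> 0 < g t ->
  continuous (fun t => W (f t) (g t)) t.
Proof.
  intros Hf Hg Hp. apply cont_eps. intros e He.
  destruct (W_cont_eps (f t) (g t) e Hp He) as [d [D1 D2]].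
  destruct (proj1 (cont_eps _ _) Hf d D1) as [d1 [E1 E2]].
  destruct (proj1 (cont_eps _ _) Hg d D1) as [d2 [F1 F2]].
  exists (Rmin d1 d2). split; [now apply Rmin_glb_lt|]. intros y Hy. apply D2.
  - apply E2. eapply Rlt_le_trans; [exact Hy|apply Rmin_l].
  - apply F2. eapply Rlt_le_trans; [exact Hy|apply Rmin_r].
Qed.

(** The largest constant with which every curve staying outside radius [x] can be calibrated. *)
Definition cstar (x : R) : R := real (Glb_Rbar (fun v => exists t, x <= t /\ v = m t)).

Lemma cstar_attained x : 0 <= x -> (forall t, x <= t -> cstar x <= m t) /\ exists t, x <= t /\ m t = cstar x.
Proof.
  intros Hx. destruct (Hinf (m x)) as [A [HA1 HA2]].
  destruct (min_attained m x (Rmax A x)) as [t0 [Ht0 Hmin]].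
  { apply Rmax_r. } { intros; now apply profile_cont. }
  assert (Hall : forall t, x <= t -> m t0 <= m t).
  { intros t Ht. destruct (Rle_dec t (Rmax A x)) as [H|H]; [apply Hmin; lra|].
    apply Rle_trans with (m x).
    - apply Hmin. pose proof (Rmax_r A x). lra.
    - apply HA2. pose proof (Rmax_l A x). lra. }
  assert (E : cstar x = m t0).
  { unfold cstar. rewrite (is_glb_Rbar_unique _ (Finite (m t0))); auto. split.
    - intros v [t [Ht ->]]. simpl. auto.
    - intros b Hb. apply (Hb (m t0)). exists t0. split; auto; lra. }
  rewrite E. split; auto. exists t0. split; auto; lra.
Qed.

Lemma cstar_le x t : 0 <= x <= t -> cstar x <= m t.
Proof. intros [H1 H2]. now apply cstar_attained. Qed.

Lemma cstar_ge x k : 0 <= x -> (forall t, x <= t -> k <= m t) -> k <= cstar x.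
Proof. intros Hx H. destruct (cstar_attained x Hx) as [_ [t [Ht <-]]]. auto. Qed.

Lemma cstar_mono x y : 0 <= x <= y -> cstar x <= cstar y.
Proof. intros Hxy. apply cstar_ge; [lra|]. intros; apply cstar_le; lra. Qed.

Lemma cstar_pos x : 0 < x -> 0 < cstar x.
Proof.
  intros Hx. destruct (cstar_attained x ltac:(lra)) as [_ [t [Ht <-]]].
  apply profile_pos; auto; lra.
Qed.

Lemma cstar_cont x : 0 < x -> continuous cstar x.
Proof.
  intros Hx. apply cont_eps. intros e He.
  destruct (proj1 (cont_eps m x) (profile_cont m Hm x) (e / 2) ltac:(lra)) as [d [D1 D2]].
  assert (Haux : forall a b, 0 < a <= b -> Rabs (a - x) < d -> Rabs (b - x) < d ->
     Rabs (cstar b - cstar a) < e).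
  { intros a b Hab Ha Hb. pose proof (cstar_mono a b ltac:(lra)).
    rewrite Rabs_pos_eq by lra.
    destruct (cstar_attained a ltac:(lra)) as [_ [t [Ht E]]].
    destruct (Rle_dec b t) as [Hbt|Hbt].
    - pose proof (cstar_le b t ltac:(lra)). lra.
    - pose proof (cstar_le b b ltac:(lra)).
      assert (Rabs (t - x) < d) by (apply Rabs_def1; apply Rabs_def2 in Ha; apply Rabs_def2 in Hb; lra).
      pose proof (D2 b Hb) as P1. pose proof (D2 t H1) as P2.
      apply Rabs_def2 in P1. apply Rabs_def2 in P2. lra. }
  exists (Rmin d (x / 2)). split; [apply Rmin_glb_lt; lra|]. intros y Hy.
  assert (H1 : Rabs (y - x) < d) by (eapply Rlt_le_trans; [exact Hy|apply Rmin_l]).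
  assert (H2 : Rabs (y - x) < x / 2) by (eapply Rlt_le_trans; [exact Hy|apply Rmin_r]).
  apply Rabs_def2 in H2.
  assert (H0 : Rabs (x - x) < d) by (rewrite Rminus_diag, Rabs_R0; auto).
  destruct (Rle_dec x y) as [E|E].
  - apply Haux; auto; lra.
  - rewrite Rabs_minus_sym. apply Haux; auto; lra.
Qed.

(** Limit of (length - final radius) for a curve with Clairaut constant [c] which goes from radius [R0]
    down to [x] and then to infinity, the missing angle up to [phi] costing [c] per radian. *)
Definition Phi (phi R0 c x : R) : R := c * phi + R0 - 2 * x - 2 * W c x + W c R0.

(** The junction value at [x <= 0] is the length defect of the path through the origin. *)
Definition Fcap (c2 phi R0 x : R) : R :=
  if Rle_dec x 0 then R0 else Phi phi R0 (Rmin (cstar x) c2) x.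

Lemma Fcap_pos c2 phi R0 x : 0 < x -> Fcap c2 phi R0 x = Phi phi R0 (Rmin (cstar x) c2) x.
Proof. intros H. unfold Fcap. destruct Rle_dec; auto; lra. Qed.

Lemma cont_min (f g : R -> R) t : continuous f t -> continuous g t ->
  continuous (fun t => Rmin (f t) (g t)) t.
Proof.
  intros Hf Hg. apply (continuous_ext (fun t => (f t + g t - Rabs (f t - g t)) / 2)).
  - intros s. unfold Rmin. destruct Rle_dec.
    + rewrite Rabs_left1 by lra. fieldR.
    + rewrite Rabs_pos_eq by lra. fieldR.
  - cont. lra.
Qed.

Lemma cont_Phi (f r c x : R -> R) t : continuous f t -> continuous r t -> continuous c t ->
  continuous x t -> 0 < r t -> 0 < x t -> continuous (fun t => Phi (f t) (r t) (c t) (x t)) t.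
Proof.
  intros Hf Hr Hc Hx Rp Xp.
  pose proof (cont_W c x t Hc Hx Xp). pose proof (cont_W c r t Hc Hr Rp).
  unfold Phi. cont.
Qed.

Lemma profile_near0 : exists d, 0 < d /\ forall x, 0 < x <= d -> x / 2 <= m x <= 2 * x.
Proof.
  destruct (proj1 (cont_eps (mu m) 0) (mu_cont m Hm 0) (/ 2) ltac:(lra)) as [d [D1 D2]].
  exists (d / 2). split; [lra|]. intros x Hx.
  specialize (D2 x). rewrite Rminus_0_r, Rabs_pos_eq in D2 by lra. specialize (D2 ltac:(lra)).
  unfold mu in D2. destruct (Req_EM_T x 0); [lra|]. destruct (Req_EM_T 0 0); [|lra].
  apply Rabs_def2 in D2.
  assert (E : m x = m x / x * x) by (field; lra). rewrite E. nra.
Qed.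

Lemma tail_invsq_near0 : exists d K, 0 < d /\ 0 < K /\ forall x, 0 < x <= d -> tail (invsq m) x <= K / x.
Proof.
  destruct profile_near0 as [d [D1 D2]].
  pose proof (tail_ge0 _ d (has_tail_invsq d D1)) as HT.
  exists d, (4 + tail (invsq m) d * d). split; auto. split; [nra|]. intros x Hx.
  rewrite (tail_Chasles _ x d) by (try lra; apply has_tail_invsq; lra).
  assert (RInt (invsq m) x d <= 4 / x - 4 / d).
  { replace (4 / x - 4 / d) with (- 4 / d - - 4 / x) by (unfold Rdiv; ring).
    rewrite <- (RInt_deriv (fun t => - 4 / t) (fun t => 4 / t ^ 2) x d).
    - apply RInt_le_cont; [lra|intros; apply invsq_cont; lra| |].
      + intros. cont. apply pow_nonzero; lra.
      + intros t Ht. unfold invsq. specialize (D2 t ltac:(lra)).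
        replace (4 / t ^ 2) with (/ (t / 2) ^ 2) by (field; lra).
        apply Rinv_le_contravar; [apply pow_lt; lra|]. apply pow_incr. lra.
    - lra.
    - intros t Ht. auto_derive; [lra|]. field. lra.
    - intros. cont. apply pow_nonzero; lra. }
  assert (0 <= 4 / d) by (apply Rdiv_le_0_compat; lra).
  apply le_div; [lra|].
  apply (Rmult_le_compat_r x) in H; [|lra].
  replace ((4 / x - 4 / d) * x) with (4 - 4 / d * x) in H by (field; lra).
  nra.
Qed.

(** Only the origin needs care. There the Clairaut constant is at most [m y <= 2 y], while the
    integral of 1/m^2 from [y] on is of order 1/y, so every correction to [R0] is of order [y]. *)
Lemma Fcap_cont c2 phi R0 x : 0 < R0 -> 0 < c2 -> 0 <= phi -> 0 <= x -> continuous (Fcap c2 phi R0) x.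
Proof.
  intros HR Hc2 Hphi Hx.
  destruct (Rle_lt_or_eq_dec 0 x Hx) as [Hp|<-].
  - apply (continuous_ext_loc _ (fun x => Phi phi R0 (Rmin (cstar x) c2) x)).
    + exists (mkposreal x Hp). intros y Hy. apply Rabs_def2 in Hy.
      unfold minus, plus, opp in Hy; simpl in Hy.
      symmetry; apply Fcap_pos. lra.
    + apply (cont_Phi (fun _ => phi) (fun _ => R0) (fun x => Rmin (cstar x) c2) (fun x => x));
        auto; try apply continuous_const; try apply continuous_id.
      apply (cont_min cstar (fun _ => c2)); [now apply cstar_cont|apply continuous_const].
  - destruct profile_near0 as [d1 [D1 D2]].
    destruct tail_invsq_near0 as [d2 [K [D3 [HK D4]]]].
    (* The summands bound, in units of [y], the angular term, the radius, the two deficits from [y]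
       and the deficit from [R0]. *)
    set (C := 2 * phi + 2 + 8 * K + 4 * tail (invsq m) R0).
    pose proof (tail_ge0 _ R0 (has_tail_invsq R0 HR)) as HT.
    assert (HC : 0 < C) by (unfold C; lra).
    apply cont_eps. intros e He.
    exists (Rmin (Rmin d1 d2) (Rmin 1 (e / C))). split.
    { repeat apply Rmin_glb_lt; try lra. now apply Rdiv_lt_0_compat. }
    intros y Hy. rewrite Rminus_0_r in Hy.
    assert (E0 : Fcap c2 phi R0 0 = R0) by (unfold Fcap; destruct Rle_dec; lra). rewrite E0.
    destruct (Rle_dec y 0) as [Hy0|Hy0].
    { unfold Fcap. destruct Rle_dec; [|lra]. rewrite Rminus_diag, Rabs_R0. auto. }
    rewrite Fcap_pos by lra.
    rewrite Rabs_pos_eq in Hy by lra.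
    assert (Y1 : y < d1) by (eapply Rlt_le_trans; [exact Hy|]; eapply Rle_trans; [apply Rmin_l|apply Rmin_l]).
    assert (Y2 : y < d2) by (eapply Rlt_le_trans; [exact Hy|]; eapply Rle_trans; [apply Rmin_l|apply Rmin_r]).
    assert (Y3 : y < 1) by (eapply Rlt_le_trans; [exact Hy|]; eapply Rle_trans; [apply Rmin_r|apply Rmin_l]).
    assert (Y4 : y < e / C) by (eapply Rlt_le_trans; [exact Hy|]; eapply Rle_trans; [apply Rmin_r|apply Rmin_r]).
    set (c := Rmin (cstar y) c2).
    assert (Hc : 0 <= c <= 2 * y).
    { unfold c. split.
      - apply Rlt_le, Rmin_glb_lt; auto. apply cstar_pos; lra.
      - eapply Rle_trans; [apply Rmin_l|]. pose proof (cstar_le y y ltac:(lra)).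
        specialize (D2 y ltac:(lra)). lra. }
    assert (W1 : 0 <= W c y <= 4 * K * y).
    { split; [apply W_ge0; lra|]. eapply Rle_trans; [apply W_le_invsq; lra|].
      specialize (D4 y ltac:(lra)).
      pose proof (tail_ge0 _ y (has_tail_invsq y ltac:(lra))).
      apply Rle_trans with ((2 * y) ^ 2 * (K / y)).
      - apply Rmult_le_compat; auto; nra.
      - apply Req_le. field. lra. }
    assert (W2 : 0 <= W c R0 <= 4 * tail (invsq m) R0 * y).
    { split; [apply W_ge0; lra|]. eapply Rle_trans; [apply W_le_invsq; lra|].
      assert (c ^ 2 <= 4 * y) by nra. nra. }
    unfold Phi. apply Rle_lt_trans with (C * y).
    + apply Rabs_le. unfold C. assert (0 <= c * phi <= 2 * phi * y) by nra. nra.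
    + apply (Rmult_lt_compat_l C) in Y4; auto.
      replace (C * (e / C)) with e in Y4 by (field; lra). exact Y4.
Qed.

End Main.

(** Continuity of [g] comes from the strict monotonicity of [f]; then the difference quotient of [f]
    is inverted. It will be applied to the arclength function. *)
Lemma inverse_derive (f df g : R -> R) :
  (forall x, is_derive f x (df x)) -> (forall x, 0 < df x) -> (forall t, f (g t) = t) ->
  forall t, is_derive g t (/ df (g t)).
Proof.
  intros Hf Hp Hg t.
  assert (Hinc : forall a b, a < b -> f a < f b).
  { intros a b Hab. apply (mono_strict_of_deriv f df); auto. }
  assert (Hcont : forall e, 0 < e -> exists d, 0 < d /\ forall h, Rabs h < d -> Rabs (g (t + h) - g t) < e).
  { intros e He. set (x := g t).
    exists (Rmin (f (x + e) - f x) (f x - f (x - e))). split.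
    - apply Rmin_glb_lt; [pose proof (Hinc x (x + e)); lra|pose proof (Hinc (x - e) x); lra].
    - intros h Hh.
      assert (H1 : Rabs h < f (x + e) - f x) by (eapply Rlt_le_trans; [exact Hh|apply Rmin_l]).
      assert (H2 : Rabs h < f x - f (x - e)) by (eapply Rlt_le_trans; [exact Hh|apply Rmin_r]).
      apply Rabs_def2 in H1. apply Rabs_def2 in H2.
      pose proof (Hg (t + h)) as Ex. pose proof (Hg t) as E0. fold x in E0.
      apply Rabs_def1.
      + apply Rnot_le_lt. intros Hl. destruct (Rle_lt_or_eq_dec (x + e) (g (t + h))) as [H|H]; [lra| |].
        * pose proof (Hinc _ _ H). lra.
        * rewrite H in H1. lra.
      + apply Rnot_le_lt. intros Hl. destruct (Rle_lt_or_eq_dec (g (t + h)) (x - e)) as [H|H]; [lra| |].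
        * pose proof (Hinc _ _ H). lra.
        * rewrite <- H in H2. lra. }
  apply is_derive_Reals. intros eps Heps.
  set (L := df (g t)). assert (HL : 0 < L) by apply Hp.
  pose proof (proj1 (is_derive_Reals _ _ _) (Hf (g t))) as Hd.
  set (eps1 := Rmin (L / 2) (eps * (L * L) / 4)).
  assert (He1 : 0 < eps1).
  { apply Rmin_glb_lt; [lra|]. assert (0 < eps * (L * L)) by (apply Rmult_lt_0_compat; nra). lra. }
  destruct (Hd eps1 He1) as [d1 Hd1].
  destruct (Hcont d1 (cond_pos d1)) as [d [Hd0 Hd2]].
  exists (mkposreal d Hd0). intros h Hh Hhd. simpl in Hhd.
  set (k := g (t + h) - g t).
  assert (Hk : k <> 0).
  { intros E. assert (g (t + h) = g t) by (unfold k in E; lra).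
    pose proof (Hg (t + h)). pose proof (Hg t). rewrite H in H0. lra. }
  assert (Ehk : h = f (g t + k) - f (g t)).
  { unfold k. replace (g t + (g (t + h) - g t)) with (g (t + h)) by ring. rewrite !Hg. ring. }
  specialize (Hd1 k Hk (Hd2 h Hhd)). rewrite <- Ehk in Hd1. fold L in Hd1.
  assert (B1 : eps1 <= L / 2) by apply Rmin_l.
  assert (B2 : eps1 <= eps * (L * L) / 4) by apply Rmin_r.
  set (u := h / k) in *. apply Rabs_def2 in Hd1.
  assert (Hu : L / 2 < u) by lra.
  replace (k / h) with (/ u) by (unfold u; field; auto).
  replace (/ u - / L) with ((L - u) / (u * L)) by (field; lra).
  rewrite Rabs_div by nra. rewrite (Rabs_pos_eq (u * L)) by nra.
  apply (Rmult_lt_reg_r (u * L)); [nra|].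
  replace (Rabs (L - u) / (u * L) * (u * L)) with (Rabs (L - u)) by (field; lra).
  apply Rlt_le_trans with (eps * (L * L) / 4 + eps * (L * L) / 4).
  - assert (Rabs (L - u) < eps1) by (apply Rabs_def1; lra).
    assert (0 < eps * (L * L)) by (apply Rmult_lt_0_compat; nra). lra.
  - assert (L * L / 2 <= u * L) by nra. nra.
Qed.

(** * Lower bounds and turning geodesics *)

Section Lower.
Context (m : R -> R) (Hm : profile m) (HJ : fin_invsq m) (Hinf : unbounded m).

(** Here [x] is the minimal radius, so [m] is at least [cstar x] along the curve and calibration
    with [Rmin (cstar x) c2] is allowed. Replacing the deficit up to radius [r] by the one up to
    infinity only lowers the bound. Curves through the origin are covered by the purely radial
    bound. *)
Lemma curve_Fcap c R0 r a c2 : C1_curve c -> 0 < R0 -> 0 < r -> 0 < c2 -> 0 <= a <= PI ->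
  enorm (c 0) = R0 -> enorm (c 1) = r -> dot (c 0) (c 1) = R0 * r * cos a ->
  exists x, 0 <= x /\ (forall t, 0 <= t <= 1 -> x <= enorm (c t)) /\
    r + Fcap m c2 a R0 x <= RInt (speed m c) 0 1.
Proof.
  intros Hc HR Hr Hc2 Ha E0 E1 Hdot.
  destruct (curve_lower m Hm c Hc) as [t0 [Ht0 [Hmin [HA HB]]]].
  rewrite E0, E1 in *.
  set (x := enorm (c t0)) in *. assert (Hx : 0 <= x) by apply enorm_ge0.
  exists x. split; auto. split; auto.
  destruct (Rle_lt_or_eq_dec 0 x Hx) as [Hp|E].
  - rewrite Fcap_pos by auto. set (k := Rmin (cstar m x) c2).
    assert (Hk : 0 <= k) by (apply Rlt_le, Rmin_glb_lt; auto; apply cstar_pos; auto).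
    specialize (HB Hp k a Hk Ha).
    assert (Hkm : forall t, 0 <= t <= 1 -> k <= m (enorm (c t))).
    { intros t Ht. eapply Rle_trans; [apply Rmin_l|]. apply cstar_le; auto. }
    specialize (HB Hkm Hdot).
    pose proof (Hmin 0 ltac:(lra)) as M0. pose proof (Hmin 1 ltac:(lra)) as M1. rewrite E0 in M0; rewrite E1 in M1.
    pose proof (W_Chasles m Hm HJ k x R0 ltac:(lra)) as W1.
    pose proof (W_Chasles m Hm HJ k x r ltac:(lra)) as W2.
    pose proof (W_ge0 m Hm HJ k r Hr). unfold Phi. lra.
  - unfold Fcap. destruct Rle_dec; lra.
Qed.

Lemma dr_lower p q R0 r a c2 V : 0 < R0 -> 0 < r -> 0 < c2 -> 0 <= a <= PI ->
  enorm p = R0 -> enorm q = r -> dot p q = R0 * r * cos a ->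
  (forall x, 0 <= x <= R0 -> V <= Fcap m c2 a R0 x) -> r + V <= dr m p q.
Proof.
  intros HR Hr Hc2 Ha Ep Eq Hd HV. apply dr_ge; auto. intros c Hc <- <-.
  destruct (curve_Fcap c R0 r a c2 Hc HR Hr Hc2 Ha Ep Eq Hd) as [x [Hx [Hm' HL]]].
  pose proof (Hm' 0 ltac:(lra)). specialize (HV x ltac:(lra)). lra.
Qed.

End Lower.

Section Geo.
Context (m : R -> R) (Hm : profile m) (HJ : fin_invsq m) (Hinf : unbounded m)
  (rho : R) (Hrho : 0 < rho) (Hm1 : 0 < Derive m rho) (Hgt : forall x, rho < x -> m rho < m x).

Let cc := m rho.

(** The difference quotient of m^2 at [rho], completed by the derivative. The hypothesis
    [0 < Derive m rho] makes it positive at [rho] itself, so that its root [SS] can be divided by at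
    the turning point. *)
Definition EE (x : R) : R :=
  if Req_EM_T x rho then 2 * m rho * Derive m rho else (m x ^ 2 - m rho ^ 2) / (x - rho).
(** The substitution [r = rho + s^2] desingularizes the geodesic tangent to the parallel of radius [rho]:
    [th s] and [al s] are its polar angle and arclength, counted from the turning point. *)
Definition rs (s : R) : R := rho + s ^ 2.
Definition SS (s : R) : R := sqrt (EE (rs s)).
Definition thd (s : R) : R := 2 * m rho / (m (rs s) * SS s).
Definition sd (s : R) : R := 2 * m (rs s) / SS s.
Definition th (s : R) : R := RInt thd 0 s.
Definition al (s : R) : R := RInt sd 0 s.
(** The signed square root of m(r)^2 - m(rho)^2, which is [m] times the radial speed: negative
    before the turning point, positive after it. *)
Definition ys (s : R) : R := s * SS s.

Lemma cc_pos : 0 < cc.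
Proof. apply profile_pos; auto. Qed.

Lemma rs_ge s : rho <= rs s.
Proof. unfold rs. pose proof (pow2_ge_0 s). lra. Qed.

Lemma m_rs_pos s : 0 < m (rs s).
Proof. apply profile_pos; auto. pose proof (rs_ge s). lra. Qed.

Lemma m_rs_ge s : cc <= m (rs s).
Proof.
  destruct (Rle_lt_or_eq_dec rho (rs s) (rs_ge s)) as [H|<-]; [|unfold cc; lra].
  apply Rlt_le, Hgt, H.
Qed.

Lemma EE_pos x : rho <= x -> 0 < EE x.
Proof.
  intros Hx. pose proof cc_pos. unfold cc in H. unfold EE. destruct Req_EM_T as [E|n].
  - apply Rmult_lt_0_compat; lra.
  - specialize (Hgt x ltac:(lra)). apply Rdiv_lt_0_compat; nra.
Qed.

Lemma EE_cont x : continuous EE x.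
Proof.
  destruct (Req_dec x rho) as [->|Hx].
  - apply cont_eps. intros e He.
    assert (Hd : is_derive (fun x => m x ^ 2) rho (2 * m rho * Derive m rho)).
    { pose proof (profile_derive m Hm rho). auto_derive; [repeat split; eexists; eauto|].
      change (Derive (fun x => m x) rho) with (Derive m rho). ring. }
    apply is_derive_Reals in Hd. destruct (Hd e He) as [d D].
    exists d. split; [apply cond_pos|]. intros y Hy. unfold EE.
    destruct (Req_EM_T rho rho); [|lra]. destruct (Req_EM_T y rho) as [|n].
    + rewrite Rminus_diag, Rabs_R0; auto.
    + specialize (D (y - rho) ltac:(lra) Hy).
      replace (rho + (y - rho)) with y in D by ring. exact D.
  - apply (continuous_ext_loc _ (fun x => (m x ^ 2 - m rho ^ 2) / (x - rho))).
    + assert (Hp : 0 < Rabs (x - rho)) by (apply Rabs_pos_lt; lra).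
      exists (mkposreal _ Hp). intros y Hy. simpl in Hy.
      unfold EE. destruct (Req_EM_T y rho) as [->|]; auto.
      exfalso. revert Hy. unfold ball; simpl. unfold AbsRing_ball, abs, minus, plus, opp; simpl.
      intros Hy. replace (rho + - x) with (- (x - rho)) in Hy by ring. rewrite Rabs_Ropp in Hy. lra.
    + pose proof (profile_cont m Hm x). cont. lra.
Qed.

Lemma rs_cont s : continuous rs s.
Proof. unfold rs. cont. Qed.

Lemma m_rs_cont s : continuous (fun s => m (rs s)) s.
Proof. apply (cont_comp rs m); [apply rs_cont|now apply profile_cont]. Qed.

Lemma SS_pos s : 0 < SS s.
Proof. apply sqrt_lt_R0, EE_pos, rs_ge. Qed.

Lemma SS_sq s : SS s * SS s = EE (rs s).
Proof. apply sqrt_sqrt, Rlt_le, EE_pos, rs_ge. Qed.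

Lemma SS_cont s : continuous SS s.
Proof. apply cont_sqrt. apply (cont_comp rs EE); [apply rs_cont|apply EE_cont]. Qed.

Lemma thd_cont s : continuous thd s.
Proof.
  pose proof (m_rs_cont s). pose proof (SS_cont s). pose proof (m_rs_pos s). pose proof (SS_pos s).
  unfold thd. cont. assert (0 < m (rs s) * SS s) by (apply Rmult_lt_0_compat; auto). lra.
Qed.

Lemma sd_cont s : continuous sd s.
Proof.
  pose proof (m_rs_cont s). pose proof (SS_cont s). pose proof (SS_pos s). unfold sd. cont. lra.
Qed.

Lemma thd_pos s : 0 < thd s.
Proof.
  pose proof cc_pos. unfold cc in H. pose proof (m_rs_pos s). pose proof (SS_pos s). unfold thd.
  apply Rdiv_lt_0_compat; [lra|]. apply Rmult_lt_0_compat; auto.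
Qed.

Lemma sd_pos s : 0 < sd s.
Proof.
  pose proof (m_rs_pos s). pose proof (SS_pos s). unfold sd. apply Rdiv_lt_0_compat; lra.
Qed.

Lemma th_derive s : is_derive th s (thd s).
Proof. apply is_derive_RInt_cont, thd_cont. Qed.

Lemma al_derive s : is_derive al s (sd s).
Proof. apply is_derive_RInt_cont, sd_cont. Qed.

Lemma th_0 : th 0 = 0.
Proof. unfold th. now rewrite RInt_point. Qed.

Lemma al_0 : al 0 = 0.
Proof. unfold al. now rewrite RInt_point. Qed.

Lemma rs_even s : rs (- s) = rs s.
Proof. unfold rs. ring. Qed.

Lemma odd_of_even_deriv (f df : R -> R) : (forall x, is_derive f x (df x)) ->
  (forall x, df (- x) = df x) -> f 0 = 0 -> forall x, 0 <= x -> f (- x) = - f x.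
Proof.
  intros Hf He H0.
  assert (Hd : forall x, is_derive (fun x => f (- x) + f x) x 0).
  { intros x. replace 0 with (- 1 * df (- x) + df x) by (rewrite He; ring).
    apply (is_derive_plus (fun x => f (- x)) f); auto.
    apply (is_derive_comp f (fun x => - x)); auto. auto_derive; auto; ring. }
  intros x Hx.
  assert (H1 : f (- 0) + f 0 <= f (- x) + f x).
  { apply (mono_of_deriv (fun x => f (- x) + f x) (fun _ => 0)); auto. intros; lra. }
  assert (H2 : - (f (- 0) + f 0) <= - (f (- x) + f x)).
  { apply (mono_of_deriv (fun x => - (f (- x) + f x)) (fun _ => 0)); auto; [|intros; lra].
    intros z _. rewrite <- Ropp_0. apply (is_derive_opp (fun x => f (- x) + f x) z 0 (Hd z)). }
  rewrite Ropp_0, H0 in *. lra.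
Qed.

Lemma th_odd s : 0 <= s -> th (- s) = - th s.
Proof.
  apply (odd_of_even_deriv th thd); [apply th_derive| |apply th_0].
  intros x. unfold thd, SS. now rewrite rs_even.
Qed.

Lemma al_odd s : 0 <= s -> al (- s) = - al s.
Proof.
  apply (odd_of_even_deriv al sd); [apply al_derive| |apply al_0].
  intros x. unfold sd, SS. now rewrite rs_even.
Qed.

Lemma th_mono a b : a <= b -> th a <= th b.
Proof.
  intros. apply (mono_of_deriv th thd); auto; intros; [apply th_derive|apply Rlt_le, thd_pos].
Qed.

Lemma al_incr a b : a < b -> al a < al b.
Proof.
  intros. apply (mono_strict_of_deriv al sd); auto; intros; [apply al_derive|apply sd_pos].
Qed.

Lemma ys_sq s : ys s ^ 2 = m (rs s) ^ 2 - m rho ^ 2.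
Proof.
  unfold ys. replace ((s * SS s) ^ 2) with (s ^ 2 * (SS s * SS s)) by ring. rewrite SS_sq.
  unfold EE. destruct Req_EM_T as [E|n].
  - rewrite E. assert (s ^ 2 = 0) as -> by (unfold rs in E; lra). ring.
  - unfold rs in *. field. intros E; apply n. lra.
Qed.

(** At 0 only continuity of [SS] is known, but the difference quotient of [s * SS s] there is [SS]
    itself; elsewhere the chain rule applies. Per unit of arclength the result reads (m r')' =
    m'(r), the radial geodesic equation in the form that the comparison will use. *)
Lemma ys_derive s : is_derive ys s (2 * m (rs s) * Derive m (rs s) / SS s).
Proof.
  destruct (Req_dec s 0) as [->|Hs].
  - apply is_derive_Reals. intros e He.
    destruct (proj1 (cont_eps SS 0) (SS_cont 0) e He) as [d [D1 D2]].
    exists (mkposreal d D1). intros h Hh Hhd. simpl in Hhd. unfold ys.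
    rewrite Rplus_0_l. replace ((h * SS h - 0 * SS 0) / h) with (SS h) by (field; auto).
    assert (E : 2 * m (rs 0) * Derive m (rs 0) / SS 0 = SS 0).
    { apply (Rmult_eq_reg_r (SS 0)); [|pose proof (SS_pos 0); lra].
      rewrite SS_sq. replace (rs 0) with rho by (unfold rs; ring).
      unfold EE. destruct Req_EM_T; [|lra]. field. pose proof (SS_pos 0); lra. }
    rewrite E. apply D2. now rewrite Rminus_0_r.
  - assert (Hloc : locally s (fun z => z * sqrt ((m (rho + z ^ 2) ^ 2 - m rho ^ 2) / z ^ 2) = ys z)).
    { assert (Hp : 0 < Rabs s) by (now apply Rabs_pos_lt).
      exists (mkposreal _ Hp). intros z Hz. revert Hz. unfold ball; simpl.
      unfold AbsRing_ball, abs, minus, plus, opp; simpl. intros Hz.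
      assert (Hz0 : z <> 0) by (intros ->; rewrite Rplus_0_l, Rabs_Ropp in Hz; lra).
      unfold ys, SS, EE, rs. destruct Req_EM_T as [E|n].
      - exfalso. assert (0 < z * z) by nra. simpl in E. lra.
      - f_equal. f_equal. f_equal. ring. }
    apply (is_derive_ext_loc _ _ _ _ Hloc).
    assert (Hrs : rs s <> rho) by (unfold rs; assert (0 < s * s) by nra; simpl; lra).
    assert (Ess : (m (rho + s ^ 2) ^ 2 - m rho ^ 2) / s ^ 2 = EE (rs s)).
    { unfold EE. destruct Req_EM_T; [lra|]. unfold rs. f_equal. ring. }
    pose proof (EE_pos (rs s) (rs_ge s)) as HE. rewrite <- Ess in HE.
    pose proof (profile_derive m Hm (rs s)) as Dm.
    set (q := fun z => (m (rho + z ^ 2) ^ 2 - m rho ^ 2) / z ^ 2) in *.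
    assert (Drs : is_derive rs s (2 * s)) by (unfold rs; auto_derive; auto; ring).
    assert (Dmr : is_derive (fun z => m (rs z)) s (2 * s * Derive m (rs s)))
      by (apply (is_derive_comp m rs); auto).
    assert (Dq : is_derive q s (2 * (2 * m (rs s) * Derive m (rs s) - EE (rs s)) / s)).
    { unfold q. apply (is_derive_ext (fun z => (m (rs z) ^ 2 - m rho ^ 2) / z ^ 2)); [reflexivity|].
      set (g := fun z => m (rs z)) in *.
      apply (is_derive_ext (fun z => (g z ^ 2 - m rho ^ 2) / z ^ 2)); [reflexivity|].
      assert (Eg : Derive g s = 2 * s * Derive m (rs s)) by (apply is_derive_unique, Dmr).
 rewrite <- Ess. fold (rs s).
      change (m (rs s)) with (g s) at 2. replace (rho + s ^ 2) with (rs s) by reflexivity.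
      change (m (rs s)) with (g s).
      auto_derive.
      - repeat split; [eexists; exact Dmr|nra].
      - change (Derive (fun x => g x) s) with (Derive g s). rewrite Eg. simpl. field. auto. }
    assert (HE' : 0 < q s) by exact HE. assert (Eq : q s = EE (rs s)) by exact Ess.
    change (is_derive (fun z => z * sqrt (q z)) s (2 * m (rs s) * Derive m (rs s) / SS s)).
    clearbody q.
    pose proof (is_derive_unique _ _ _ Dq) as Uq.
    auto_derive.
    + repeat split; auto. eexists; exact Dq.
    + change (Derive (fun x => q x) s) with (Derive q s). rewrite Uq, Eq. fold (SS s).
      rewrite <- SS_sq. pose proof (SS_pos s). field. split; lra.
Qed.

Lemma ys_pos s : 0 <= s -> 0 <= ys s.
Proof. intros. apply Rmult_le_pos; auto. apply Rlt_le, SS_pos. Qed.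

Lemma ys_sqrt s : 0 <= s -> sqrt (m (rs s) ^ 2 - m rho ^ 2) = ys s.
Proof. intros Hs. rewrite <- ys_sq. apply sqrt_pow2. now apply ys_pos. Qed.

Lemma ys_lt s : ys s < m (rs s).
Proof.
  pose proof (ys_sq s). pose proof (m_rs_pos s). pose proof cc_pos. unfold cc in H1. nra.
Qed.

Lemma wdef_ys s : 0 <= s -> 1 - wdef m (m rho) (rs s) = ys s / m (rs s).
Proof.
  intros Hs. pose proof (m_rs_pos s). unfold wdef.
  replace (1 - (1 - sqrt (1 - (m rho / m (rs s)) ^ 2))) with (sqrt (1 - (m rho / m (rs s)) ^ 2)) by ring.
  replace (1 - (m rho / m (rs s)) ^ 2) with ((ys s / m (rs s)) ^ 2).
  - apply sqrt_pow2. apply Rdiv_le_0_compat; auto. now apply ys_pos.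
  - unfold Rdiv. rewrite Rpow_mult_distr, ys_sq. field. lra.
Qed.

Lemma rs_derive s : is_derive rs s (2 * s).
Proof. unfold rs. auto_derive; auto; ring. Qed.

Lemma rs_0 : rs 0 = rho.
Proof. unfold rs. ring. Qed.

Lemma th_hdef a b : 0 < a <= b -> th b - th a = RInt (hdef m (m rho)) (rs a) (rs b).
Proof.
  intros [Ha Hab]. rewrite <- (RInt_deriv th thd a b); auto;
    [|intros; apply th_derive|intros; apply thd_cont].
  assert (Hrs : forall t, 0 < t -> rho < rs t) by (intros; unfold rs; nra).
  rewrite <- (RInt_comp_R (hdef m (m rho)) rs (fun t => 2 * t)); auto.
  - apply RInt_ext_le; auto. intros t Ht. unfold hdef. rewrite ys_sqrt by lra. unfold thd, ys.
    pose proof (m_rs_pos t). pose proof (SS_pos t). field. repeat split; lra.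
  - intros t Ht. pose proof (Hrs t ltac:(lra)). pose proof cc_pos. unfold cc in H0.
    apply hdef_cont; auto; [|lra]. split; [lra|]. apply Hgt; auto.
  - intros; apply rs_derive.
  - intros; cont.
Qed.

(** The equality case of the calibration: along the geodesic, the length is the integral of the
    calibrating form. *)
Lemma al_th s : 0 <= s -> al s = m rho * th s + (rs s - rho - RInt (wdef m (m rho)) rho (rs s)).
Proof.
  intros Hs. unfold al, th.
  assert (Hcw : forall t, continuous (fun t => wdef m (m rho) (rs t)) t).
  { intros t. apply (cont_comp rs); [apply rs_cont|]. apply wdef_cont; auto. pose proof (rs_ge t). lra. }
  assert (E1 : RInt (fun t => 2 * t * wdef m (m rho) (rs t)) 0 s = RInt (wdef m (m rho)) rho (rs s)).
  { rewrite <- rs_0 at 2. rewrite <- (RInt_comp_R (wdef m (m rho)) rs (fun t => 2 * t) 0 s); auto.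
    - intros; apply wdef_cont; auto. pose proof (rs_ge t). lra.
    - intros; apply rs_derive.
    - intros; cont. }
  assert (E2 : RInt (fun t => 2 * t) 0 s = rs s - rho).
  { rewrite (RInt_deriv rs (fun t => 2 * t) 0 s); auto; [now rewrite rs_0|intros; apply rs_derive|intros; cont]. }
  rewrite <- E1, <- E2.
  assert (C2 : forall t, continuous (fun t => 2 * t) t) by (intros; cont).
  assert (C3 : forall t, continuous (fun t => 2 * t * wdef m (m rho) (rs t)) t).
  { intros t. apply (cont_mult (fun t => 2 * t)); auto. }
  rewrite <- RInt_minus_cont by auto.
  rewrite <- RInt_scal_cont by (auto; intros; apply thd_cont).
  rewrite <- RInt_plus_cont; auto.
  - apply RInt_ext_le; auto. intros t Ht.
    replace (2 * t - 2 * t * wdef m (m rho) (rs t)) with (2 * t * (1 - wdef m (m rho) (rs t))) by ring.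
    rewrite wdef_ys by lra. pose proof (m_rs_pos t). pose proof (SS_pos t). pose proof (ys_sq t) as E.
    unfold sd, thd.
    apply (Rmult_eq_reg_r (m (rs t) * SS t)); [|apply Rgt_not_eq, Rmult_lt_0_compat; auto].
    transitivity (2 * m (rs t) ^ 2); [field; lra|].
    transitivity (2 * m rho ^ 2 + 2 * (ys t) * (t * SS t)); [|field; lra].
    change (t * SS t) with (ys t). replace (2 * ys t * ys t) with (2 * ys t ^ 2) by ring. rewrite E. ring.
  - intros. apply (cont_mult (fun _ => m rho)); [apply continuous_const|apply thd_cont].
  - intros. apply (cont_minus (fun t => 2 * t)); auto.
Qed.

(** The angle from the turning point to infinity. It is split at parameter 1 because [hdef] is
    singular at [rho], where [tail] cannot start; by [Thi_eq] the place of the split is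
    immaterial. *)
Definition Thi : R := th 1 + tail (hdef m (m rho)) (rs 1).

Lemma has_tail_h x : rho < x -> has_tail (hdef m (m rho)) x.
Proof.
  intros Hx. pose proof cc_pos. unfold cc in H. apply has_tail_hdef; auto; try lra.
  intros; apply Hgt; lra.
Qed.

Lemma rs_gt s : 0 < s -> rho < rs s.
Proof. intros Hs. unfold rs. assert (0 < s * s) by (apply Rmult_lt_0_compat; lra). simpl; lra. Qed.

Lemma rs_le a b : 0 <= a <= b -> rs a <= rs b.
Proof. intros. unfold rs. nra. Qed.

Lemma Thi_eq a : 0 < a -> Thi = th a + tail (hdef m (m rho)) (rs a).
Proof.
  intros Ha. unfold Thi. destruct (Rle_dec a 1) as [H|H].
  - rewrite (tail_Chasles _ (rs a) (rs 1)); [|apply has_tail_h, rs_gt; auto|apply rs_le; lra].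
    rewrite <- th_hdef by lra. ring.
  - rewrite (tail_Chasles _ (rs 1) (rs a)); [|apply has_tail_h, rs_gt; lra|apply rs_le; lra].
    rewrite <- th_hdef by lra. ring.
Qed.

Lemma th_le_Thi a : th a <= Thi.
Proof.
  pose proof (Rmax_l a 1). pose proof (Rmax_r a 1).
  eapply Rle_trans; [apply (th_mono a (Rmax a 1)); auto|].
  rewrite (Thi_eq (Rmax a 1)) by lra.
  pose proof (tail_ge0 _ _ (has_tail_h (rs (Rmax a 1)) (rs_gt (Rmax a 1) ltac:(lra)))). lra.
Qed.

Lemma th_lim e : 0 < e -> exists A, 0 < A /\ forall a, A <= a -> Thi - e < th a.
Proof.
  intros He. destruct (tail_small _ (rs 1) e (has_tail_h (rs 1) (rs_gt 1 ltac:(lra))) He) as [Y [H1 H2]].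
  exists (Rmax 1 (Y + 1)). split; [pose proof (Rmax_l 1 (Y + 1)); lra|].
  intros a Ha. pose proof (Rmax_l 1 (Y + 1)). pose proof (Rmax_r 1 (Y + 1)).
  rewrite (Thi_eq a) by lra. specialize (H2 (rs a)).
  assert (Y <= rs a) by (unfold rs; nra). specialize (H2 H3). lra.
Qed.

Lemma al_ge s : 0 <= s -> s ^ 2 <= al s.
Proof.
  intros Hs. replace (s ^ 2) with (RInt (fun t => 2 * t) 0 s).
  - apply RInt_le_cont; auto; [intros; cont|intros; apply sd_cont|].
    intros t Ht. unfold sd. pose proof (SS_pos t). apply le_div; auto.
    pose proof (ys_lt t). unfold ys in H0. lra.
  - rewrite (RInt_deriv rs (fun t => 2 * t) 0 s); auto; [unfold rs; ringR|intros; apply rs_derive|intros; cont].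
Qed.

Lemma al_onto t : { s : R | al s = t }.
Proof.
  pose proof (Rabs_pos t) as Hp. set (b := Rabs t + 1).
  pose proof (al_ge b ltac:(unfold b; lra)) as H1. pose proof (al_odd b ltac:(unfold b; lra)) as H2.
  assert (Hb : Rabs t <= b ^ 2) by (unfold b; nra).
  pose proof (Rle_abs t). pose proof (Rle_abs (- t)). rewrite Rabs_Ropp in H0.
  destruct (IVT_gen al (- b) b t) as [x [_ Hx]].
  - intros z. apply continuity_pt_filterlim. eapply deriv_cont, al_derive.
  - rewrite Rmin_left, Rmax_right by lra. lra.
  - exists x; auto.
Qed.

Definition sinv (t : R) : R := proj1_sig (al_onto t).

Lemma al_sinv t : al (sinv t) = t.
Proof. unfold sinv. now destruct (al_onto t). Qed.

Lemma al_inj a b : al a = al b -> a = b.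
Proof.
  intros E. destruct (Rtotal_order a b) as [H|[H|H]]; auto; apply al_incr in H; lra.
Qed.

Lemma sinv_mono a b : a <= b -> sinv a <= sinv b.
Proof.
  intros H. apply Rnot_lt_le. intros Hl. apply al_incr in Hl. rewrite !al_sinv in Hl. lra.
Qed.

Lemma sinv_derive t : is_derive sinv t (SS (sinv t) / (2 * m (rs (sinv t)))).
Proof.
  replace (SS (sinv t) / (2 * m (rs (sinv t)))) with (/ sd (sinv t)).
  - apply (inverse_derive al sd); [apply al_derive|apply sd_pos|apply al_sinv].
  - unfold sd. pose proof (m_rs_pos (sinv t)). pose proof (SS_pos (sinv t)). field. lra.
Qed.

(** Total angle swept by the geodesic which comes in from radius [R0], turns at [rho] and escapes. *)
Definition turn (R0 : R) : R := th (sqrt (R0 - rho)) + Thi.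

Lemma dr_rs_curve p a b : a <= b ->
  dr m (polar (rs a) (p + th a)) (polar (rs b) (p + th b)) <= al b - al a.
Proof.
  intros Hab. eapply Rle_trans; [apply (dr_polar_curve m Hm rs (fun s => p + th s) (fun s => 2 * s) thd)|].
  - apply rs_derive.
  - intros t. rewrite <- (Rplus_0_l (thd t)). apply (is_derive_plus (fun _ => p)); [apply (is_derive_const p)|apply th_derive].
  - intros; cont.
  - apply thd_cont.
  - auto.
  - intros. pose proof (rs_ge t). lra.
  - rewrite <- (RInt_deriv al sd a b); auto; [|intros; apply al_derive|intros; apply sd_cont].
    apply Req_le, RInt_ext_le; auto. intros t _.
    transitivity (sqrt (sd t ^ 2)); [f_equal|apply sqrt_pow2, Rlt_le, sd_pos].
    pose proof (m_rs_pos t). pose proof (SS_pos t). pose proof (ys_sq t) as E. unfold ys in E.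
    unfold thd, sd.
    apply (Rmult_eq_reg_r (SS t ^ 2)); [|apply Rgt_not_eq, pow_lt; auto].
    transitivity (4 * ((t * SS t) ^ 2 + m rho ^ 2)); [field; lra|]. rewrite E. field. lra.
Qed.

(** An interface that hides the parameter [s]: time is arclength, time 0 is the incoming passage
    through radius [R0], and [y] is [m] times the radial speed. The second limit in [geo_lim] says
    that the gain of the geodesic is [Phi] at its own turn, Clairaut constant and turning radius. *)
Record geodesic (R0 : R) (r y Th : R -> R) : Prop := {
  geo_r0 : r 0 = R0;
  geo_y0 : y 0 = - sqrt (m R0 ^ 2 - m rho ^ 2);
  geo_Th0 : Th 0 = 0;
  geo_ge : forall t, rho <= r t;
  geo_r : forall t, is_derive r t (y t / m (r t));
  geo_y : forall t, is_derive y t (Derive m (r t));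
  geo_Th : forall t, is_derive Th t (m rho / m (r t) ^ 2);
  geo_sq : forall t, y t ^ 2 = m (r t) ^ 2 - m rho ^ 2;
  geo_Th_range : forall t, 0 <= t -> 0 <= Th t <= turn R0;
  geo_lim : forall e, 0 < e -> exists T0, 0 < T0 /\ forall t, T0 <= t ->
     Rabs (Th t - turn R0) < e /\ Rabs (t - r t - Phi m (turn R0) R0 (m rho) rho) < e;
  geo_dr : forall p s t, s <= t ->
     dr m (polar (r s) (p + Th s)) (polar (r t) (p + Th t)) <= t - s }.

Lemma geodesic_exists R0 : rho < R0 -> exists r y Th, geodesic R0 r y Th.
Proof.
  intros HR. set (a0 := sqrt (R0 - rho)).
  assert (Ha0 : 0 < a0) by (apply sqrt_lt_R0; lra).
  assert (Ers : rs a0 = R0) by (unfold rs, a0; rewrite <- Rsqr_pow2, Rsqr_sqrt by lra; ring).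
  (* Time is shifted by [t0] so that time 0 corresponds to the parameter [- a0] on the incoming
     branch. *)
  set (t0 := al a0). set (sg := fun t => sinv (t - t0)).
  assert (Esg : sg 0 = - a0).
  { apply al_inj. unfold sg. rewrite al_sinv, al_odd by lra. unfold t0. ring. }
  assert (Dsg : forall t, is_derive sg t (SS (sg t) / (2 * m (rs (sg t))))).
  { intros t. unfold sg. rewrite <- (Rmult_1_l (_ / _)).
    apply (is_derive_comp sinv (fun t => t - t0)); [apply sinv_derive|]. auto_derive; auto; ring. }
  assert (Asg : forall t, al (sg t) = t - t0) by (intros; apply al_sinv).
  assert (Msg : forall s t, s <= t -> sg s <= sg t) by (intros; apply sinv_mono; lra).
  exists (fun t => rs (sg t)), (fun t => ys (sg t)), (fun t => th (sg t) + th a0).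
  split.
  - rewrite Esg, rs_even. exact Ers.
  - rewrite Esg. unfold ys. rewrite <- Ers, ys_sqrt by lra. unfold ys.
    unfold SS. rewrite rs_even. ring.
  - rewrite Esg, th_odd by lra. ring.
  - intros; apply rs_ge.
  - intros t. pose proof (m_rs_pos (sg t)). pose proof (SS_pos (sg t)).
    replace (ys (sg t) / m (rs (sg t))) with (SS (sg t) / (2 * m (rs (sg t))) * (2 * sg t))
      by (unfold ys; field; lra).
    apply (is_derive_comp rs sg); [apply rs_derive|apply Dsg].
  - intros t. pose proof (m_rs_pos (sg t)). pose proof (SS_pos (sg t)).
    replace (Derive m (rs (sg t))) with
      (SS (sg t) / (2 * m (rs (sg t))) * (2 * m (rs (sg t)) * Derive m (rs (sg t)) / SS (sg t)))
      by (field; lra).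
    apply (is_derive_comp ys sg); [apply ys_derive|apply Dsg].
  - intros t. pose proof (m_rs_pos (sg t)). pose proof (SS_pos (sg t)).
    replace (m rho / m (rs (sg t)) ^ 2) with
      (SS (sg t) / (2 * m (rs (sg t))) * thd (sg t) + 0) by (unfold thd; field; lra).
    apply (is_derive_plus (fun t => th (sg t)) (fun _ => th a0)); [|apply (is_derive_const (th a0))].
    apply (is_derive_comp th sg); [apply th_derive|apply Dsg].
  - intros; apply ys_sq.
  - intros t Ht. pose proof (Msg 0 t Ht) as H. rewrite Esg in H.
    pose proof (th_mono _ _ H). rewrite th_odd in H0 by lra.
    pose proof (th_le_Thi (sg t)). unfold turn. fold a0. lra.
  - intros e He.
    set (c := m rho). assert (Hc : 0 < c) by apply cc_pos.
    set (e1 := Rmin e (e / (2 * c))).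
    assert (He1 : 0 < e1) by (apply Rmin_glb_lt; auto; apply Rdiv_lt_0_compat; lra).
    destruct (th_lim e1 He1) as [A [HA1 HA2]].
    assert (HTW := has_tail_wdef m Hm HJ c rho Hrho).
    destruct (tail_small _ rho (e / 2) HTW ltac:(lra)) as [Y [HY1 HY2]].
    set (B := Rmax A (Y + 1)). pose proof (Rmax_l A (Y + 1)). pose proof (Rmax_r A (Y + 1)). fold B in H, H0.
    exists (Rmax 1 (al B + t0)). split; [pose proof (Rmax_l 1 (al B + t0)); lra|].
    intros t Ht. pose proof (Rmax_r 1 (al B + t0)).
    assert (HB : B <= sg t).
    { apply Rnot_lt_le. intros Hl. apply al_incr in Hl. rewrite Asg in Hl. lra. }
    specialize (HA2 (sg t) ltac:(lra)). pose proof (th_le_Thi (sg t)) as HT2.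
    assert (Ed : th (sg t) + th a0 - turn R0 = th (sg t) - Thi) by (unfold turn; fold a0; ring).
    assert (L1 : e1 <= e) by apply Rmin_l.
    assert (L2 : c * e1 <= e / 2).
    { apply Rle_trans with (c * (e / (2 * c))); [apply Rmult_le_compat_l; [lra|apply Rmin_r]|].
      apply Req_le. field. lra. }
    split; [rewrite Ed; apply Rabs_def1; lra|].
    pose proof (al_th (sg t) ltac:(lra)) as E1. rewrite Asg in E1. fold c in E1.
    pose proof (al_th a0 ltac:(lra)) as E2. fold t0 c in E2. rewrite Ers in E2.
    pose proof (W_Chasles m Hm HJ c rho R0 ltac:(lra)) as E3.
    pose proof (W_Chasles m Hm HJ c rho (rs (sg t)) (conj Hrho (rs_ge _))) as E4.
    assert (HW : 0 <= W m c (rs (sg t)) < e / 2).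
    { split; [apply W_ge0; auto; pose proof (rs_ge (sg t)); lra|]. apply HY2. unfold rs. nra. }
    replace (t - rs (sg t) - Phi m (turn R0) R0 c rho) with
      (c * (th (sg t) - Thi) + W m c (rs (sg t))).
    + assert (c * (th (sg t) - Thi) <= 0) by nra.
      assert (- (e / 2) < c * (th (sg t) - Thi)) by nra.
      apply Rabs_def1; lra.
    + unfold Phi, turn. fold a0.  lra.
  - intros p s t Hst. specialize (Msg s t Hst).
    pose proof (dr_rs_curve (p + th a0) _ _ Msg) as H. rewrite !Asg in H.
    replace (p + (th (sg s) + th a0)) with (p + th a0 + th (sg s)) by ring.
    replace (p + (th (sg t) + th a0)) with (p + th a0 + th (sg t)) by ring. lra.
Qed.

End Geo.

(** * Minimizers of the lower bound *)

Section Steps.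
Context (m : R -> R) (Hm : profile m) (HJ : fin_invsq m) (Hinf : unbounded m).

Lemma profile_mono a b : a <= b -> (forall t, a <= t <= b -> 0 <= Derive m t) -> m a <= m b.
Proof.
  intros. apply (mono_of_deriv m (Derive m)); auto. intros; now apply profile_derive.
Qed.

(** A geodesic asymptotic to a parallel which is a critical point of [m] has infinite turn. *)
Lemma hdef_diverges x0 K : 0 < x0 -> Derive m x0 = 0 -> exists eta d, 0 < eta < 1 /\ 0 < d /\
  forall c, 0 < c -> m x0 - d <= c <= m x0 ->
   (forall t, x0 + eta <= t <= x0 + 1 -> c < m t) -> K < RInt (hdef m c) (x0 + eta) (x0 + 1).
Proof.
  intros Hx0 Hd0. set (c0 := m x0). assert (Hc0 : 0 < c0) by (apply profile_pos; auto).
  (* [a2] is the second derivative of m^2. Bounding it by [B] puts m^2 below a parabola with vertex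
     at [x0], which makes the integrand at least [kap / (t - x0)]. *)
  set (a2 := fun t => 2 * Derive m t ^ 2 + 2 * m t * Derive_n m 2 t).
  assert (Ha2 : forall t, continuous a2 t).
  { intros t. pose proof (profile_cont m Hm t). pose proof (profile_cont1 m Hm t).
    pose proof (profile_cont2 m Hm t). unfold a2. cont. }
  destruct (max_attained a2 x0 (x0 + 1) ltac:(lra) ltac:(auto)) as [tm [_ Htm]].
  set (B := Rabs (a2 tm) + 1).
  assert (HB : 0 < B /\ forall t, x0 <= t <= x0 + 1 -> a2 t <= B).
  { unfold B. pose proof (Rabs_pos (a2 tm)). split; [lra|]. intros t Ht. specialize (Htm t Ht).
    pose proof (Rle_abs (a2 tm)). lra. }
  destruct HB as [HB HB2].
  assert (Hda : forall t, is_derive (fun t => 2 * m t * Derive m t) t (a2 t)).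
  { intros t. pose proof (profile_derive m Hm t) as D1. pose proof (profile_derive2 m Hm t) as D2.
    set (m1 := Derive m) in *.
    auto_derive; [repeat split; eexists; eassumption|].
    change (Derive (fun x => m1 x) t) with (Derive m1 t). change (Derive (fun x => m x) t) with (m1 t).
    replace (Derive m1 t) with (Derive_n m 2 t) by (symmetry; apply is_derive_unique, D2).
    unfold a2. ring. }
  assert (Hmm : forall t, x0 <= t <= x0 + 1 -> m t ^ 2 <= c0 ^ 2 + B * (t - x0) ^ 2).
  { assert (H1 : forall t, x0 <= t <= x0 + 1 -> 2 * m t * Derive m t <= B * (t - x0)).
    { intros t Ht.
      assert (B * (x0 - x0) - 2 * m x0 * Derive m x0 <= B * (t - x0) - 2 * m t * Derive m t).
      { apply (mono_of_deriv (fun t => B * (t - x0) - 2 * m t * Derive m t) (fun t => B - a2 t)); [lra| |].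
        - intros z _. apply (is_derive_minus (fun t => B * (t - x0)) _ z B (a2 z)); [|apply Hda].
          auto_derive; auto; ring.
        - intros z Hz. specialize (HB2 z ltac:(lra)). lra. }
      rewrite Hd0 in H. lra. }
    intros t Ht.
    assert (B * (x0 - x0) ^ 2 - m x0 ^ 2 <= B * (t - x0) ^ 2 - m t ^ 2); [|unfold c0; lra].
    apply (mono_of_deriv (fun t => B * (t - x0) ^ 2 - m t ^ 2)
       (fun t => 2 * B * (t - x0) - 2 * m t * Derive m t)); [lra| |].
    - intros z _. pose proof (profile_derive m Hm z).
      auto_derive; [repeat split; eexists; eassumption|].
      change (Derive (fun x => m x) z) with (Derive m z). ring.
    - intros z Hz. specialize (H1 z ltac:(lra)). assert (0 <= B * (z - x0)) by (apply Rmult_le_pos; lra). lra. }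
  destruct (max_attained m x0 (x0 + 1) ltac:(lra) ltac:(intros; now apply profile_cont)) as [tM [HtM1 HtM]].
  set (M := m tM) in *. assert (HM : 0 < M) by (apply profile_pos; auto; lra).
  assert (Hs2B : 0 < sqrt (2 * B)) by (apply sqrt_lt_R0; lra).
  set (kap := c0 / (2 * M * sqrt (2 * B))).
  assert (Hk : 0 < kap).
  { apply Rdiv_lt_0_compat; auto. apply Rmult_lt_0_compat; lra. }
  (* With this [eta] the integral of [kap / (t - x0)] is |K| + 1. *)
  set (eta := exp (- (Rabs K + 1) / kap)).
  assert (Heta0 : 0 < eta) by apply exp_pos.
  assert (Heta1 : eta < 1).
  { unfold eta. apply Rlt_le_trans with (exp 0); [apply exp_increasing|rewrite exp_0; lra]. unfold Rdiv. pose proof (Rabs_pos K).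
    assert (0 < / kap) by (now apply Rinv_0_lt_compat).
    assert (0 < (Rabs K + 1) * / kap) by (apply Rmult_lt_0_compat; lra). lra. }
  (* [d] makes c0^2 - c^2 at most B eta^2, so that passing from [c0] to [c] at most doubles the
     parabola beyond [x0 + eta]. *)
  set (d := Rmin (c0 / 2) (B * eta ^ 2 / (2 * c0))).
  assert (He2 : 0 < B * eta ^ 2) by (apply Rmult_lt_0_compat; auto; apply pow_lt; auto).
  assert (Hd : 0 < d) by (apply Rmin_glb_lt; [lra|apply Rdiv_lt_0_compat; lra]).
  exists eta, d. split; [lra|]. split; auto. intros c Hc Hcd Hct.
  assert (D1 : d <= c0 / 2) by apply Rmin_l.
  assert (D2 : d <= B * eta ^ 2 / (2 * c0)) by apply Rmin_r.
  assert (D3 : 2 * c0 * d <= B * eta ^ 2).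
  { apply (Rmult_le_compat_l (2 * c0)) in D2; [|lra].
    replace (2 * c0 * (B * eta ^ 2 / (2 * c0))) with (B * eta ^ 2) in D2 by (field; lra). exact D2. }
  assert (Hcc : c0 ^ 2 - c ^ 2 <= B * eta ^ 2).
  { assert ((c0 - c) * (c0 + c) <= d * (2 * c0)) by (apply Rmult_le_compat; unfold c0 in *; lra).
    replace (c0 ^ 2 - c ^ 2) with ((c0 - c) * (c0 + c)) by ring. lra. }
  apply Rlt_le_trans with (RInt (fun t => kap / (t - x0)) (x0 + eta) (x0 + 1)).
  - rewrite (RInt_deriv (fun t => kap * ln (t - x0)) (fun t => kap / (t - x0))); [|lra| |].
    + replace (x0 + 1 - x0) with 1 by ring. replace (x0 + eta - x0) with eta by ring.
      rewrite ln_1. unfold eta. rewrite ln_exp.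
      replace (kap * 0 - kap * (- (Rabs K + 1) / kap)) with (Rabs K + 1) by (field; lra).
      pose proof (Rle_abs K). lra.
    + intros t Ht. auto_derive; [lra|]. field. lra.
    + intros t Ht. cont. lra.
  - apply RInt_le_cont; [lra|intros; cont; lra| |].
    + intros t Ht. apply hdef_cont; auto; [split; [lra|auto]|lra].
    + intros t Ht. specialize (Hct t Ht). specialize (HtM t ltac:(lra)).
      specialize (Hmm t ltac:(lra)).
      assert (Hs : sqrt (m t ^ 2 - c ^ 2) <= sqrt (2 * B) * (t - x0)).
      { rewrite <- (sqrt_pow2 (t - x0)) by lra. rewrite <- sqrt_mult_alt by lra.
        apply sqrt_le_1_alt.
        assert (eta ^ 2 <= (t - x0) ^ 2) by (apply pow_incr; lra). nra. }
      assert (Hs0 : 0 < sqrt (m t ^ 2 - c ^ 2)) by (apply sqrt_lt_R0; nra).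
      unfold hdef, kap.
      apply le_div; [apply Rmult_lt_0_compat; lra|].
      apply Rle_trans with (c0 / (2 * M * sqrt (2 * B)) / (t - x0) * (M * (sqrt (2 * B) * (t - x0)))).
      * apply Rmult_le_compat_l.
        { apply Rdiv_le_0_compat; [|lra]. apply Rlt_le, Hk. }
        apply Rmult_le_compat; lra.
      * replace (c0 / (2 * M * sqrt (2 * B)) / (t - x0) * (M * (sqrt (2 * B) * (t - x0)))) with (c0 / 2)
          by (field; lra). lra.
Qed.

Lemma W_subgrad_up c c' x : 0 < x -> 0 <= c <= c' -> (forall t, x <= t -> c < m t /\ c' <= m t) ->
  W m c x + (c' - c) * tail (hdef m c) x <= W m c' x.
Proof.
  intros Hx Hc Ht.
  pose proof (has_tail_wdef m Hm HJ c x Hx) as T1. pose proof (has_tail_wdef m Hm HJ c' x Hx) as T2.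
  pose proof (has_tail_hdef m Hm HJ Hinf c x ltac:(lra) Hx ltac:(intros; now apply Ht)) as T3.
  destruct (has_tail_lin _ _ (c' - c) x T1 T3 ltac:(lra)) as [T4 E].
  unfold W. rewrite <- E. apply tail_mono; auto.
  intros t Htx. destruct (Ht t Htx). pose proof (wdef_subgrad m c c' t ltac:(lra) ltac:(lra)). lra.
Qed.

Lemma W_subgrad_down c c' x : 0 < x -> 0 <= c' <= c -> (forall t, x <= t -> c < m t) ->
  W m c x <= W m c' x + (c - c') * tail (hdef m c) x.
Proof.
  intros Hx Hc Ht.
  pose proof (has_tail_wdef m Hm HJ c x Hx) as T1. pose proof (has_tail_wdef m Hm HJ c' x Hx) as T2.
  pose proof (has_tail_hdef m Hm HJ Hinf c x ltac:(lra) Hx Ht) as T3.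
  destruct (has_tail_lin _ _ (c - c') x T2 T3 ltac:(lra)) as [T4 E].
  unfold W. rewrite <- E. apply tail_mono; auto.
  intros t Htx. specialize (Ht t Htx).
  pose proof (wdef_subgrad m c c' t ltac:(lra) ltac:(lra)). lra.
Qed.

Lemma wdef_int_subgrad_up c c' x y : 0 < x <= y -> 0 <= c <= c' ->
  (forall t, x <= t <= y -> c < m t /\ c' <= m t) ->
  (c' - c) * RInt (hdef m c) x y <= RInt (wdef m c') x y - RInt (wdef m c) x y.
Proof.
  intros [Hx Hxy] Hc Ht.
  assert (Ch : forall t, x <= t <= y -> continuous (hdef m c) t).
  { intros t Htt. apply hdef_cont; auto; [|lra]. destruct (Ht t Htt); lra. }
  assert (Cw : forall k t, x <= t <= y -> continuous (wdef m k) t) by (intros; apply wdef_cont; auto; lra).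
  rewrite <- RInt_minus_cont, <- RInt_scal_cont by auto.
  apply RInt_le_cont; auto.
  - intros. apply (cont_mult (fun _ => c' - c)); [apply continuous_const|auto].
  - intros. apply cont_minus; auto.
  - intros t Htt. destruct (Ht t Htt). apply wdef_subgrad; lra.
Qed.

Lemma wdef_int_subgrad_down c c' x y : 0 < x <= y -> 0 <= c' <= c ->
  (forall t, x <= t <= y -> c < m t) ->
  RInt (wdef m c) x y - RInt (wdef m c') x y <= (c - c') * RInt (hdef m c) x y.
Proof.
  intros [Hx Hxy] Hc Ht.
  assert (Ch : forall t, x <= t <= y -> continuous (hdef m c) t).
  { intros t Htt. apply hdef_cont; auto; [|lra]. specialize (Ht t Htt); lra. }
  assert (Cw : forall k t, x <= t <= y -> continuous (wdef m k) t) by (intros; apply wdef_cont; auto; lra).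
  rewrite <- RInt_minus_cont, <- RInt_scal_cont by auto.
  apply RInt_le_cont; auto.
  - intros. apply cont_minus; auto.
  - intros. apply (cont_mult (fun _ => c - c')); [apply continuous_const|auto].
  - intros t Htt. specialize (Ht t Htt). pose proof (wdef_subgrad m c c' t ltac:(lra) ltac:(lra)). lra.
Qed.

(** On [[rho, x]] the deficit is at most the length of the interval, so discarding this interval
    does not raise the value; beyond [x] the tangent line inequality applies. The factor of [c' - c]
    is [phi] minus the angle that the constant [c] sweeps outside radius [x]. *)
Lemma right_step phi R0 rho x c c' : 0 < rho < x -> x <= R0 -> 0 <= c <= c' ->
  (forall t, x <= t -> c < m t /\ c' <= m t) ->
  Phi m phi R0 c' x - Phi m phi R0 c rho <=
   (c' - c) * (phi - (2 * RInt (hdef m c) x R0 + tail (hdef m c) R0)).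
Proof.
  intros Hx HxR Hc Ht.
  pose proof (wdef_int_subgrad_up c c' x R0 ltac:(lra) Hc ltac:(intros; apply Ht; lra)) as I1.
  pose proof (W_subgrad_up c c' R0 ltac:(lra) Hc ltac:(intros; apply Ht; lra)) as I2.
  pose proof (W_Chasles m Hm HJ c rho x ltac:(lra)) as E1.
  pose proof (W_Chasles m Hm HJ c x R0 ltac:(lra)) as E2.
  pose proof (W_Chasles m Hm HJ c' x R0 ltac:(lra)) as E3.
  pose proof (wdef_RInt_range m Hm c rho x ltac:(lra)) as E4.
  unfold Phi. nra.
Qed.

(** Takes the supremum of the points where the infimum is attained. Beyond it [m] is strictly
    larger, as a turning geodesic requires. *)
Lemma last_point x0 : 0 < x0 -> exists rho, x0 <= rho /\ m rho = cstar m x0 /\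
  forall t, rho < t -> cstar m x0 < m t.
Proof.
  intros Hx0. set (c := cstar m x0).
  destruct (cstar_attained m Hm Hinf x0 ltac:(lra)) as [HA [t0 [Ht0 Et0]]]. fold c in HA, Et0.
  destruct (Hinf (c + 1)) as [A [HA1 HA2]].
  destruct (completeness (fun t => x0 <= t /\ m t = c)) as [rho [H1 H2]].
  - exists A. intros t [Ht E]. apply Rnot_lt_le. intros Hl. specialize (HA2 t ltac:(lra)). lra.
  - exists t0. auto.
  - assert (Hge : x0 <= rho) by (eapply Rle_trans; [exact Ht0|apply H1; auto]).
    assert (E : m rho = c).
    { apply NNPP. intros n. assert (Hgt : c < m rho) by (specialize (HA rho Hge); lra).
      destruct (proj1 (cont_eps m rho) (profile_cont m Hm rho) (m rho - c) ltac:(lra)) as [d [D1 D2]].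
      assert (Hub : is_upper_bound (fun t => x0 <= t /\ m t = c) (rho - d / 2)).
      { intros t [Ht Et]. apply Rnot_lt_le. intros Hl.
        assert (t <= rho) by (apply H1; auto).
        specialize (D2 t ltac:(apply Rabs_def1; lra)). apply Rabs_def2 in D2. lra. }
      specialize (H2 _ Hub). lra. }
    exists rho. split; auto. split; auto. intros t Ht.
    specialize (HA t ltac:(lra)). destruct (Rle_lt_or_eq_dec _ _ HA) as [H|H]; auto.
    assert (t <= rho) by (apply H1; split; auto; lra). lra.
Qed.

Lemma Derive_ge0_of_gt rho : (forall t, rho < t -> m rho < m t) -> 0 <= Derive m rho.
Proof.
  intros H. apply Rnot_lt_le. intros Hl.
  pose proof (proj1 (is_derive_Reals _ _ _) (profile_derive m Hm rho)) as D.
  destruct (D (- Derive m rho) ltac:(lra)) as [d Dd].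
  pose proof (cond_pos d). specialize (Dd (d / 2) ltac:(lra)).
  rewrite Rabs_pos_eq in Dd by lra. specialize (Dd ltac:(lra)).
  specialize (H (rho + d / 2) ltac:(lra)). apply Rabs_def2 in Dd.
  assert (0 < (m (rho + d / 2) - m rho) / (d / 2)) by (apply Rdiv_lt_0_compat; lra). lra.
Qed.

Section AtRho.
Context (rho : R) (Hrho : 0 < rho) (Hm1 : 0 < Derive m rho) (Hgt : forall x, rho < x -> m rho < m x).

Lemma rs_sqrt x : rho <= x -> rs rho (sqrt (x - rho)) = x.
Proof. intros. unfold rs. rewrite <- Rsqr_pow2, Rsqr_sqrt by lra. ring. Qed.

Lemma tail_h_Thi x : rho < x -> tail (hdef m (m rho)) x = Thi m rho - th m rho (sqrt (x - rho)).
Proof.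
  intros Hx. rewrite (Thi_eq m Hm HJ Hinf rho Hrho Hm1 Hgt (sqrt (x - rho))) by (apply sqrt_lt_R0; lra).
  rewrite rs_sqrt by lra. ring.
Qed.

Lemma RInt_h_th x y : rho < x <= y ->
  RInt (hdef m (m rho)) x y = th m rho (sqrt (y - rho)) - th m rho (sqrt (x - rho)).
Proof.
  intros Hx. rewrite (th_hdef m Hm rho Hrho Hm1 Hgt).
  - rewrite !rs_sqrt by lra. reflexivity.
  - split; [apply sqrt_lt_R0; lra|apply sqrt_le_1_alt; lra].
Qed.

Lemma th_small e : 0 < e -> exists d, 0 < d /\ forall x, rho < x < rho + d ->
  0 <= th m rho (sqrt (x - rho)) < e.
Proof.
  intros He.
  assert (Hc : continuous (th m rho) 0) by (eapply deriv_cont, th_derive; eauto).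
  destruct (proj1 (cont_eps _ _) Hc e He) as [d [D1 D2]].
  exists (d ^ 2). split; [apply pow_lt; auto|]. intros x Hx.
  pose proof (sqrt_pos (x - rho)) as Hs.
  assert (Hsd : sqrt (x - rho) < d).
  { rewrite <- (sqrt_pow2 d) by lra. apply sqrt_lt_1_alt. lra. }
  specialize (D2 (sqrt (x - rho))). rewrite th_0, !Rminus_0_r in D2.
  rewrite (Rabs_pos_eq (sqrt _)) in D2 by auto. specialize (D2 Hsd).
  pose proof (th_mono m Hm rho Hrho Hm1 Hgt 0 _ Hs) as Hmo. rewrite th_0 in Hmo.
  rewrite Rabs_pos_eq in D2 by auto. lra.
Qed.

(** To first order in [m rho - m x], the bound changes at a rate of turn minus [phi]. The newly
    added interval [[x, rho]] contributes only at order 3/2, since the radial speed there is of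
    order [sqrt (rho - x)]. As [m rho - m x] is bounded below by [k (rho - x)], the first-order term
    decides. *)
Lemma left_step phi R0 : rho <= R0 -> exists d k K, 0 < d <= rho /\ 0 < k /\ 0 <= K /\
  forall x, rho - d < x < rho -> m x < m rho /\ cstar m x = m x /\ k * (rho - x) <= m rho - m x /\
   Phi m phi R0 (m x) x - Phi m phi R0 (m rho) rho <=
     (m rho - m x) * (turn m rho R0 - phi) + K * ((rho - x) * sqrt (rho - x)).
Proof.
  intros HR. set (c := m rho). assert (Hc : 0 < c) by (apply profile_pos; auto).
  set (D := Derive m rho) in *.
  destruct (proj1 (cont_eps _ _) (profile_cont1 m Hm rho) (D / 2) ltac:(lra)) as [d0 [D1 D2]].
  set (d := Rmin d0 rho).
  assert (Hd : 0 < d /\ d <= d0 /\ d <= rho).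
  { split; [apply Rmin_glb_lt; auto|split; [apply Rmin_l|apply Rmin_r]]. }
  assert (Hder : forall t, rho - d < t <= rho -> D / 2 <= Derive m t <= 2 * D).
  { intros t Ht. specialize (D2 t ltac:(apply Rabs_def1; lra)). apply Rabs_def2 in D2. fold D in D2. lra. }
  assert (HK : 0 <= 2 * sqrt (4 * D / c)) by (pose proof (sqrt_pos (4 * D / c)); lra).
  exists d, (D / 2), (2 * sqrt (4 * D / c)). split; [lra|]. split; [lra|]. split; auto.
  intros x Hx.
  assert (Hlow : D / 2 * (rho - x) <= c - m x).
  { assert (m x - D / 2 * x <= m rho - D / 2 * rho); [|unfold c; lra].
    apply (mono_of_deriv (fun t => m t - D / 2 * t) (fun t => Derive m t - D / 2)); [lra| |].
    - intros t _. apply (is_derive_minus m (fun t => D / 2 * t)); [now apply profile_derive|auto_derive; auto; ring].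
    - intros t Ht. specialize (Hder t ltac:(lra)). lra. }
  assert (Hup : c - m x <= 2 * D * (rho - x)).
  { assert (2 * D * x - m x <= 2 * D * rho - m rho); [|unfold c; lra].
    apply (mono_of_deriv (fun t => 2 * D * t - m t) (fun t => 2 * D - Derive m t)); [lra| |].
    - intros t _. apply (is_derive_minus (fun t => 2 * D * t) m); [auto_derive; auto; ring|now apply profile_derive].
    - intros t Ht. specialize (Hder t ltac:(lra)). lra. }
  assert (Hmono : forall t, x <= t <= rho -> m x <= m t <= c).
  { intros t Ht. split; apply profile_mono; try lra; intros u Hu; specialize (Hder u ltac:(lra)); lra. }
  assert (Hxpos : 0 < m x) by (apply profile_pos; auto; lra).
  assert (Hlt : m x < c) by nra.
  split; auto. split; [|split; auto].
  { apply Rle_antisym; [apply cstar_le; auto; lra|]. apply cstar_ge; auto; [lra|].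
    intros t Ht. destruct (Rle_dec t rho); [apply Hmono; lra|].
    specialize (Hgt t ltac:(lra)). fold c in Hgt. lra. }
  set (c' := m x) in *.
  assert (Hgt' : forall y, rho < y -> forall t, y <= t -> c < m t) by (intros; apply Hgt; lra).
  (* [hdef] is singular at [rho], so the inequality is used from some [y > rho] on, and [[rho, y]]
     costs at most its length. *)
  assert (S1 : W m c rho - W m c' rho <= (c - c') * Thi m rho).
  { apply le_of_eps. intros e He. set (y := rho + e / 2).
    pose proof (W_subgrad_down c c' y ltac:(unfold y; lra) ltac:(lra) (Hgt' y ltac:(unfold y; lra))) as H1.
    unfold c in H1 at 3. rewrite tail_h_Thi in H1 by (unfold y; lra).
    pose proof (th_mono m Hm rho Hrho Hm1 Hgt 0 (sqrt (y - rho)) (sqrt_pos _)) as Hmo. rewrite th_0 in Hmo.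
    pose proof (W_Chasles m Hm HJ c rho y ltac:(unfold y; lra)).
    pose proof (W_Chasles m Hm HJ c' rho y ltac:(unfold y; lra)).
    pose proof (wdef_RInt_range m Hm c rho y ltac:(unfold y; lra)).
    pose proof (wdef_RInt_range m Hm c' rho y ltac:(unfold y; lra)).
    unfold y in *. fold c in H1. nra. }
  assert (S2 : RInt (wdef m c) rho R0 - RInt (wdef m c') rho R0 <= (c - c') * th m rho (sqrt (R0 - rho))).
  { destruct (Rle_lt_or_eq_dec _ _ HR) as [Hl|<-].
    - apply le_of_eps. intros e He. set (y := rho + Rmin (e / 2) (R0 - rho)).
      assert (Hy : rho < y <= R0 /\ y <= rho + e / 2).
      { unfold y. pose proof (Rmin_l (e / 2) (R0 - rho)). pose proof (Rmin_r (e / 2) (R0 - rho)).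
        assert (0 < Rmin (e / 2) (R0 - rho)) by (apply Rmin_glb_lt; lra). lra. }
      pose proof (wdef_int_subgrad_down c c' y R0 ltac:(lra) ltac:(lra)
        ltac:(intros; apply (Hgt' y); lra)) as H1.
      unfold c in H1 at 3. rewrite RInt_h_th in H1 by lra.
      pose proof (th_mono m Hm rho Hrho Hm1 Hgt 0 (sqrt (y - rho)) (sqrt_pos _)) as Hmo. rewrite th_0 in Hmo.
      assert (Cw : forall k t, rho <= t <= R0 -> continuous (wdef m k) t) by (intros; apply wdef_cont; auto; lra).
      pose proof (RInt_Chasles_cont _ rho y R0 ltac:(lra) (Cw c)).
      pose proof (RInt_Chasles_cont _ rho y R0 ltac:(lra) (Cw c')).
      pose proof (wdef_RInt_range m Hm c rho y ltac:(lra)).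
      pose proof (wdef_RInt_range m Hm c' rho y ltac:(lra)).
      fold c in H1. nra.
    - rewrite (Rminus_diag rho), sqrt_0, th_0, !RInt_point. unfold zero; simpl. lra. }
  assert (S3 : (rho - x) - RInt (wdef m c') x rho <= sqrt (4 * D / c) * ((rho - x) * sqrt (rho - x))).
  { rewrite <- RInt_one_minus by (auto; lra).
    apply Rle_trans with (RInt (fun _ => sqrt (4 * D / c) * sqrt (rho - x)) x rho).
    - apply RInt_le_cont; [lra| |intros; apply continuous_const|].
      + intros t Ht. apply (cont_minus (fun _ => 1)); [apply continuous_const|apply wdef_cont; auto; lra].
      + intros t Ht. unfold wdef. replace (1 - (1 - sqrt (1 - (c' / m t) ^ 2))) with (sqrt (1 - (c' / m t) ^ 2)) by ring.
        rewrite <- sqrt_mult_alt by (apply Rdiv_le_0_compat; lra).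
        apply sqrt_le_1_alt. specialize (Hmono t Ht).
        assert (Hq : c' / c <= c' / m t).
        { apply Rmult_le_compat_l; [lra|]. apply Rinv_le_contravar; lra. }
        assert (0 <= c' / c) by (apply Rdiv_le_0_compat; lra).
        assert ((c' / c) ^ 2 <= (c' / m t) ^ 2) by (apply pow_incr; lra).
        assert (1 - (c' / c) ^ 2 <= 4 * D / c * (rho - x)); [|lra].
        replace (1 - (c' / c) ^ 2) with ((c - c') * (c + c') / (c * c)) by (field; lra).
        apply div_le; [nra|]. replace (4 * D / c * (rho - x) * (c * c)) with (2 * D * (rho - x) * (2 * c)) by (field; lra).
        apply Rmult_le_compat; lra.
    - rewrite RInt_const_R. lra. }
  pose proof (W_Chasles m Hm HJ c' x rho ltac:(lra)).
  pose proof (W_Chasles m Hm HJ c rho R0 ltac:(lra)).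
  pose proof (W_Chasles m Hm HJ c' rho R0 ltac:(lra)).
  unfold Phi, turn. nra.
Qed.

End AtRho.

(** An interior minimizer of [Fcap] is the turning radius of a geodesic of total turn [phi]. *)
Lemma minimizer_geodesic R0 phi c2 r1 : 0 < R0 -> 0 <= phi < PI -> 0 < c2 <= cstar m R0 ->
  0 <= r1 <= R0 -> Fcap m c2 phi R0 r1 < Fcap m c2 phi R0 R0 ->
  exists rho, 0 < rho < R0 /\ 0 < Derive m rho /\ (forall x, rho < x -> m rho < m x) /\ m rho < c2 /\
    turn m rho R0 = phi /\ forall x, 0 <= x <= R0 -> Phi m phi R0 (m rho) rho <= Fcap m c2 phi R0 x.
Proof.
  intros HR Hphi Hc2 Hr1 Hlt.
  destruct (min_attained (Fcap m c2 phi R0) 0 R0 ltac:(lra)) as [x0 [Hx0 Hmin]].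
  { intros; apply Fcap_cont; auto; lra. }
  (* At 0 the bound is the defect of the path through the origin. A minimum there would make this
     path shortest, against [corner_cut]. *)
  assert (Hx0p : 0 < x0).
  { apply Rnot_le_lt. intros Hl. assert (x0 = 0) by lra. subst x0.
    assert (E0 : Fcap m c2 phi R0 0 = R0) by (unfold Fcap; destruct Rle_dec; lra).
    destruct (corner_cut m Hm phi R0 Hphi HR) as [e [He1 He2]]. specialize (He2 0).
    rewrite Rplus_0_l in He2.
    assert (H : R0 + R0 <= dr m (polar R0 0) (polar R0 phi)).
    { apply (dr_lower m Hm HJ Hinf _ _ R0 R0 phi c2); auto; try lra; try (apply enorm_polar; lra).
      - rewrite dot_polar. replace (0 - phi) with (- phi) by ring. now rewrite cos_neg.
      - intros x Hx. specialize (Hmin x Hx). rewrite E0 in Hmin. exact Hmin. }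
    pose proof (dr_triangle m Hm (polar R0 0) (polar e 0) (polar R0 phi)).
    pose proof (dr_triangle m Hm (polar e 0) (polar e phi) (polar R0 phi)).
    pose proof (dr_radial_line m Hm phi e R0 ltac:(lra)).
    pose proof (dr_radial_line m Hm 0 e R0 ltac:(lra)).
    rewrite (dr_sym m Hm (polar R0 0) (polar e 0)) in H0. lra. }
  set (c := cstar m x0). assert (Hc : 0 < c) by (apply cstar_pos; auto).
  assert (EFR : Fcap m c2 phi R0 R0 = Phi m phi R0 c2 R0).
  { rewrite Fcap_pos by auto. now rewrite Rmin_right by lra. }
  (* If the cap were active at [x0], the value there would be at least the value at [R0], which [r1]
     beats. *)
  assert (Hcc2 : c < c2).
  { apply Rnot_le_lt. intros Hl. specialize (Hmin r1 Hr1).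
    rewrite (Fcap_pos m c2 phi R0 x0) in Hmin by auto. rewrite Rmin_right in Hmin by exact Hl.
    rewrite EFR in Hlt. pose proof (W_Chasles m Hm HJ c2 x0 R0 ltac:(lra)).
    pose proof (wdef_RInt_range m Hm c2 x0 R0 ltac:(lra)). unfold Phi in Hmin, Hlt. lra. }
  (* Moving out to the last radius with the same infimum keeps the constant and does not raise the
     value. *)
  destruct (last_point x0 Hx0p) as [rho [Hr [Er Hgt]]]. fold c in Er, Hgt.
  assert (HrR : rho < R0).
  { apply Rnot_le_lt. intros Hl. pose proof (cstar_le m Hm Hinf R0 rho ltac:(lra)). lra. }
  assert (Ecr : cstar m rho = c).
  { apply Rle_antisym; [rewrite <- Er; apply cstar_le; auto; lra|apply cstar_mono; auto; lra]. }
  assert (EFr : Fcap m c2 phi R0 rho = Phi m phi R0 c rho).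
  { rewrite Fcap_pos by lra. rewrite Ecr, Rmin_left by lra. reflexivity. }
  assert (Hmin' : forall x, 0 <= x <= R0 -> Phi m phi R0 c rho <= Fcap m c2 phi R0 x).
  { intros x Hx. eapply Rle_trans; [|apply Hmin, Hx].
    rewrite (Fcap_pos m c2 phi R0 x0) by auto. fold c. rewrite Rmin_left by lra.
    pose proof (W_Chasles m Hm HJ c x0 rho ltac:(lra)).
    pose proof (wdef_RInt_range m Hm c x0 rho ltac:(lra)). unfold Phi. lra. }
  assert (Hrho : 0 < rho) by lra.
  assert (Hgt' : forall x, rho < x -> m rho < m x) by (intros; rewrite Er; auto).
  (* Moving outward from the minimizer cannot lower the value, so by [right_step] the angle swept
     outside radius [x] is at most [phi]. *)
  assert (HQ : forall x, rho < x <= R0 -> 2 * RInt (hdef m c) x R0 + tail (hdef m c) R0 <= phi).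
  { intros x Hx. set (c' := Rmin (cstar m x) c2).
    assert (Hc' : c < c').
    { apply Rmin_glb_lt; auto. destruct (cstar_attained m Hm Hinf x ltac:(lra)) as [_ [t [Ht <-]]].
      apply Hgt; lra. }
    pose proof (right_step phi R0 rho x c c' ltac:(lra) ltac:(lra) ltac:(lra)) as RS.
    specialize (RS ltac:(intros t Ht; split; [apply Hgt; lra|eapply Rle_trans; [apply Rmin_l|apply cstar_le; auto; lra]])).
    specialize (Hmin' x ltac:(lra)). rewrite Fcap_pos in Hmin' by lra. fold c' in Hmin'.
    apply Rnot_lt_le. intros Hl. nra. }
  assert (HT : forall x, rho < x -> has_tail (hdef m c) x).
  { intros x Hx. apply has_tail_hdef; auto; try lra. intros; apply Hgt; lra. }
  assert (Htail : forall x, rho < x -> tail (hdef m c) x <= phi).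
  { intros x Hx. destruct (Rle_dec x R0) as [Hl|Hl].
    - rewrite (tail_Chasles _ x R0 (HT x Hx) Hl). specialize (HQ x ltac:(lra)).
      assert (0 <= RInt (hdef m c) x R0); [|lra].
      apply RInt_pos; auto; intros t Ht.
      + apply hdef_cont; auto; [split; [lra|apply Hgt; lra]|lra].
      + apply hdef_ge0; auto. split; [lra|apply Hgt; lra].
    - specialize (HQ R0 ltac:(lra)). rewrite RInt_point in HQ. unfold zero in HQ; simpl in HQ.
      pose proof (tail_Chasles _ R0 x (HT R0 HrR) ltac:(lra)).
      assert (0 <= RInt (hdef m c) R0 x); [|lra].
      apply RInt_pos; [lra| |]; intros t Ht.
      + apply hdef_cont; auto; [split; [lra|apply Hgt; lra]|lra].
      + apply hdef_ge0; auto. split; [lra|apply Hgt; lra]. }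
  (* A critical point of [m] would give an infinite turn, against the bound [phi]. *)
  assert (Hm1 : 0 < Derive m rho).
  { destruct (Rle_lt_or_eq_dec _ _ (Derive_ge0_of_gt rho Hgt')) as [H|H]; auto. exfalso.
    destruct (hdef_diverges rho phi Hrho (eq_sym H)) as [eta [d [He [Hd HD]]]].
    specialize (HD c Hc ltac:(lra) ltac:(intros; apply Hgt; lra)).
    pose proof (RInt_le_tail _ _ (HT (rho + eta) ltac:(lra)) (rho + 1) ltac:(lra)).
    specialize (Htail (rho + eta) ltac:(lra)). lra. }
  exists rho. rewrite <- Er in *. repeat (split; [first [lra|assumption]|]). split; [|exact Hmin'].
  apply Rle_antisym.
  - apply le_of_eps. intros e He.
    destruct (th_small rho Hrho Hm1 Hgt' (e / 2) ltac:(lra)) as [d [D1 D2]].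
    set (x := rho + Rmin (d / 2) (R0 - rho)).
    assert (Hx : rho < x <= R0 /\ x < rho + d).
    { unfold x. pose proof (Rmin_l (d / 2) (R0 - rho)). pose proof (Rmin_r (d / 2) (R0 - rho)).
      assert (0 < Rmin (d / 2) (R0 - rho)) by (apply Rmin_glb_lt; lra). lra. }
    specialize (D2 x ltac:(lra)). specialize (HQ x ltac:(lra)).
    rewrite RInt_h_th, tail_h_Thi in HQ by (auto; lra). unfold turn. lra.
  - apply Rnot_lt_le. intros Hl.
    destruct (left_step rho Hrho Hm1 Hgt' phi R0 ltac:(lra)) as [d [k [K [Hd [Hk [HK LS]]]]]].
    set (g := phi - turn m rho R0) in *.
    (* [u] is so small that the error of order 3/2 uses up at most half of the first-order
       decrease. *)
    set (u := Rmin (d / 2) ((k * g / (K + 1)) ^ 2 / 4)).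
    assert (Hkg : 0 < k * g / (K + 1)).
    { apply Rdiv_lt_0_compat; [|lra]. apply Rmult_lt_0_compat; auto. unfold g; lra. }
    assert (Hu : 0 < u <= d / 2).
    { unfold u. split; [apply Rmin_glb_lt; [lra|]|apply Rmin_l].
      apply Rdiv_lt_0_compat; [apply pow_lt; auto|lra]. }
    assert (Hsu : sqrt u <= k * g / (K + 1) / 2).
    { rewrite <- (sqrt_pow2 (k * g / (K + 1) / 2)) by lra. apply sqrt_le_1_alt.
      unfold u. eapply Rle_trans; [apply Rmin_r|]. apply Req_le. field. lra. }
    specialize (LS (rho - u) ltac:(lra)). destruct LS as [L1 [L2 [L3 L4]]].
    replace (rho - (rho - u)) with u in L3, L4 by ring.
    specialize (Hmin' (rho - u) ltac:(lra)). rewrite Fcap_pos in Hmin' by lra.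
    rewrite L2, Rmin_left in Hmin' by lra.
    replace (turn m rho R0 - phi) with (- g) in L4 by (unfold g; ring).
    assert (Hg : 0 < g) by (unfold g; lra).
    assert (k * u * g <= (m rho - m (rho - u)) * g) by (apply Rmult_le_compat_r; lra).
    assert (K * (u * sqrt u) <= (K + 1) * (u * (k * g / (K + 1) / 2))).
    { pose proof (sqrt_pos u). apply Rmult_le_compat; try lra; [nra|]. apply Rmult_le_compat_l; lra. }
    replace ((K + 1) * (u * (k * g / (K + 1) / 2))) with (k * u * g / 2) in H0 by (field; lra).
    assert (0 < k * u * g) by (repeat apply Rmult_lt_0_compat; lra). lra.
Qed.

End Steps.

(** * From interior minimizers to rays, and openness of the criterion *)

Lemma right_quotient (f : R -> R) (l : R) : is_derive f 0 l ->
  filterlim (fun h => (f h - f 0) / h) (at_right 0) (locally l).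
Proof.
  intros H. apply is_derive_Reals in H. apply filterlim_locally. intros e.
  destruct (H e (cond_pos e)) as [d Hd]. exists d. intros h Hh Hp.
  specialize (Hd h ltac:(lra)). rewrite Rplus_0_l in Hd. apply Hd.
  revert Hh. unfold ball; simpl. unfold AbsRing_ball, abs, minus, plus, opp; simpl.
  now rewrite Ropp_0, Rplus_0_r.
Qed.

Lemma acos_lt_half x : 0 < x <= 1 -> acos x < PI / 2.
Proof.
  intros Hx. apply Rnot_le_lt. intros Hl. pose proof (acos_bound x).
  assert (cos (acos x) <= cos (PI / 2)) by (apply cos_decr_1; pose proof PI_RGT_0; lra).
  rewrite cos_PI2, cos_acos in H0 by lra. lra.
Qed.

Section Ray.
Context (m : R -> R) (Hm : profile m) (HJ : fin_invsq m) (Hinf : unbounded m).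

Lemma Fcap_phi c2 a b R0 x : 0 < c2 -> a <= b ->
  Fcap m c2 b R0 x - c2 * (b - a) <= Fcap m c2 a R0 x <= Fcap m c2 b R0 x.
Proof.
  intros Hc Hab. unfold Fcap. destruct Rle_dec as [H|H].
  - split; [|lra]. assert (0 <= c2 * (b - a)) by (apply Rmult_le_pos; lra). lra.
  - unfold Phi. set (k := Rmin (cstar m x) c2).
    assert (Hk : 0 <= k <= c2).
    { unfold k. split; [|apply Rmin_r]. apply Rlt_le, Rmin_glb_lt; auto. apply cstar_pos; auto; lra. }
    nra.
Qed.

Definition minimizing (R0 phi c2 rho : R) : Prop :=
  0 < rho < R0 /\ 0 < Derive m rho /\ (forall x, rho < x -> m rho < m x) /\ m rho < c2 /\
    turn m rho R0 = phi /\ forall x, 0 <= x <= R0 -> Phi m phi R0 (m rho) rho <= Fcap m c2 phi R0 x.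

(** For large [T] the lower bound for the distance between times 0 and [T] is within [e] of [T],
    because by [geo_lim] the gain of the geodesic is the minimum of [Fcap]. A shortcut between times
    [s] and [t] would shorten the whole. *)
Lemma ray_of_min R0 phi c2 rho r y Th p : 0 <= phi <= PI -> minimizing R0 phi c2 rho ->
  geodesic m rho R0 r y Th ->
  forall s t, 0 <= s <= t -> dr m (polar (r s) (p + Th s)) (polar (r t) (p + Th t)) = t - s.
Proof.
  intros Hphi (Hrho & Hm1 & Hgt & Hcc & Hturn & Hmin) G s t Hst.
  apply Rle_antisym; [apply (geo_dr _ _ _ _ _ _ G); lra|].
  assert (Hc0 : 0 < m rho) by (apply profile_pos; auto; lra).
  apply le_of_eps. intros e He.
  set (e1 := Rmin (e / 2) (e / (2 * c2))).
  assert (He1 : 0 < e1) by (apply Rmin_glb_lt; [lra|apply Rdiv_lt_0_compat; lra]).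
  destruct (geo_lim _ _ _ _ _ _ G e1 He1) as [T0 [HT0 HT]].
  set (T := Rmax T0 t). pose proof (Rmax_l T0 t). pose proof (Rmax_r T0 t). fold T in H, H0.
  destruct (HT T H) as [A1 A2]. rewrite Hturn in A1, A2.
  pose proof (geo_Th_range _ _ _ _ _ _ G T ltac:(lra)) as A3. rewrite Hturn in A3.
  assert (B1 : e1 <= e / 2) by apply Rmin_l.
  assert (B2 : c2 * e1 <= e / 2).
  { apply Rle_trans with (c2 * (e / (2 * c2))); [apply Rmult_le_compat_l; [lra|apply Rmin_r]|].
    apply Req_le. field. lra. }
  apply Rabs_def2 in A1. apply Rabs_def2 in A2.
  pose proof (geo_ge _ _ _ _ _ _ G T) as Hr.
  assert (HL : r T + (Phi m phi R0 (m rho) rho - c2 * (phi - Th T)) <=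
     dr m (polar (r 0) (p + Th 0)) (polar (r T) (p + Th T))).
  { rewrite (geo_r0 _ _ _ _ _ _ G), (geo_Th0 _ _ _ _ _ _ G).
    apply (dr_lower m Hm HJ Hinf _ _ R0 (r T) (Th T) c2); try lra; try (apply enorm_polar; lra).
    - rewrite dot_polar. replace (p + 0 - (p + Th T)) with (- Th T) by ring. now rewrite cos_neg.
    - intros x Hx. specialize (Hmin x Hx).
      pose proof (Fcap_phi c2 (Th T) phi R0 x ltac:(lra) ltac:(lra)). lra. }
  pose proof (geo_dr _ _ _ _ _ _ G p 0 s ltac:(lra)) as D1.
  pose proof (geo_dr _ _ _ _ _ _ G p t T ltac:(lra)) as D2.
  pose proof (dr_triangle m Hm (polar (r 0) (p + Th 0)) (polar (r s) (p + Th s)) (polar (r T) (p + Th T))).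
  pose proof (dr_triangle m Hm (polar (r s) (p + Th s)) (polar (r t) (p + Th t)) (polar (r T) (p + Th T))).
  assert (c2 * (phi - Th T) <= c2 * e1) by (apply Rmult_le_compat_l; lra).
  lra.
Qed.

Lemma polar_origin t : polar 0 t = origin.
Proof. unfold polar, origin. f_equal; ring. Qed.

(** The segment to the origin is the meridian. The cosine of its angle with the geodesic is minus
    the initial radial speed, sqrt (m(R0)^2 - m(rho)^2) / m(R0), which is positive. *)
Lemma A_of_min R0 phi c2 rho p : 0 <= phi <= PI -> minimizing R0 phi c2 rho -> A_m m (polar R0 p).
Proof.
  intros Hphi Hmin'. pose proof Hmin' as (Hrho & Hm1 & Hgt & _).
  destruct (geodesic_exists m Hm HJ Hinf rho ltac:(lra) Hm1 Hgt R0 ltac:(lra)) as [r [y [Th G]]].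
  assert (Hn : polar R0 p <> origin).
  { intros E. pose proof (enorm_polar R0 p ltac:(lra)) as En. rewrite E in En.
    unfold enorm, origin, dot in En; simpl in En. rewrite Rmult_0_l, Rplus_0_l, sqrt_0 in En. lra. }
  split; auto. exists (fun t => polar (r t) (p + Th t)).
  assert (E0 : polar (r 0) (p + Th 0) = polar R0 p).
  { rewrite (geo_r0 _ _ _ _ _ _ G), (geo_Th0 _ _ _ _ _ _ G). f_equal. ring. }
  split; [|split; auto].
  - intros s t Hs Ht. rewrite dist_finite by auto. f_equal.
    destruct (Rle_dec s t) as [H|H].
    + rewrite (ray_of_min R0 phi c2 rho r y Th p Hphi Hmin' G) by lra. rewrite Rabs_pos_eq; lra.
    + rewrite dr_sym by auto.
      rewrite (ray_of_min R0 phi c2 rho r y Th p Hphi Hmin' G) by lra. rewrite Rabs_left; lra.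
  - split; [cbv beta; now rewrite E0|].
    assert (HM : m rho < m R0) by (apply Hgt; lra).
    assert (Hc0 : 0 < m rho) by (apply profile_pos; auto; lra).
    set (M := m R0) in *. set (c := m rho) in *.
    set (r' := - sqrt (M ^ 2 - c ^ 2) / M). set (h' := c / M ^ 2).
    assert (Hs : 0 < sqrt (M ^ 2 - c ^ 2)) by (apply sqrt_lt_R0; nra).
    assert (Hs2 : sqrt (M ^ 2 - c ^ 2) ^ 2 = M ^ 2 - c ^ 2) by (rewrite <- Rsqr_pow2; apply Rsqr_sqrt; nra).
    assert (Er : r' ^ 2 + M ^ 2 * h' ^ 2 = 1).
    { unfold r', h'. transitivity ((sqrt (M ^ 2 - c ^ 2) ^ 2 + c ^ 2) / M ^ 2); [field; lra|].
      rewrite Hs2. field. lra. }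
    assert (Hr' : 0 < - r').
    { unfold r'. replace (- (- sqrt (M ^ 2 - c ^ 2) / M)) with (sqrt (M ^ 2 - c ^ 2) / M) by (field; lra).
      apply Rdiv_lt_0_compat; lra. }
    assert (Dr : is_derive r 0 r').
    { pose proof (geo_r _ _ _ _ _ _ G 0) as D. rewrite (geo_y0 _ _ _ _ _ _ G), (geo_r0 _ _ _ _ _ _ G) in D. exact D. }
    assert (Dh : is_derive Th 0 h').
    { pose proof (geo_Th _ _ _ _ _ _ G 0) as D. rewrite (geo_r0 _ _ _ _ _ _ G) in D. exact D. }
    pose proof (is_derive_unique _ _ _ Dr) as Ur. pose proof (is_derive_unique _ _ _ Dh) as Uh.
    exists (r' * cos p - R0 * sin p * h', r' * sin p + R0 * cos p * h'),
      (fun s => polar (R0 - s) p), (- cos p, - sin p).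
    split; [|split; [|split]].
    + split; simpl.
      * apply (right_quotient (fun h => r h * cos (p + Th h))).
        auto_derive; [repeat split; eexists; eassumption|].
        change (Derive (fun x => r x) 0) with (Derive r 0). change (Derive (fun x => Th x) 0) with (Derive Th 0).
        rewrite Ur, Uh, (geo_r0 _ _ _ _ _ _ G), (geo_Th0 _ _ _ _ _ _ G), Rplus_0_r. ring.
      * apply (right_quotient (fun h => r h * sin (p + Th h))).
        auto_derive; [repeat split; eexists; eassumption|].
        change (Derive (fun x => r x) 0) with (Derive r 0). change (Derive (fun x => Th x) 0) with (Derive Th 0).
        rewrite Ur, Uh, (geo_r0 _ _ _ _ _ _ G), (geo_Th0 _ _ _ _ _ _ G), Rplus_0_r. ring.
    + assert (Hseg : forall s t, 0 <= s <= t -> t <= R0 -> dr m (polar (R0 - s) p) (polar (R0 - t) p) = t - s).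
      { intros s t Hst HtR. rewrite dr_sym, dr_radial_line by (auto; lra). ring. }
      cbv beta. rewrite E0. exists R0. split; [lra|]. split; [|split; [|split]].
      * rewrite dist_finite by auto. f_equal. rewrite <- (polar_origin p).
        rewrite dr_sym, dr_radial_line by (auto; lra). ring.
      * now rewrite Rminus_0_r.
      * rewrite Rminus_diag. apply polar_origin.
      * intros s t Hs' Ht. rewrite dist_finite by auto. f_equal.
        destruct (Rle_dec s t) as [H|H].
        -- rewrite Hseg by lra. rewrite Rabs_pos_eq; lra.
        -- rewrite dr_sym, Hseg by (auto; lra). rewrite Rabs_left; lra.
    + split; simpl.
      * apply (right_quotient (fun h => (R0 - h) * cos p)). auto_derive; auto. ring.
      * apply (right_quotient (fun h => (R0 - h) * sin p)). auto_derive; auto. ring.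
    + cbv beta. rewrite E0. unfold angle.
      pose proof (sin2_cos2 p) as Esc. unfold Rsqr in Esc.
      assert (E1 : gm m (polar R0 p) (r' * cos p - R0 * sin p * h', r' * sin p + R0 * cos p * h')
         (- cos p, - sin p) = - r').
      { unfold gm. rewrite enorm_polar by lra. destruct Req_EM_T; [lra|]. cbv zeta.
        unfold dot, polar; simpl fst; simpl snd. fold M. set (sn := sin p) in *. set (cs := cos p) in *.
        replace (R0 * cs * (r' * cs - R0 * sn * h') + R0 * sn * (r' * sn + R0 * cs * h')) with
          (R0 * r' * (sn * sn + cs * cs)) by ring.
        replace (R0 * cs * - cs + R0 * sn * - sn) with (- R0 * (sn * sn + cs * cs)) by ring.
        replace ((r' * cs - R0 * sn * h') * - cs + (r' * sn + R0 * cs * h') * - sn) with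
          (- r' * (sn * sn + cs * cs)) by ring.
        rewrite Esc. field. lra. }
      assert (E2 : gm m (polar R0 p) (- cos p, - sin p) (- cos p, - sin p) = 1).
      { unfold gm. rewrite enorm_polar by lra. destruct Req_EM_T; [lra|]. cbv zeta.
        unfold dot, polar; simpl fst; simpl snd. fold M. set (sn := sin p) in *. set (cs := cos p) in *.
        replace (R0 * cs * - cs + R0 * sn * - sn) with (- R0 * (sn * sn + cs * cs)) by ring.
        replace (- cs * - cs + - sn * - sn) with (sn * sn + cs * cs) by ring.
        rewrite Esc. field. lra. }
      assert (E3 : gm m (polar R0 p) (r' * cos p - R0 * sin p * h', r' * sin p + R0 * cos p * h')
         (r' * cos p - R0 * sin p * h', r' * sin p + R0 * cos p * h') = 1).
      { rewrite <- Er.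
        unfold gm. rewrite enorm_polar by lra. destruct Req_EM_T; [lra|]. cbv zeta.
        unfold dot, polar; simpl fst; simpl snd. fold M. set (sn := sin p) in *. set (cs := cos p) in *.
        replace (R0 * cs * (r' * cs - R0 * sn * h') + R0 * sn * (r' * sn + R0 * cs * h')) with
          (R0 * r' * (sn * sn + cs * cs)) by ring.
        replace ((r' * cs - R0 * sn * h') * (r' * cs - R0 * sn * h') +
          (r' * sn + R0 * cs * h') * (r' * sn + R0 * cs * h')) with
          ((r' ^ 2 + R0 ^ 2 * h' ^ 2) * (sn * sn + cs * cs)) by ring.
        rewrite Esc. field. lra. }
      rewrite E1, E2, E3, sqrt_1. replace (- r' / (1 * 1)) with (- r') by field.
      apply acos_lt_half. nra.
Qed.

(** The comparison value at [r1] beats the direct outgoing route, for some angle [phi < PI]: an open condition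
    on [R0] which characterizes [A_m]. *)
Definition crit (R0 : R) : Prop := exists c2 phi r1, 0 < c2 <= cstar m R0 /\ 0 <= phi < PI /\
  0 <= r1 <= R0 /\ Fcap m c2 phi R0 r1 < Fcap m c2 phi R0 R0.

Lemma A_of_crit R0 p : 0 < R0 -> crit R0 -> A_m m (polar R0 p).
Proof.
  intros HR [c2 [phi [r1 [H1 [H2 [H3 H4]]]]]].
  destruct (minimizer_geodesic m Hm HJ Hinf R0 phi c2 r1 HR H2 H1 H3 H4) as [rho Hrho].
  apply (A_of_min R0 phi c2 rho); auto. lra.
Qed.

(** The angle and the radius [r1 < R0] are kept, while the cap becomes [Rmin (cstar R') c2], since
    [cstar R'] may drop below [c2]. Both sides are then continuous in [R']. *)
Lemma crit_open R0 : 0 < R0 -> crit R0 -> exists e, 0 < e /\ forall R', Rabs (R' - R0) < e -> 0 < R' /\ crit R'.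
Proof.
  intros HR [c2 [phi [r1 [H1 [H2 [H3 H4]]]]]].
  assert (Hr1 : r1 < R0).
  { destruct (Rle_lt_or_eq_dec _ _ (proj2 H3)) as [H|H]; auto. rewrite H in H4. lra. }
  set (k := fun R' => Rmin (cstar m R') c2).
  assert (Ck : continuous k R0) by (apply (cont_min (cstar m) (fun _ => c2));
    [apply cstar_cont; auto|apply continuous_const]).
  assert (Ek : k R0 = c2) by (apply Rmin_right; lra).
  assert (HD : exists d, 0 < d /\ forall R', Rabs (R' - R0) < d -> 0 < R' ->
     Fcap m (k R') phi R' r1 < Phi m phi R' (k R') R').
  { set (G := fun R' => Phi m phi R' (k R') R' - (if Rle_dec r1 0 then R' else Phi m phi R' (Rmin (cstar m r1) (k R')) r1)).
    assert (CG : continuous G R0).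
    { apply cont_minus.
      - apply (cont_Phi m Hm HJ (fun _ => phi) (fun R' => R') k (fun R' => R')); auto;
          try apply continuous_const; apply continuous_id.
      - destruct Rle_dec; [apply continuous_id|].
        apply (cont_Phi m Hm HJ (fun _ => phi) (fun R' => R') (fun R' => Rmin (cstar m r1) (k R')) (fun _ => r1)); auto;
          try apply continuous_const; try apply continuous_id; [|lra].
        apply (cont_min (fun _ => cstar m r1) k); auto. apply continuous_const. }
    assert (G0 : 0 < G R0).
    { rewrite (Fcap_pos m c2 phi R0 R0) in H4 by auto. rewrite Rmin_right in H4 by lra.
      unfold G. rewrite Ek. unfold Fcap in H4. destruct Rle_dec; lra. }
    destruct (proj1 (cont_eps G R0) CG (G R0) G0) as [d [D1 D2]].
    exists d. split; auto. intros R' HR' Hp. specialize (D2 R' HR'). apply Rabs_def2 in D2.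
    assert (GR : 0 < G R') by lra. unfold G in GR. unfold Fcap. destruct Rle_dec; lra. }
  destruct HD as [d [D1 D2]].
  exists (Rmin d (R0 - r1)). split; [apply Rmin_glb_lt; lra|].
  intros R' HR'.
  assert (B1 : Rabs (R' - R0) < d) by (eapply Rlt_le_trans; [exact HR'|apply Rmin_l]).
  assert (B2 : Rabs (R' - R0) < R0 - r1) by (eapply Rlt_le_trans; [exact HR'|apply Rmin_r]).
  apply Rabs_def2 in B2. assert (Hp : 0 < R') by lra. split; auto.
  exists (k R'), phi, r1. split; [|split; [|split]]; auto; try lra.
  - unfold k. split; [apply Rmin_glb_lt; [apply cstar_pos; auto|lra]|apply Rmin_l].
  - rewrite (Fcap_pos m (k R') phi R' R') by auto.
    rewrite (Rmin_right (cstar m R') (k R')) by apply Rmin_l. auto.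
Qed.

End Ray.

(** * Consequences of the existence of an inward ray *)

(** No bound on [x] is assumed, since the quotient in [angle] is never estimated by Cauchy-Schwarz;
    at and below -1 the value of [acos] is PI. *)
Lemma acos_lt_half_inv x : acos x < PI / 2 -> 0 < x.
Proof.
  intros H. apply Rnot_le_lt. intros Hx. pose proof PI_RGT_0.
  destruct (Rle_dec x (-1)) as [Hl|Hl].
  - unfold acos in H. destruct Rle_dec; lra.
  - assert (E : cos (acos x) = x) by (apply cos_acos; lra).
    pose proof (acos_bound x). assert (0 < cos (acos x)) by (apply cos_gt_0; lra). lra.
Qed.

Lemma polar_repr_from q p : q <> origin -> exists a e, 0 <= a <= PI /\ (e = 1 \/ e = -1) /\
  q = polar (enorm q) (p + e * a).
Proof.
  intros Hq. destruct (polar_repr q Hq) as [u Hu].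
  set (d := u - p). pose proof (COS_bound d) as Hb.
  assert (Ec : cos (acos (cos d)) = cos d) by (apply cos_acos; lra).
  pose proof (acos_bound (cos d)).
  assert (Hs : 0 <= sin (acos (cos d))) by (apply sin_ge_0; lra).
  pose proof (sin2_cos2 d) as E1. pose proof (sin2_cos2 (acos (cos d))) as E2. unfold Rsqr in E1, E2.
  rewrite Ec in E2.
  destruct (Rle_dec 0 (sin d)) as [H0|H0].
  - exists (acos (cos d)), 1. split; auto. split; auto.
    assert (Es : sin (acos (cos d)) = sin d) by nra.
    rewrite Hu at 1. unfold polar. rewrite Rmult_1_l, cos_plus, sin_plus, Ec, Es.
    replace u with (p + d) by (unfold d; ring). rewrite cos_plus, sin_plus. reflexivity.
  - exists (acos (cos d)), (-1). split; auto. split; auto.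
    assert (Es : sin (acos (cos d)) = - sin d) by nra.
    rewrite Hu at 1. unfold polar. replace (p + -1 * acos (cos d)) with (p - acos (cos d)) by ring.
    rewrite cos_minus, sin_minus, Ec, Es.
    replace u with (p + d) by (unfold d; ring). rewrite cos_plus, sin_plus. f_equal; ring.
Qed.

Section FromRay.
Context (m : R -> R) (Hm : profile m).

Lemma dr_origin q : dr m q origin = enorm q.
Proof.
  destruct (classic (q = origin)) as [->|n].
  - rewrite <- (polar_origin 0) at 1 2. rewrite dr_radial_line by (auto; lra).
    rewrite <- (polar_origin 0), enorm_polar; lra.
  - destruct (polar_repr q n) as [t Ht]. rewrite Ht at 1. rewrite <- (polar_origin t).
    rewrite dr_sym, dr_radial_line by (auto; pose proof (enorm_ge0 q); lra). ring.
Qed.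

(** All that is kept of the angle condition. The segment is a meridian, so its initial velocity is
    the inward radial unit vector, and an acute angle makes the one-sided derivative of |g|^2 at
    time 0 negative. *)
Lemma inward_of_A q : A_m m q -> exists g t0, 0 < t0 /\ g 0 = q /\ enorm (g t0) < enorm q /\
  forall s t, 0 <= s -> 0 <= t -> dr m (g s) (g t) = Rabs (t - s).
Proof.
  intros [Hq [g [Hg [Eg [Hg0 [v [sg [w [Hv [Hsg [Hw Hang]]]]]]]]]]].
  assert (Hray : forall s t, 0 <= s -> 0 <= t -> dr m (g s) (g t) = Rabs (t - s)).
  { intros s t Hs Ht. specialize (Hg s t Hs Ht). rewrite dist_finite in Hg by auto. now injection Hg. }
  set (R0 := enorm q). assert (HR : 0 < R0).
  { destruct (Rle_lt_or_eq_dec 0 R0 (enorm_ge0 q)) as [H|H]; auto.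
    exfalso; apply Hq, enorm_eq0. auto. }
  destruct (polar_repr q Hq) as [p Hp]. fold R0 in Hp.
  rewrite Eg in *.
  destruct Hsg as [l [Hl [El [S0 [Sl HS]]]]].
  rewrite dist_finite, dr_origin in El by auto. injection El as El. fold R0 in El. subst l.
  assert (Hsgp : forall s, 0 < s < R0 -> sg s = polar (R0 - s) p).
  { intros s Hs. pose proof (HS 0 s ltac:(lra) ltac:(lra)) as H1. pose proof (HS s R0 ltac:(lra) ltac:(lra)) as H2.
    rewrite dist_finite in H1, H2 by auto. injection H1 as H1. injection H2 as H2.
    rewrite Sl, dr_origin, Rabs_pos_eq in H2 by lra. rewrite S0, Rminus_0_r, Rabs_pos_eq in H1 by lra.
    assert (Hn : sg s <> origin).
    { intros E. rewrite E in H2. unfold enorm, origin, dot in H2; simpl in H2.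
      rewrite Rmult_0_l, Rplus_0_l, sqrt_0 in H2. lra. }
    destruct (polar_repr (sg s) Hn) as [u Hu]. rewrite H2 in Hu. rewrite Hu.
    apply (meridian_unique m Hm R0); [lra|]. rewrite <- Hp, <- Hu. lra. }
  assert (Ew : w = (- cos p, - sin p)).
  { destruct Hw as [W1 W2]. destruct w as [w1 w2]; simpl in W1, W2.
    rewrite S0, Hp in W1, W2. unfold polar in W1, W2; simpl in W1, W2.
    assert (Hnear : at_right 0 (fun h => 0 < h < R0)).
    { exists (mkposreal R0 HR). intros h Hh Hpos. split; auto.
      revert Hh. unfold ball; simpl. unfold AbsRing_ball, abs, minus, plus, opp; simpl.
      rewrite Ropp_0, Rplus_0_r. intros Hh. apply Rabs_def2 in Hh. lra. }
    f_equal.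
    - apply (filterlim_locally_unique (F := at_right 0) (fun h => (fst (sg h) - R0 * cos p) / h)); auto.
      apply (filterlim_ext_loc (fun _ => - cos p)); [|apply filterlim_const].
      eapply filter_imp; [|exact Hnear]. intros h Hh. rewrite Hsgp by auto. unfold polar; simpl. field. lra.
    - apply (filterlim_locally_unique (F := at_right 0) (fun h => (snd (sg h) - R0 * sin p) / h)); auto.
      apply (filterlim_ext_loc (fun _ => - sin p)); [|apply filterlim_const].
      eapply filter_imp; [|exact Hnear]. intros h Hh. rewrite Hsgp by auto. unfold polar; simpl. field. lra. }
  subst w. unfold angle in Hang. apply acos_lt_half_inv in Hang.
  assert (Hdot : dot q v < 0).
  { pose proof (sin2_cos2 p) as Esc. unfold Rsqr in Esc.
    assert (E1 : gm m q v (- cos p, - sin p) = - (dot q v / R0)).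
    { unfold gm. fold R0. destruct Req_EM_T; [lra|]. cbv zeta. rewrite Hp. unfold dot, polar; simpl fst; simpl snd.
      set (sn := sin p) in *. set (cs := cos p) in *.
      replace (R0 * cs * - cs + R0 * sn * - sn) with (- R0 * (sn * sn + cs * cs)) by ring.
      rewrite Esc. field. lra. }
    rewrite E1 in Hang. apply Rnot_le_lt. intros Hle.
    set (N := sqrt (gm m q v v) * sqrt (gm m q (- cos p, - sin p) (- cos p, - sin p))) in *.
    assert (HN : 0 <= / N).
    { assert (0 <= N) by (apply Rmult_le_pos; apply sqrt_pos).
      destruct (Rle_lt_or_eq_dec 0 N H) as [H1|H1]; [now apply Rlt_le, Rinv_0_lt_compat|].
      rewrite <- H1, Rinv_0. lra. }
    assert (0 <= dot q v / R0) by (apply Rdiv_le_0_compat; lra).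
    unfold Rdiv in Hang. nra. }
  destruct Hv as [V1 V2]. rewrite Eg in V1, V2. destruct v as [v1 v2]; simpl in V1, V2.
  set (D := - dot q (v1, v2)) in *. assert (HD : 0 < D) by (unfold D; lra).
  set (B := Rabs (fst q) + Rabs (snd q) + 1).
  assert (HB : 1 <= B) by (unfold B; pose proof (Rabs_pos (fst q)); pose proof (Rabs_pos (snd q)); lra).
  (* For the difference quotient [a] at time [h], |g h|^2 - |q|^2 = h (2 q.a + h |a|^2). The
     constants [e], [C] and [h] ensure q.a <= -D/2 and h |a|^2 < D. *)
  set (e := D / (2 * B)). assert (He : 0 < e) by (apply Rdiv_lt_0_compat; lra).
  destruct (proj1 (filterlim_locally _ _) V1 (mkposreal e He)) as [d1 H1].
  destruct (proj1 (filterlim_locally _ _) V2 (mkposreal e He)) as [d2 H2].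
  set (C := (Rabs v1 + e) ^ 2 + (Rabs v2 + e) ^ 2 + 1).
  assert (HC : 1 <= C) by (unfold C; pose proof (pow2_ge_0 (Rabs v1 + e)); pose proof (pow2_ge_0 (Rabs v2 + e)); lra).
  set (h := Rmin (Rmin (d1 / 2) (d2 / 2)) (D / (2 * C))).
  pose proof (cond_pos d1). pose proof (cond_pos d2).
  assert (Hh : 0 < h) by (repeat apply Rmin_glb_lt; try lra; apply Rdiv_lt_0_compat; lra).
  assert (L1 : h <= d1 / 2) by (eapply Rle_trans; [apply Rmin_l|apply Rmin_l]).
  assert (L2 : h <= d2 / 2) by (eapply Rle_trans; [apply Rmin_l|apply Rmin_r]).
  assert (L3 : h * C <= D / 2).
  { assert (h <= D / (2 * C)) by apply Rmin_r.
    apply Rle_trans with (D / (2 * C) * C); [apply Rmult_le_compat_r; lra|]. apply Req_le; field; lra. }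
  assert (Hball : forall d : posreal, h <= d / 2 -> ball 0 d h).
  { intros d Hd. pose proof (cond_pos d). unfold ball; simpl. unfold AbsRing_ball, abs, minus, plus, opp; simpl.
    rewrite Ropp_0, Rplus_0_r, Rabs_pos_eq; lra. }
  specialize (H1 h (Hball d1 L1) Hh). specialize (H2 h (Hball d2 L2) Hh).
  revert H1 H2. unfold ball; simpl. unfold AbsRing_ball, abs, minus, plus, opp; simpl. intros H1 H2.
  exists g, h. split; auto. split; auto. split; auto.
  set (a1 := (fst (g h) - fst q) / h) in *. set (a2 := (snd (g h) - snd q) / h) in *.
  assert (F1 : fst (g h) = fst q + h * a1) by (unfold a1; field; lra).
  assert (F2 : snd (g h) = snd q + h * a2) by (unfold a2; field; lra).
  change (Rabs (a1 - v1) < e) in H1. change (Rabs (a2 - v2) < e) in H2.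
  apply sqrt_lt_1_alt. split; [apply dot_ge0|].
  assert (G1 : fst q * (a1 - v1) <= Rabs (fst q) * e).
  { eapply Rle_trans; [apply Rle_abs|]. rewrite Rabs_mult. apply Rmult_le_compat_l; [apply Rabs_pos|lra]. }
  assert (G2 : snd q * (a2 - v2) <= Rabs (snd q) * e).
  { eapply Rle_trans; [apply Rle_abs|]. rewrite Rabs_mult. apply Rmult_le_compat_l; [apply Rabs_pos|lra]. }
  assert (EB : B * e = D / 2) by (unfold e; field; lra).
  assert (G3 : a1 ^ 2 + a2 ^ 2 < C).
  { assert (Ha : forall a v, Rabs (a - v) < e -> a ^ 2 <= (Rabs v + e) ^ 2).
    { intros a v Hav. rewrite <- (pow2_abs a). apply pow_incr. split; [apply Rabs_pos|].
      pose proof (Rabs_triang (a - v) v). replace (a - v + v) with a in H3 by ring. lra. }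
    pose proof (Ha a1 v1 H1). pose proof (Ha a2 v2 H2). unfold C. lra. }
  unfold dot. rewrite F1, F2. unfold D, dot in *; simpl in *.
  assert (K1 : fst q * a1 + snd q * a2 <= - D / 2).
  { unfold D, dot in *; simpl in *. unfold B in EB. nra. }
  assert (K2 : h * (a1 ^ 2 + a2 ^ 2) < D).
  { apply Rle_lt_trans with (h * C); [apply Rmult_le_compat_l; lra|]. unfold D, dot in *; simpl in *; lra. }
  assert (K3 : h * (2 * (fst q * a1 + snd q * a2) + h * (a1 ^ 2 + a2 ^ 2)) < 0).
  { assert (0 < h * - (2 * (fst q * a1 + snd q * a2) + h * (a1 ^ 2 + a2 ^ 2))); [|lra].
    apply Rmult_lt_0_compat; lra. }
  nra.
Qed.

Section Ray.
Context (g : R -> pt) (q : pt) (t0 : R) (Ht0 : 0 < t0) (Eg : g 0 = q) (Hin : enorm (g t0) < enorm q)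
  (Hray : forall s t, 0 <= s -> 0 <= t -> dr m (g s) (g t) = Rabs (t - s)).

Lemma ray_far T : 0 <= T -> T - enorm q <= enorm (g T).
Proof.
  intros HT. pose proof (Hray 0 T ltac:(lra) HT) as H. rewrite Eg, Rminus_0_r, Rabs_pos_eq in H by auto.
  pose proof (dr_triangle m Hm q origin (g T)) as H1. rewrite (dr_sym m Hm origin), !dr_origin in H1. lra.
Qed.

Lemma ray_dr T : 0 <= T -> dr m q (g T) = T.
Proof.
  intros HT. pose proof (Hray 0 T ltac:(lra) HT) as H. rewrite Eg, Rminus_0_r, Rabs_pos_eq in H by auto. exact H.
Qed.

(** The ray is not known to be a C^1 curve. It is replaced by an almost shortest curve through
    [g t0], whose minimal radius is therefore at most that of [g t0]. *)
Lemma ray_curve T e : t0 <= T -> 0 < e -> exists c, C1_curve c /\ c 0 = q /\ c 1 = g T /\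
  c (/ 2) = g t0 /\ RInt (speed m c) 0 1 <= T + e.
Proof.
  intros HT He.
  destruct (dr_approx m Hm q (g t0) (e / 2) ltac:(lra)) as [c1 [A1 [A2 [A3 A4]]]].
  destruct (dr_approx m Hm (g t0) (g T) (e / 2) ltac:(lra)) as [c2 [B1 [B2 [B3 B4]]]].
  destruct (concat m Hm c1 c2 A1 B1) as [c [C1 [C2 [C3 [C4 C5]]]]]; [congruence|].
  exists c. rewrite C2, C3, C4, C5, A2, A3, B3. repeat (split; auto).
  rewrite ray_dr in A4 by lra. rewrite Hray in B4 by lra. rewrite Rabs_pos_eq in B4 by lra. lra.
Qed.

(** An inward ray makes a radial detour of at least [2 (R0 - R1)]. If the integral [J] of 1/m^2
    between the end radii were large, the end point could be reached with increasing radius, the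
    angle [a <= PI] being spread over all radii, at an extra cost of at most [a^2 / (2 J)]. *)
Lemma ray_fin_invsq : fin_invsq m.
Proof.
  set (R0 := enorm q). set (R1 := enorm (g t0)). fold R0 R1 in Hin.
  assert (HR1 : 0 <= R1) by apply enorm_ge0.
  assert (Hq : q <> origin).
  { intros E. unfold R0 in Hin. rewrite E in Hin. unfold enorm at 1, origin, dot in Hin; simpl in Hin.
    rewrite Rmult_0_l, Rplus_0_l, sqrt_0 in Hin. lra. }
  destruct (polar_repr q Hq) as [p Hp]. fold R0 in Hp.
  set (B := PI ^ 2 / (4 * (R0 - R1))).
  assert (Hjc : forall t, 0 < t -> continuous (invsq m) t) by (intros; now apply invsq_cont).
  assert (Hmain : forall y, R0 < y -> RInt (invsq m) R0 y <= B).
  { intros y Hy. set (T := Rmax t0 (y + R0)). pose proof (Rmax_l t0 (y + R0)) as T1.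
    pose proof (Rmax_r t0 (y + R0)) as T2. fold T in T1, T2.
    pose proof (ray_far T ltac:(lra)) as Hfar. fold R0 in Hfar. set (r := enorm (g T)) in *.
    set (J := RInt (invsq m) R0 r).
    assert (HyJ : RInt (invsq m) R0 y <= J).
    { unfold J. rewrite (RInt_Chasles_cont _ R0 y r) by (try lra; intros; apply Hjc; lra).
      pose proof (RInt_pos (invsq m) y r ltac:(lra) ltac:(intros; apply Hjc; lra)
        ltac:(intros; apply Rlt_le, invsq_pos; auto; lra)). lra. }
    assert (HJ0 : 0 < RInt (invsq m) R0 y).
    { apply RInt_gt_0; auto; [intros; apply invsq_pos; auto; lra|].
      intros; apply Hjc; lra. }
    assert (Hn : g T <> origin).
    { intros E. unfold r in Hfar. rewrite E in Hfar. unfold enorm at 1, origin, dot in Hfar; simpl in Hfar.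
      rewrite Rmult_0_l, Rplus_0_l, sqrt_0 in Hfar. lra. }
    destruct (polar_repr_from (g T) p Hn) as [a [e [Ha [He Hg]]]]. fold r in Hg.
    assert (Hup : T <= r - R0 + a ^ 2 / (2 * J)).
    { rewrite <- (ray_dr T) by lra. rewrite Hp, Hg.
      (* For a given total angle, an angular speed proportional to 1/m^2 minimizes the integral of
         m^2 om^2 / 2, which bounds the extra length. *)
      set (om := fun x => e * a / J * invsq m x).
      assert (Hoc : forall x, 0 < x -> continuous om x).
      { intros x Hx. apply (cont_mult (fun _ => e * a / J)); [apply continuous_const|auto]. }
      assert (Eom : RInt om R0 r = e * a).
      { unfold om. rewrite RInt_scal_cont by (try lra; intros; apply Hjc; lra). fold J. fieldR. lra. }
      pose proof (dr_graph m Hm om R0 r p ltac:(lra) ltac:(intros; apply Hoc; lra)) as HG.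
      rewrite Eom in HG. eapply Rle_trans; [exact HG|].
      assert (E2 : RInt (fun x => 1 + a ^ 2 / (2 * J ^ 2) * invsq m x) R0 r = r - R0 + a ^ 2 / (2 * J)).
      { rewrite (RInt_plus_cont (fun _ => 1)); [|lra|intros; apply continuous_const|].
        - rewrite RInt_const_R, RInt_scal_cont by (try lra; intros; apply Hjc; lra). fold J. fieldR. lra.
        - intros. apply (cont_mult (fun _ => a ^ 2 / (2 * J ^ 2))); [apply continuous_const|apply Hjc; lra]. }
      rewrite <- E2. apply RInt_le_cont; [lra| | |].
      - intros x Hx. pose proof (profile_cont m Hm x). pose proof (Hoc x ltac:(lra)). cont.
      - intros x Hx. apply (cont_plus (fun _ => 1)); [apply continuous_const|].
        apply (cont_mult (fun _ => a ^ 2 / (2 * J ^ 2))); [apply continuous_const|apply Hjc; lra].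
      - intros x Hx. pose proof (profile_pos m Hm x ltac:(lra)) as Hmx.
        set (z := a ^ 2 / (2 * J ^ 2) * invsq m x).
        assert (Hz : 0 <= z).
        { unfold z. apply Rmult_le_pos; [|apply Rlt_le, invsq_pos; auto; lra].
          apply Rdiv_le_0_compat; [apply pow2_ge_0|]. assert (0 < J * J) by (apply Rmult_lt_0_compat; lra). simpl; lra. }
        assert (Ez : m x ^ 2 * om x ^ 2 = 2 * z).
        { unfold om, z, invsq. destruct He as [-> | ->]; field; lra. }
        rewrite Ez. rewrite <- (sqrt_pow2 (1 + z)) by lra. apply sqrt_le_1_alt. nra. }
    pose proof (ray_dr t0 ltac:(lra)) as D1. pose proof (Hray t0 T ltac:(lra) ltac:(lra)) as D2.
    rewrite Rabs_pos_eq in D2 by lra.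
    pose proof (dr_radial m Hm q (g t0)) as E1. pose proof (dr_radial m Hm (g t0) (g T)) as E2.
    fold R0 R1 in E1. fold R1 r in E2. rewrite D1 in E1. rewrite D2 in E2.
    pose proof (Rle_abs (- (R1 - R0))) as F1. rewrite Rabs_Ropp in F1. pose proof (Rle_abs (r - R1)) as F2.
    assert (HH : 2 * (R0 - R1) <= a ^ 2 / (2 * J)) by lra.
    eapply Rle_trans; [exact HyJ|]. unfold B. apply le_div; [lra|].
    assert (2 * (R0 - R1) * (2 * J) <= a ^ 2).
    { apply (Rmult_le_compat_r (2 * J)) in HH; [|lra].
      replace (a ^ 2 / (2 * J) * (2 * J)) with (a ^ 2) in HH by (field; lra). exact HH. }
    assert (a ^ 2 <= PI ^ 2) by (apply pow_incr; lra). lra. }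
  set (z := Rmax 1 R0). pose proof (Rmax_l 1 R0) as Z1. pose proof (Rmax_r 1 R0) as Z2. fold z in Z1, Z2.
  exists (RInt (invsq m) 1 z + B). intros y Hy.
  set (w := Rmax y (z + 1)). pose proof (Rmax_l y (z + 1)) as W1. pose proof (Rmax_r y (z + 1)) as W2. fold w in W1, W2.
  pose proof (Hmain w ltac:(lra)) as H1.
  assert (HC : forall a b c, 0 < a <= b -> b <= c -> RInt (invsq m) a c = RInt (invsq m) a b + RInt (invsq m) b c /\
     0 <= RInt (invsq m) a b /\ 0 <= RInt (invsq m) b c).
  { intros a b c Hab Hbc. split; [apply RInt_Chasles_cont; try lra; intros; apply Hjc; lra|].
    split; apply RInt_pos; try lra; intros; try (apply Hjc; lra); apply Rlt_le, invsq_pos; auto; lra. }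
  destruct (HC 1 y w ltac:(lra) ltac:(lra)) as [A1 [A2 A3]].
  destruct (HC 1 z w ltac:(lra) ltac:(lra)) as [B1 [B2 B3]].
  destruct (HC R0 z w ltac:(lra) ltac:(lra)) as [C1 [C2 C3]]. lra.
Qed.

End Ray.

Context (Hvm : forall r1 r2, 0 < r1 -> r1 <= r2 -> Gm m r2 <= Gm m r1).

Lemma m2_eq x : 0 < x -> Derive_n m 2 x = - Gm m x * m x.
Proof. intros Hx. pose proof (profile_pos m Hm x Hx). unfold Gm. field. lra. Qed.

Lemma bounded_not_fin a B : 0 < a -> fin_invsq m -> (forall t, a <= t -> m t <= B) -> False.
Proof.
  intros Ha [K HK] HB.
  set (b := Rmax a 1). pose proof (Rmax_l a 1) as B1. pose proof (Rmax_r a 1) as B2. fold b in B1, B2.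
  assert (HBp : 0 < B) by (pose proof (HB a ltac:(lra)); pose proof (profile_pos m Hm a Ha); lra).
  assert (Hi : 0 < / B ^ 2) by (apply Rinv_0_lt_compat, pow_lt; auto).
  assert (HK0 : 0 <= K) by (specialize (HK 1 ltac:(lra)); rewrite RInt_point in HK; exact HK).
  set (y := b + (K + 1) * B ^ 2).
  assert (Hy : b <= y) by (unfold y; assert (0 < (K + 1) * B ^ 2) by (apply Rmult_lt_0_compat; [lra|apply pow_lt; auto]); lra).
  specialize (HK y ltac:(lra)).
  assert (Hjc : forall t, 0 < t -> continuous (invsq m) t) by (intros; now apply invsq_cont).
  rewrite (RInt_Chasles_cont _ 1 b y) in HK by (try lra; intros; apply Hjc; lra).
  pose proof (RInt_pos (invsq m) 1 b ltac:(lra) ltac:(intros; apply Hjc; lra)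
    ltac:(intros; apply Rlt_le, invsq_pos; auto; lra)).
  assert (RInt (fun _ => / B ^ 2) b y <= RInt (invsq m) b y).
  { apply RInt_le_cont; auto; [intros; apply continuous_const|intros; apply Hjc; lra|].
    intros t Ht. unfold invsq. pose proof (profile_pos m Hm t ltac:(lra)). specialize (HB t ltac:(lra)).
    apply Rinv_le_contravar; [apply pow_lt; auto|apply pow_incr; lra]. }
  rewrite RInt_const_R in H0. unfold y in H0.
  replace (/ B ^ 2 * (b + (K + 1) * B ^ 2 - b)) with (K + 1) in H0 by (field; lra).
  unfold y in HK. lra.
Qed.

(** If the curvature is negative at [a], it stays negative and [m] is convex from there on: it grows
    at least linearly once its slope is positive, and is bounded otherwise. If the curvature is
    nonnegative throughout, [m] is concave and positive, hence nondecreasing. A bounded [m] is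
    excluded because 1/m^2 is integrable. *)
Lemma unbounded_of_fin : fin_invsq m -> unbounded m.
Proof.
  intros HJ.
  assert (Dm : forall x, is_derive m x (Derive m x)) by (intros; now apply profile_derive).
  assert (D2 : forall x, is_derive (Derive m) x (Derive_n m 2 x)) by (intros; now apply profile_derive2).
  destruct (classic (exists a, 0 < a /\ Gm m a < 0)) as [[a [Ha HG]]|HG].
  - assert (Hinc : forall s t, a <= s <= t -> Derive m s <= Derive m t).
    { intros s t Hst. apply (mono_of_deriv (Derive m) (Derive_n m 2)); [lra|auto|].
      intros x Hx. rewrite m2_eq by lra. pose proof (Hvm a x Ha ltac:(lra)).
      pose proof (profile_pos m Hm x ltac:(lra)). nra. }
    destruct (classic (exists b, a <= b /\ 0 < Derive m b)) as [[b [Hb HD]]|HD].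
    + intros B. set (d := Derive m b) in *.
      exists (b + Rabs B / d). split.
      { assert (0 <= Rabs B / d) by (apply Rdiv_le_0_compat; [apply Rabs_pos|auto]). lra. }
      intros x Hx. assert (H0 : 0 <= Rabs B / d) by (apply Rdiv_le_0_compat; [apply Rabs_pos|auto]).
      assert (m b - d * b <= m x - d * x).
      { apply (mono_of_deriv (fun t => m t - d * t) (fun t => Derive m t - d)); [lra| |].
        - intros t _. apply (is_derive_minus m (fun t => d * t)); [auto|auto_derive; auto; ring].
        - intros t Ht. specialize (Hinc b t ltac:(lra)). unfold d. lra. }
      pose proof (profile_pos m Hm b ltac:(lra)). pose proof (Rle_abs B).
      assert (Rabs B <= d * (x - b)).
      { apply Rle_trans with (d * (Rabs B / d)); [apply Req_le; field; lra|].
        apply Rmult_le_compat_l; lra. }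
      lra.
    + exfalso. apply (bounded_not_fin a (m a) Ha HJ). intros t Ht.
      assert (- m a <= - m t); [|lra].
      apply (mono_of_deriv (fun t => - m t) (fun t => - Derive m t)); auto.
      * intros; now apply (is_derive_opp m).
      * intros x Hx. apply Rnot_lt_le. intros Hl. apply HD. exists x. lra.
  - assert (HG' : forall a, 0 < a -> 0 <= Gm m a).
    { intros a Ha. apply Rnot_lt_le. intros Hl. apply HG. eauto. }
    assert (Hdec : forall s t, 0 < s <= t -> Derive m t <= Derive m s).
    { intros s t Hst. assert (- Derive m s <= - Derive m t); [|lra].
      apply (mono_of_deriv (fun t => - Derive m t) (fun t => - Derive_n m 2 t)); [lra| |].
      - intros; now apply (is_derive_opp (Derive m)).
      - intros x Hx. rewrite m2_eq by lra. specialize (HG' x ltac:(lra)).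
        pose proof (profile_pos m Hm x ltac:(lra)). nra. }
    assert (Hnn : forall a, 0 < a -> 0 <= Derive m a).
    { intros a Ha. apply Rnot_lt_le. intros Hl. set (d := Derive m a) in *.
      (* [x] is the zero of the tangent at [a]; a concave [m] would not be positive there. *)
      set (x := a + m a / - d). pose proof (profile_pos m Hm a Ha) as Hma.
      assert (Hx : a < x) by (unfold x; assert (0 < m a / - d) by (apply Rdiv_lt_0_compat; lra); lra).
      assert (d * a - m a <= d * x - m x).
      { apply (mono_of_deriv (fun t => d * t - m t) (fun t => d - Derive m t)); [lra| |].
        - intros t _. apply (is_derive_minus (fun t => d * t) m); [auto_derive; auto; ring|auto].
        - intros t Ht. specialize (Hdec a t ltac:(lra)). unfold d. lra. }
      pose proof (profile_pos m Hm x ltac:(lra)).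
      assert (d * (x - a) = - m a) by (unfold x; field; lra). lra. }
    assert (Hmono : forall s t, 0 < s <= t -> m s <= m t).
    { intros s t Hst. apply (mono_of_deriv m (Derive m)); [lra|auto|]. intros; apply Hnn; lra. }
    intros B. destruct (classic (exists a, 0 < a /\ B <= m a)) as [[a [Ha HB]]|HB].
    + exists a. split; auto. intros x Hx. specialize (Hmono a x ltac:(lra)). lra.
    + exfalso. apply (bounded_not_fin 1 B ltac:(lra) HJ). intros t Ht.
      apply Rnot_lt_le. intros Hl. apply HB. exists t. lra.
Qed.

End FromRay.

(** * Sturm comparison *)

Section Compare.
Context (m : R -> R) (Hm : profile m)
  (Hvm : forall r1 r2, 0 < r1 -> r1 <= r2 -> Gm m r2 <= Gm m r1).

Lemma profile_odd x : m (- x) = - m x.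
Proof. apply Hm. Qed.

Lemma Derive_even x : Derive m (- x) = Derive m x.
Proof.
  assert (H1 : is_derive (fun t => - m (- t)) x (Derive m (- x))).
  { replace (Derive m (- x)) with (- (-1 * Derive m (- x))) by ring.
    apply (is_derive_opp (fun t => m (- t))).
    apply (is_derive_comp m (fun t => - t)); [now apply profile_derive|auto_derive; auto; ring]. }
  rewrite <- (is_derive_unique _ _ _ H1). apply Derive_ext. intros t. rewrite profile_odd. ring.
Qed.

(** Primitive of [m]: along any geodesic [u = fm r] satisfies [u'' = m' (r)], and the
    von Mangoldt condition says that [m' (r)] is a convex function of [u]. *)
Definition fm (x : R) : R := RInt m 0 x.

Lemma fm_derive x : is_derive fm x (m x).
Proof. apply is_derive_RInt_cont. intros; now apply profile_cont. Qed.

Lemma fm_even x : fm (- x) = fm x.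
Proof.
  assert (E0 : fm 0 = 0) by (unfold fm; now rewrite RInt_point).
  assert (Hd : forall t, is_derive (fun t => fm (- t) - fm t) t 0).
  { intros t. replace 0 with (-1 * m (- t) - m t) by (rewrite profile_odd; ring).
    apply (is_derive_minus (fun t => fm (- t)) fm); [|apply fm_derive].
    apply (is_derive_comp fm (fun t => - t)); [apply fm_derive|auto_derive; auto; ring]. }
  assert (H : forall a b, a <= b -> fm (- a) - fm a = fm (- b) - fm b).
  { intros a b Hab. apply Rle_antisym.
    - apply (mono_of_deriv (fun t => fm (- t) - fm t) (fun _ => 0)); auto. intros; lra.
    - assert (- (fm (- a) - fm a) <= - (fm (- b) - fm b)); [|lra].
      apply (mono_of_deriv (fun t => - (fm (- t) - fm t)) (fun _ => 0)); auto; [|intros; lra].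
      intros t _. rewrite <- Ropp_0. apply (is_derive_opp (fun t => fm (- t) - fm t)). auto. }
  destruct (Rle_dec 0 x) as [Hx|Hx].
  - specialize (H 0 x Hx). rewrite Ropp_0 in H. lra.
  - specialize (H x 0 ltac:(lra)). rewrite Ropp_0 in H. lra.
Qed.

Lemma fm_incr a b : 0 <= a < b -> fm a < fm b.
Proof.
  intros Hab. unfold fm.
  assert (H : 0 < RInt m a b).
  { apply RInt_gt_0; [lra| |].
    - intros; apply profile_pos; auto; lra.
    - intros; now apply profile_cont. }
  rewrite (RInt_Chasles_cont m 0 a b) by (try lra; intros; now apply profile_cont). lra.
Qed.

Lemma fm_abs x : fm (Rabs x) = fm x.
Proof. unfold Rabs. destruct Rcase_abs; auto. apply fm_even. Qed.

Lemma Derive_abs x : Derive m (Rabs x) = Derive m x.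
Proof. unfold Rabs. destruct Rcase_abs; auto. apply Derive_even. Qed.

Lemma m2_zero : Derive_n m 2 0 = 0.
Proof.
  pose proof (profile_derive2 m Hm 0) as H.
  assert (H1 : is_derive (fun t => Derive m (- t)) 0 (-1 * Derive_n m 2 0)).
  { apply (is_derive_comp (Derive m) (fun t => - t)); [rewrite Ropp_0; exact H|auto_derive; auto; ring]. }
  apply is_derive_unique in H. apply is_derive_unique in H1.
  rewrite (Derive_ext _ (Derive m)) in H1 by (intros; apply Derive_even).
  rewrite H in H1. lra.
Qed.

Lemma convex_left r1 r2 : 0 <= r1 <= r2 -> 0 < r2 ->
  Derive m r2 - Derive m r1 <= - Gm m r2 * (fm r2 - fm r1).
Proof.
  intros H12 H2. set (G := Gm m r2).
  assert (- Derive m r1 - G * fm r1 <= - Derive m r2 - G * fm r2); [|lra].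
  apply (mono_of_deriv (fun t => - Derive m t - G * fm t) (fun t => - Derive_n m 2 t - G * m t)); [lra| |].
  - intros t _. apply (is_derive_minus (fun t => - Derive m t) (fun t => G * fm t)).
    + apply (is_derive_opp (Derive m)). now apply profile_derive2.
    + apply (is_derive_scal fm). apply fm_derive.
  - intros t Ht. destruct (Rle_lt_or_eq_dec 0 t ltac:(lra)) as [Hp|<-].
    + rewrite m2_eq by auto. pose proof (Hvm t r2 Hp ltac:(lra)). fold G in H.
      pose proof (profile_pos m Hm t Hp). nra.
    + rewrite m2_zero, (profile_0 m Hm). lra.
Qed.

Lemma convex_right r2 r3 : 0 < r2 <= r3 -> - Gm m r2 * (fm r3 - fm r2) <= Derive m r3 - Derive m r2.
Proof.
  intros H23. set (G := Gm m r2).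
  assert (Derive m r2 + G * fm r2 <= Derive m r3 + G * fm r3); [|lra].
  apply (mono_of_deriv (fun t => Derive m t + G * fm t) (fun t => Derive_n m 2 t + G * m t)); [lra| |].
  - intros t _. apply (is_derive_plus (Derive m) (fun t => G * fm t)).
    + now apply profile_derive2.
    + apply (is_derive_scal fm). apply fm_derive.
  - intros t Ht. rewrite m2_eq by (auto; lra). pose proof (Hvm r2 t ltac:(lra) ltac:(lra)). fold G in H.
    pose proof (profile_pos m Hm t ltac:(lra)).
    assert (0 <= (G - Gm m t) * m t) by (apply Rmult_le_pos; lra). lra.
Qed.

(** If [Derive m] were positive at [r2], its tangent there as a function of [fm] would, whatever the
    sign of the slope, be positive at one of the ends. *)
Lemma Derive_quasiconvex r1 r2 r3 : 0 < r1 <= r2 -> r2 <= r3 -> Derive m r1 <= 0 -> Derive m r3 <= 0 ->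
  Derive m r2 <= 0.
Proof.
  intros H12 H23 D1 D3. apply Rnot_lt_le. intros Hl.
  pose proof (convex_left r1 r2 ltac:(lra) ltac:(lra)) as L1.
  pose proof (convex_right r2 r3 ltac:(lra)) as L2.
  assert (F1 : fm r1 <= fm r2) by (destruct (Req_dec r1 r2) as [->|]; [lra|apply Rlt_le, fm_incr; lra]).
  assert (F2 : fm r2 <= fm r3) by (destruct (Req_dec r2 r3) as [->|]; [lra|apply Rlt_le, fm_incr; lra]).
  destruct (Rle_dec 0 (Gm m r2)) as [HG|HG].
  - assert (0 <= Gm m r2 * (fm r2 - fm r1)) by (apply Rmult_le_pos; lra). lra.
  - assert (0 <= - Gm m r2 * (fm r3 - fm r2)) by (apply Rmult_le_pos; lra). lra.
Qed.

Lemma deriv_at_min (f : R -> R) (x l d : R) : is_derive f x l -> 0 < d ->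
  (forall y, Rabs (y - x) < d -> f x <= f y) -> l = 0.
Proof.
  intros Hf Hd Hmin. apply is_derive_Reals in Hf. apply NNPP. intros n.
  assert (Hl : 0 < Rabs l) by (now apply Rabs_pos_lt).
  destruct (Hf (Rabs l) Hl) as [d1 H1]. pose proof (cond_pos d1).
  set (h := Rmin (d1 / 2) (d / 2)).
  assert (Hh : 0 < h) by (apply Rmin_glb_lt; lra).
  assert (B1 : h <= d1 / 2) by apply Rmin_l. assert (B2 : h <= d / 2) by apply Rmin_r.
  pose proof (H1 h ltac:(lra) ltac:(rewrite Rabs_pos_eq; lra)) as P1.
  pose proof (H1 (- h) ltac:(lra) ltac:(rewrite Rabs_left; lra)) as P2.
  pose proof (Hmin (x + h) ltac:(replace (x + h - x) with h by ring; rewrite Rabs_pos_eq; lra)) as M1.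
  pose proof (Hmin (x + - h) ltac:(replace (x + - h - x) with (- h) by ring; rewrite Rabs_left; lra)) as M2.
  assert (Q1 : 0 <= (f (x + h) - f x) / h) by (apply Rdiv_le_0_compat; lra).
  assert (Q2 : (f (x + - h) - f x) / - h <= 0).
  { replace ((f (x + - h) - f x) / - h) with (- ((f (x + - h) - f x) / h)) by (field; lra).
    assert (0 <= (f (x + - h) - f x) / h) by (apply Rdiv_le_0_compat; lra). lra. }
  apply Rabs_def2 in P1. apply Rabs_def2 in P2.
  destruct (Rle_dec 0 l) as [H0|H0].
  - rewrite Rabs_pos_eq in P1, P2 by auto. lra.
  - rewrite Rabs_left in P1, P2 by lra. lra.
Qed.

(** Sturm comparison: writing [X], [Y] for the differences of [fm r] along the two geodesics and along
    the meridian through the origin, convexity makes [X / Y] nondecreasing. *)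
Lemma compare R0 ca cb (ra ya rb yb : R -> R) : 0 < R0 -> 0 < ca < cb -> cb < m R0 ->
  ra 0 = R0 -> rb 0 = R0 -> ya 0 = - sqrt (m R0 ^ 2 - ca ^ 2) -> yb 0 = - sqrt (m R0 ^ 2 - cb ^ 2) ->
  (forall t, 0 < ra t) -> (forall t, 0 < rb t) ->
  (forall t, is_derive ra t (ya t / m (ra t))) -> (forall t, is_derive rb t (yb t / m (rb t))) ->
  (forall t, is_derive ya t (Derive m (ra t))) -> (forall t, is_derive yb t (Derive m (rb t))) ->
  (forall t, ya t ^ 2 = m (ra t) ^ 2 - ca ^ 2) ->
  (forall t, 0 <= t -> t - R0 <= ra t) ->
  forall t, 0 <= t -> ra t <= rb t.
Proof.
  intros HR Hc HcM Ea Eb Va Vb Pa Pb Da Db Dya Dyb Sa Hfar.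
  set (X := fun t => fm (rb t) - fm (ra t)).
  set (Y := fun t => fm (ra t) - fm (R0 - t)).
  set (dX := fun t => yb t - ya t).
  set (dY := fun t => ya t + m (R0 - t)).
  assert (Ma : forall t, 0 < m (ra t)) by (intros; apply profile_pos; auto).
  assert (Mb : forall t, 0 < m (rb t)) by (intros; apply profile_pos; auto).
  assert (Dfa : forall t, is_derive (fun t => fm (ra t)) t (ya t)).
  { intros t. replace (ya t) with (ya t / m (ra t) * m (ra t)) by (field; specialize (Ma t); lra).
    apply (is_derive_comp fm ra); [apply fm_derive|apply Da]. }
  assert (Dfb : forall t, is_derive (fun t => fm (rb t)) t (yb t)).
  { intros t. replace (yb t) with (yb t / m (rb t) * m (rb t)) by (field; specialize (Mb t); lra).
    apply (is_derive_comp fm rb); [apply fm_derive|apply Db]. }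
  assert (DX : forall t, is_derive X t (dX t)) by (intros; apply (is_derive_minus (fun t => fm (rb t))); auto).
  assert (DY : forall t, is_derive Y t (dY t)).
  { intros t. unfold dY. replace (ya t + m (R0 - t)) with (ya t - (-1 * m (R0 - t))) by ring.
    apply (is_derive_minus (fun t => fm (ra t))); auto.
    apply (is_derive_comp fm (fun t => R0 - t)); [apply fm_derive|auto_derive; auto; ring]. }
  assert (DdX : forall t, is_derive dX t (Derive m (rb t) - Derive m (ra t)))
    by (intros; apply (is_derive_minus yb ya); auto).
  assert (DdY : forall t, is_derive dY t (Derive m (ra t) - Derive m (R0 - t))).
  { intros t. replace (Derive m (ra t) - Derive m (R0 - t)) with (Derive m (ra t) + (-1 * Derive m (R0 - t))) by ring.
    apply (is_derive_plus ya (fun t => m (R0 - t))); auto.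
    apply (is_derive_comp m (fun t => R0 - t)); [now apply profile_derive|auto_derive; auto; ring]. }
  (* The radius is at least [R0 - t] because the radial speed is at least -1, and at least [t - R0]
     by [Hfar]. Behind the origin the meridian is represented by the negative number [R0 - t], which
     is harmless since [fm] and [Derive m] are even. *)
  assert (Hge : forall t, 0 <= t -> Rabs (R0 - t) <= ra t).
  { intros t Ht. specialize (Hfar t Ht).
    assert (H : ra 0 + 0 <= ra t + t).
    { apply (mono_of_deriv (fun t => ra t + t) (fun t => ya t / m (ra t) + 1)); auto.
      - intros s _. apply (is_derive_plus ra (fun t => t)); auto. apply (is_derive_id (K := R_AbsRing)).
      - intros s _. specialize (Sa s). specialize (Ma s).
        assert (- m (ra s) <= ya s) by nra.
        assert (-1 <= ya s / m (ra s)) by (apply le_div; lra). lra. }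
    apply Rabs_le. lra. }
  assert (HY0 : forall t, 0 <= t -> 0 <= Y t).
  { intros t Ht. unfold Y. rewrite <- (fm_abs (R0 - t)). specialize (Hge t Ht).
    destruct (Req_dec (Rabs (R0 - t)) (ra t)) as [->|n]; [lra|].
    assert (fm (Rabs (R0 - t)) < fm (ra t)); [|lra].
    apply fm_incr. pose proof (Rabs_pos (R0 - t)). lra. }
  (* A zero of [Y] at some [t > 0] would be a minimum, so [ya t = - m (R0 - t)] and hence
     [ya t ^ 2 = m (ra t) ^ 2], against [0 < ca]. *)
  assert (HY : forall t, 0 < t -> 0 < Y t).
  { intros t Ht. destruct (Rle_lt_or_eq_dec 0 (Y t) (HY0 t ltac:(lra))) as [H|H]; auto. exfalso.
    assert (E : dY t = 0).
    { apply (deriv_at_min Y t (dY t) t); auto. intros y Hy. rewrite <- H. apply HY0.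
      apply Rabs_def2 in Hy. lra. }
    assert (Er : Rabs (R0 - t) = ra t).
    { unfold Y in H. rewrite <- (fm_abs (R0 - t)) in H. specialize (Hge t ltac:(lra)).
      apply NNPP. intros n. assert (fm (Rabs (R0 - t)) < fm (ra t)); [|lra].
      apply fm_incr. pose proof (Rabs_pos (R0 - t)). lra. }
    assert (Em : m (R0 - t) ^ 2 = m (ra t) ^ 2).
    { rewrite <- Er. unfold Rabs. destruct Rcase_abs; auto. rewrite profile_odd. ring. }
    specialize (Sa t). unfold dY in E. nra. }
  (* The Wronskian of [X] and [Y]. While both are nonnegative its derivative is too: the tangent
     line inequalities at [ra t] involve the same slope [- Gm m (ra t)], and its two contributions
     cancel. *)
  set (Wr := fun t => dX t * Y t - X t * dY t).
  assert (DWr : forall t, is_derive Wr t ((Derive m (rb t) - Derive m (ra t)) * Y t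
      - X t * (Derive m (ra t) - Derive m (R0 - t)))).
  { intros t. unfold Wr. replace (_ - X t * _) with
     ((Derive m (rb t) - Derive m (ra t)) * Y t + dX t * dY t -
      (dX t * dY t + X t * (Derive m (ra t) - Derive m (R0 - t)))) by ring.
    apply (is_derive_minus (fun t => dX t * Y t) (fun t => X t * dY t)).
    - apply (is_derive_mult dX Y); auto. intros; apply Rmult_comm.
    - apply (is_derive_mult X dY); auto. intros; apply Rmult_comm. }
  assert (X0 : X 0 = 0) by (unfold X; rewrite Ea, Eb; ring).
  assert (Y00 : Y 0 = 0) by (unfold Y; rewrite Ea, Rminus_0_r; ring).
  assert (dX0 : 0 < dX 0).
  { unfold dX. rewrite Va, Vb.
    assert (sqrt (m R0 ^ 2 - cb ^ 2) < sqrt (m R0 ^ 2 - ca ^ 2)); [|lra]. apply sqrt_lt_1_alt. nra. }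
  assert (CX : forall t, continuous X t) by (intros; eapply deriv_cont, DX).
  assert (HXle : forall t, 0 <= t -> 0 <= X t -> ra t <= rb t).
  { intros t Ht H. apply Rnot_lt_le. intros Hl.
    assert (fm (rb t) < fm (ra t)) by (apply fm_incr; specialize (Pb t); lra). unfold X in H. lra. }
  assert (Hnear : exists d, 0 < d /\ forall t, 0 < t < d -> 0 < X t).
  { pose proof (proj1 (is_derive_Reals _ _ _) (DX 0)) as D. destruct (D (dX 0) dX0) as [d Hd].
    exists d. split; [apply cond_pos|]. intros t Ht.
    specialize (Hd t ltac:(lra) ltac:(rewrite Rabs_pos_eq; lra)). rewrite Rplus_0_l, X0, Rminus_0_r in Hd.
    apply Rabs_def2 in Hd. assert (H : 0 < X t / t) by lra.
    replace (X t) with (X t / t * t) by (field; lra). apply Rmult_lt_0_compat; lra. }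
  destruct Hnear as [d [Hd1 Hd2]].
  assert (Hgrow : forall s e, 0 < e <= s -> (forall t, 0 < t <= s -> 0 < X t) -> X e / Y e <= X s / Y s).
  { intros s e He Hpos.
    assert (HW : forall t, 0 <= t <= s -> 0 <= Wr t).
    { intros t Ht. assert (E0 : Wr 0 = 0) by (unfold Wr; rewrite X0, Y00; ring). rewrite <- E0.
      apply (mono_of_deriv Wr (fun t => (Derive m (rb t) - Derive m (ra t)) * Y t
        - X t * (Derive m (ra t) - Derive m (R0 - t)))); [lra|auto|].
      intros z Hz.
      assert (HXz : 0 <= X z).
      { destruct (Rle_lt_or_eq_dec 0 z ltac:(lra)) as [H|<-]; [apply Rlt_le, Hpos; lra|lra]. }
      pose proof (HY0 z ltac:(lra)) as HYz. pose proof (HXle z ltac:(lra) HXz) as Hr.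
      pose proof (convex_right (ra z) (rb z) ltac:(split; auto)) as C1.
      pose proof (convex_left (Rabs (R0 - z)) (ra z) ltac:(split; [apply Rabs_pos|apply Hge; lra]) (Pa z)) as C2.
      rewrite fm_abs, Derive_abs in C2. fold (X z) in C1. fold (Y z) in C2.
      apply (Rmult_le_compat_r (Y z)) in C1; auto. apply (Rmult_le_compat_l (X z)) in C2; auto. lra. }
    apply (mono_of_deriv (fun t => X t / Y t) (fun t => Wr t / Y t ^ 2)); [lra| |].
    - intros t Ht. apply (is_derive_div X Y t (dX t) (dY t)); auto. specialize (HY t ltac:(lra)); lra.
    - intros t Ht. apply Rdiv_le_0_compat; [apply HW; lra|]. apply pow_lt, HY. lra. }
  (* Continuation: at the supremum [s2] of the times up to which [X] is positive, the monotone
     quotient gives [X >= k Y > 0], so positivity extends beyond [s2]. *)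
  assert (HXpos : forall s, 0 < s -> 0 < X s).
  { intros s1 Hs1. apply NNPP. intros Hn.
    set (E := fun s => 0 <= s <= s1 /\ forall t, 0 < t <= s -> 0 < X t).
    destruct (completeness E) as [s2 [U1 U2]].
    { exists s1. intros s [Hs _]. lra. }
    { exists 0. split; [lra|]. intros; lra. }
    assert (Hds1 : d <= s1).
    { apply Rnot_lt_le. intros Hl. apply Hn. apply Hd2. lra. }
    assert (HE1 : E (d / 2)) by (split; [lra|intros; apply Hd2; lra]).
    assert (Hs2 : d / 2 <= s2) by (apply U1; auto).
    assert (Hs2b : s2 <= s1) by (apply U2; intros s [Hs _]; lra).
    assert (Hpos : forall t, 0 < t < s2 -> 0 < X t).
    { intros t Ht. apply NNPP. intros Hnt.
      assert (Hub : is_upper_bound E t).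
      { intros s [Hs HsE]. apply Rnot_lt_le. intros Hl. apply Hnt, HsE. lra. }
      specialize (U2 t Hub). lra. }
    set (e := d / 2) in *. set (k := X e / Y e).
    assert (Hk : 0 < k) by (apply Rdiv_lt_0_compat; [apply Hd2; unfold e; lra|apply HY; unfold e; lra]).
    assert (Hs2pos : 0 < X s2).
    { destruct (Rle_lt_or_eq_dec e s2 Hs2) as [Hl|<-]; [|apply Hd2; unfold e; lra].
      assert (HYs : 0 < Y s2) by (apply HY; unfold e in *; lra).
      apply Rlt_le_trans with (k * Y s2); [apply Rmult_lt_0_compat; auto|].
      apply Rnot_lt_le. intros Hc'.
      assert (CG : continuous (fun t => k * Y t - X t) s2).
      { apply cont_minus; auto. apply (cont_mult (fun _ => k)); [apply continuous_const|]. eapply deriv_cont, DY. }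
      destruct (proj1 (cont_eps _ _) CG (k * Y s2 - X s2) ltac:(lra)) as [d3 [D1 D2]].
      set (s := Rmax (s2 - d3 / 2) e).
      assert (Hs : e <= s < s2 /\ s2 - d3 / 2 <= s).
      { unfold s. split; [split; [apply Rmax_r|apply Rmax_lub_lt; lra]|apply Rmax_l]. }
      specialize (D2 s ltac:(apply Rabs_def1; lra)). apply Rabs_def2 in D2.
      assert (HYs' : 0 < Y s) by (apply HY; unfold e in *; lra).
      pose proof (Hgrow s e ltac:(unfold e in *; lra) ltac:(intros; apply Hpos; lra)) as HG. fold k in HG.
      apply (Rmult_le_compat_r (Y s)) in HG; [|lra].
      replace (X s / Y s * Y s) with (X s) in HG by (field; lra). lra. }
    destruct (proj1 (cont_eps X s2) (CX s2) (X s2) Hs2pos) as [d3 [D1 D2]].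
    destruct (Rle_lt_or_eq_dec s2 s1 Hs2b) as [Hl|<-]; [|auto].
    set (s := Rmin (s2 + d3 / 2) s1).
    assert (Hs : s2 < s <= s1 /\ s <= s2 + d3 / 2).
    { unfold s. split; [split; [apply Rmin_glb_lt; lra|apply Rmin_r]|apply Rmin_l]. }
    assert (E s).
    { split; [unfold e in *; lra|]. intros t Ht. destruct (Rlt_dec t s2) as [H|H]; [apply Hpos; lra|].
      specialize (D2 t ltac:(apply Rabs_def1; lra)). apply Rabs_def2 in D2. lra. }
    specialize (U1 s H). lra. }
  intros t Ht. apply HXle; auto.
  destruct (Rle_lt_or_eq_dec 0 t Ht) as [H|<-]; [apply Rlt_le, HXpos; auto|lra].
Qed.

End Compare.

(** * The optimal Clairaut constant *)

(** The derivative of [hdef m c x] in [c]. It increases with [c], so its value at the larger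
    constant is a Lipschitz bound. *)
Definition lipc (m : R -> R) (c x : R) : R := m x / (sqrt (m x ^ 2 - c ^ 2)) ^ 3.

Lemma hdef_lip m c c' x : 0 <= c <= c' -> c' < m x ->
  hdef m c' x - hdef m c x <= (c' - c) * lipc m c' x.
Proof.
  intros Hc Hx. unfold hdef, lipc. set (M := m x) in *.
  set (s := sqrt (M ^ 2 - c ^ 2)). set (s' := sqrt (M ^ 2 - c' ^ 2)).
  assert (Hs' : 0 < s') by (apply sqrt_lt_R0; nra).
  assert (Hss : s' <= s) by (apply sqrt_le_1_alt; nra).
  assert (Es : s * s = M ^ 2 - c ^ 2) by (apply sqrt_sqrt; nra).
  assert (Es' : s' * s' = M ^ 2 - c' ^ 2) by (apply sqrt_sqrt; nra).
  assert (HM : 0 < M) by lra.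
  assert (H1 : (s - s') * s' <= (c' - c) * c').
  { assert ((s - s') * (s + s') = (c' - c) * (c' + c)) by nra. nra. }
  apply (Rmult_le_reg_r (M * s * s' ^ 3)).
  { assert (0 < s' ^ 3) by (apply pow_lt; auto). assert (0 < M * s) by (apply Rmult_lt_0_compat; lra).
    apply Rmult_lt_0_compat; auto. }
  replace ((c' / (M * s') - c / (M * s)) * (M * s * s' ^ 3)) with (((c' - c) * s + c * (s - s')) * s' ^ 2)
    by (field; lra).
  replace ((c' - c) * (M / s' ^ 3) * (M * s * s' ^ 3)) with ((c' - c) * (M ^ 2) * s) by (field; lra).
  replace (M ^ 2) with (s' ^ 2 + c' ^ 2) by (simpl; lra).
  assert (c * (s - s') * s' ^ 2 <= (c' - c) * c' ^ 2 * s).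
  { replace (c * (s - s') * s' ^ 2) with (c * s' * ((s - s') * s')) by ring.
    apply Rle_trans with (c * s' * ((c' - c) * c')).
    - apply Rmult_le_compat_l; auto. apply Rmult_le_pos; lra.
    - replace (c * s' * ((c' - c) * c')) with ((c' - c) * c' * (c * s')) by ring.
      replace ((c' - c) * c' ^ 2 * s) with ((c' - c) * c' * (c' * s)) by ring.
      apply Rmult_le_compat_l; [apply Rmult_le_pos; lra|]. apply Rmult_le_compat; lra. }
  nra.
Qed.

Lemma hdef_mono m c c' x : 0 <= c <= c' -> c' < m x -> hdef m c x <= hdef m c' x.
Proof.
  intros Hc Hx. unfold hdef. set (M := m x) in *.
  assert (Hs' : 0 < sqrt (M ^ 2 - c' ^ 2)) by (apply sqrt_lt_R0; nra).
  assert (Hss : sqrt (M ^ 2 - c' ^ 2) <= sqrt (M ^ 2 - c ^ 2)) by (apply sqrt_le_1_alt; nra).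
  apply Rmult_le_compat; try lra.
  - apply Rlt_le, Rinv_0_lt_compat, Rmult_lt_0_compat; lra.
  - apply Rinv_le_contravar; [apply Rmult_lt_0_compat; lra|]. apply Rmult_le_compat_l; lra.
Qed.

Section N.
Context (m : R -> R) (Hm : profile m) (HJ : fin_invsq m) (Hinf : unbounded m).

Lemma lipc_cont c x : 0 <= c < m x -> continuous (lipc m c) x.
Proof.
  intros Hc. pose proof (profile_cont m Hm x). unfold lipc.
  assert (0 < sqrt (m x ^ 2 - c ^ 2)) by (apply sqrt_lt_R0; nra).
  apply (cont_div m (fun x => sqrt (m x ^ 2 - c ^ 2) ^ 3)); auto; [cont|apply pow_nonzero; lra].
Qed.

Lemma lipc_ge0 c x : 0 <= c < m x -> 0 <= lipc m c x.
Proof.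
  intros Hc. unfold lipc. assert (0 < sqrt (m x ^ 2 - c ^ 2)) by (apply sqrt_lt_R0; nra).
  apply Rdiv_le_0_compat; [lra|apply pow_lt; auto].
Qed.

Lemma has_tail_lipc c x : 0 <= c -> 0 < x -> (forall t, x <= t -> c < m t) -> has_tail (lipc m c) x.
Proof.
  intros Hc Hx H. destruct (Hinf (2 * c)) as [A [HA1 HA2]].
  apply (has_tail_dom m Hm HJ _ x 8 A); auto.
  - intros; apply lipc_cont; split; auto.
  - intros; apply lipc_ge0; auto.
  - intros t Ht1 Ht2. specialize (HA2 t Ht1). specialize (H t Ht2). unfold lipc, invsq.
    assert (Hs : m t / 2 <= sqrt (m t ^ 2 - c ^ 2)).
    { rewrite <- (sqrt_pow2 (m t / 2)) by lra. apply sqrt_le_1_alt. nra. }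
    apply div_le; [apply pow_lt; lra|].
    apply Rle_trans with (8 * / m t ^ 2 * (m t / 2) ^ 3); [apply Req_le; field; lra|].
    apply Rmult_le_compat_l; [|apply pow_incr; lra].
    assert (0 < / m t ^ 2) by (apply Rinv_0_lt_compat, pow_lt; lra). lra.
Qed.

Lemma tail_hdef_lip c c' x : 0 <= c <= c' -> 0 < x -> (forall t, x <= t -> c' < m t) ->
  tail (hdef m c') x <= tail (hdef m c) x + (c' - c) * tail (lipc m c') x.
Proof.
  intros Hc Hx H.
  assert (H' : forall t, x <= t -> c < m t) by (intros t Ht; specialize (H t Ht); lra).
  pose proof (has_tail_hdef m Hm HJ Hinf c x ltac:(lra) Hx H') as T1.
  pose proof (has_tail_hdef m Hm HJ Hinf c' x ltac:(lra) Hx H) as T2.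
  pose proof (has_tail_lipc c' x ltac:(lra) Hx H) as T3.
  destruct (has_tail_lin _ _ (c' - c) x T1 T3 ltac:(lra)) as [T4 <-].
  apply tail_mono; auto. intros t Ht. pose proof (hdef_lip m c c' t Hc (H t Ht)). lra.
Qed.

Lemma tail_hdef_mono c c' x : 0 <= c <= c' -> 0 < x -> (forall t, x <= t -> c' < m t) ->
  tail (hdef m c) x <= tail (hdef m c') x.
Proof.
  intros Hc Hx H.
  assert (H' : forall t, x <= t -> c < m t) by (intros t Ht; specialize (H t Ht); lra).
  apply tail_mono; try (apply has_tail_hdef; auto; lra).
  intros t Ht. apply hdef_mono; auto.
Qed.

Section Max.
Context (R0 phi c2 : R) (HR : 0 < R0) (Hphi : 0 <= phi) (Hc2 : 0 <= c2 <= cstar m R0)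
  (Hmax : forall c, 0 <= c <= cstar m R0 -> Phi m phi R0 c R0 <= Phi m phi R0 c2 R0).

(** The maximized function of [c] is concave with derivative [phi] minus the tail of [hdef], which
    cannot be negative before the maximum. Constants below [c2] are used because at [c2] itself
    [hdef] may be singular. *)
Lemma max_left c x y : 0 <= c < c2 -> R0 <= x <= y -> RInt (hdef m c) x y <= phi.
Proof.
  intros Hc Hxy. pose proof (Hmax c ltac:(lra)) as H. unfold Phi in H.
  assert (Hge : forall t, R0 <= t -> c2 <= m t).
  { intros t Ht. pose proof (cstar_le m Hm Hinf R0 t ltac:(lra)). lra. }
  assert (H1 : W m c R0 + (c2 - c) * tail (hdef m c) R0 <= W m c2 R0).
  { apply W_subgrad_up; auto; [lra|]. intros t Ht. specialize (Hge t Ht). lra. }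
  assert (HT : has_tail (hdef m c) R0).
  { apply has_tail_hdef; auto; [lra|]. intros t Ht. specialize (Hge t Ht). lra. }
  assert (H2 : tail (hdef m c) R0 <= phi).
  { apply Rnot_lt_le. intros Hl. nra. }
  eapply Rle_trans; [|exact H2].
  eapply Rle_trans; [|apply (RInt_le_tail _ _ HT y); lra].
  rewrite (RInt_Chasles_cont _ R0 x y); [|lra|intros; apply HT; lra].
  pose proof (RInt_pos (hdef m c) R0 x ltac:(lra) ltac:(intros; apply HT; lra) ltac:(intros; apply HT; lra)). lra.
Qed.

(** Near a critical point of [m] at level [c2], the angles swept by constants just below [c2] exceed
    every bound by [hdef_diverges], against [max_left]. *)
Lemma max_no_critical t : R0 <= t -> 0 < c2 -> m t = c2 -> Derive m t <> 0.
Proof.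
  intros Ht Hp Et D0.
  destruct (hdef_diverges m Hm t phi ltac:(lra) D0) as [eta [d [He [Hd HD]]]].
  set (c := Rmax (c2 - d) (c2 / 2)).
  assert (Hc : c2 - d <= c /\ c2 / 2 <= c /\ c < c2).
  { unfold c. split; [apply Rmax_l|split; [apply Rmax_r|apply Rmax_lub_lt; lra]]. }
  rewrite Et in HD. specialize (HD c ltac:(lra) ltac:(lra)).
  assert (phi < RInt (hdef m c) (t + eta) (t + 1)).
  { apply HD. intros s Hs. pose proof (cstar_le m Hm Hinf R0 s ltac:(lra)). lra. }
  pose proof (max_left c (t + eta) (t + 1) ltac:(lra) ltac:(lra)). lra.
Qed.

(** A contact with level [c2] beyond [R0] would be a local minimum of [m], hence a critical
    point. *)
Lemma max_gt t : R0 < t -> c2 < m t.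
Proof.
  intros Ht. pose proof (cstar_le m Hm Hinf R0 t ltac:(lra)) as H.
  destruct (Rle_lt_or_eq_dec c2 (m t) ltac:(lra)) as [|E]; auto. exfalso.
  destruct (Rle_lt_or_eq_dec 0 c2 ltac:(lra)) as [Hp|E0].
  - apply (max_no_critical t ltac:(lra) Hp (eq_sym E)).
    apply (deriv_at_min m t _ (t - R0)); [now apply profile_derive|lra|].
    intros y Hy. apply Rabs_def2 in Hy. pose proof (cstar_le m Hm Hinf R0 y ltac:(lra)). lra.
  - pose proof (profile_pos m Hm t ltac:(lra)). lra.
Qed.

Lemma max_Derive : 0 < c2 -> c2 = m R0 -> 0 < Derive m R0.
Proof.
  intros Hp E. assert (Hgt : forall t, R0 < t -> m R0 < m t) by (intros; rewrite <- E; now apply max_gt).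
  pose proof (Derive_ge0_of_gt m Hm R0 Hgt).
  pose proof (max_no_critical R0 ltac:(lra) Hp (eq_sym E)). lra.
Qed.

Lemma max_turn_le x y : R0 <= x <= y -> c2 < m x -> RInt (hdef m c2) x y <= phi.
Proof.
  intros Hxy Hx.
  assert (Hgt : forall t, x <= t <= y -> c2 < m t).
  { intros t Ht. destruct (Req_dec t x) as [->|]; auto. apply max_gt; lra. }
  destruct (Rle_lt_or_eq_dec 0 c2 ltac:(lra)) as [Hp|E0].
  - assert (Cl : forall t, x <= t <= y -> continuous (lipc m c2) t).
    { intros t Ht. apply lipc_cont. specialize (Hgt t Ht). lra. }
    assert (Ch : forall c t, 0 <= c <= c2 -> x <= t <= y -> continuous (hdef m c) t).
    { intros c t Hc Ht. apply hdef_cont; auto; [|lra]. specialize (Hgt t Ht). lra. }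
    set (C := RInt (lipc m c2) x y).
    assert (HC : 0 <= C).
    { apply RInt_pos; auto; [lra|]. intros t Ht. apply lipc_ge0. specialize (Hgt t Ht). lra. }
    apply le_of_eps. intros e He.
    set (d := Rmin c2 (e / (C + 1))).
    assert (Hd : 0 < d /\ d <= c2 /\ d * C <= e).
    { unfold d. assert (0 < e / (C + 1)) by (apply Rdiv_lt_0_compat; lra).
      split; [apply Rmin_glb_lt; lra|]. split; [apply Rmin_l|].
      apply Rle_trans with (e / (C + 1) * (C + 1)); [|apply Req_le; field; lra].
      apply Rmult_le_compat; try lra; [|apply Rmin_r]. apply Rlt_le, Rmin_glb_lt; lra. }
    pose proof (max_left (c2 - d) x y ltac:(lra) Hxy) as H.
    assert (RInt (hdef m c2) x y <= RInt (hdef m (c2 - d)) x y + d * C); [|lra].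
    unfold C. rewrite <- RInt_scal_cont by (auto; lra).
    rewrite <- RInt_plus_cont; [|lra|intros; apply Ch; auto; lra|].
    + apply RInt_le_cont; [lra|intros; apply Ch; auto; lra| |].
      * intros t Ht. apply cont_plus; [apply Ch; auto; lra|].
        apply (cont_mult (fun _ => d)); [apply continuous_const|auto].
      * intros t Ht. pose proof (hdef_lip m (c2 - d) c2 t ltac:(lra) (Hgt t Ht)) as HL.
        replace (c2 - (c2 - d)) with d in HL by ring. lra.
    + intros t Ht. apply (cont_mult (fun _ => d)); [apply continuous_const|auto].
  - rewrite <- E0. rewrite (RInt_ext_le _ (fun _ => 0)); [|lra|].
    + rewrite RInt_const_R. lra.
    + intros t Ht. unfold hdef, Rdiv. ring.
Qed.

(** Here [c2] lies strictly below [cstar R0], so slightly larger constants are admissible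
    competitors and give the reverse inequality. The midpoint [ch] supplies one Lipschitz constant
    for all of them. *)
Lemma max_turn_ge : c2 < m R0 -> c2 < cstar m R0 /\ phi <= tail (hdef m c2) R0.
Proof.
  intros HM.
  assert (Hlt : c2 < cstar m R0).
  { destruct (cstar_attained m Hm Hinf R0 ltac:(lra)) as [_ [t [Ht <-]]].
    destruct (Req_dec t R0) as [->|]; auto. apply max_gt; lra. }
  split; auto.
  assert (Hst : forall t, R0 <= t -> cstar m R0 <= m t) by (intros; apply cstar_le; auto; lra).
  set (ch := (c2 + cstar m R0) / 2).
  assert (Hch : forall t, R0 <= t -> ch < m t) by (intros t Ht; specialize (Hst t Ht); unfold ch; lra).
  pose proof (has_tail_lipc ch R0 ltac:(unfold ch; lra) HR Hch) as TL.
  set (C := tail (lipc m ch) R0). assert (HC : 0 <= C) by (now apply tail_ge0).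
  apply le_of_eps. intros e He.
  set (d := Rmin (ch - c2) (e / (C + 1))).
  assert (Hd : 0 < d /\ d <= ch - c2 /\ d * C <= e).
  { unfold d. assert (0 < e / (C + 1)) by (apply Rdiv_lt_0_compat; lra).
    assert (0 < ch - c2) by (unfold ch; lra).
    split; [apply Rmin_glb_lt; lra|]. split; [apply Rmin_l|].
    apply Rle_trans with (e / (C + 1) * (C + 1)); [|apply Req_le; field; lra].
    apply Rmult_le_compat; try lra; [|apply Rmin_r]. apply Rlt_le, Rmin_glb_lt; lra. }
  set (c := c2 + d).
  assert (Hc : forall t, R0 <= t -> c < m t) by (intros t Ht; specialize (Hch t Ht); unfold c; lra).
  pose proof (Hmax c ltac:(unfold c, ch in *; lra)) as H. unfold Phi in H.
  pose proof (W_subgrad_down m Hm HJ Hinf c c2 R0 HR ltac:(unfold c; lra) Hc) as H1.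
  assert (H2 : phi <= tail (hdef m c) R0).
  { apply Rnot_lt_le. intros Hl. unfold c in *. nra. }
  pose proof (tail_hdef_lip c2 c R0 ltac:(unfold c; lra) HR Hc) as H3.
  assert (Hl : tail (lipc m c) R0 <= C).
  { apply tail_mono; auto; [apply has_tail_lipc; auto; unfold c; lra|].
    intros t Ht. specialize (Hch t Ht). unfold lipc.
    assert (0 < sqrt (m t ^ 2 - ch ^ 2)) by (apply sqrt_lt_R0; unfold ch in *; nra).
    apply Rmult_le_compat_l; [unfold ch in *; lra|]. apply Rinv_le_contravar; [apply pow_lt; auto|].
    apply pow_incr. split; [lra|]. apply sqrt_le_1_alt. unfold c, ch in *. nra. }
  assert ((c - c2) * tail (lipc m c) R0 <= d * C).
  { replace (c - c2) with d by (unfold c; ring). apply Rmult_le_compat_l; lra. }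
  lra.
Qed.

(** The competitor goes along the parallel of radius [R0] and then along a geodesic with Clairaut constant [c2]. *)
Lemma upper_dr x r p e a : (e = 1 \/ e = -1) -> R0 <= x <= r -> c2 < m x ->
  dr m (polar R0 p) (polar r (p + e * a)) <=
    m R0 * Rabs (a - RInt (hdef m c2) x r) + (r - R0)
     + c2 * RInt (hdef m c2) x r - RInt (wdef m c2) x r.
Proof.
  intros He Hx Hcx. set (T := RInt (hdef m c2) x r).
  assert (Hgt : forall t, x <= t <= r -> c2 < m t).
  { intros t Ht. destruct (Req_dec t x) as [->|]; auto. apply max_gt; lra. }
  assert (Ch : forall t, x <= t <= r -> continuous (hdef m c2) t).
  { intros t Ht. apply hdef_cont; auto; [|lra]. specialize (Hgt t Ht). lra. }
  assert (Cw : forall t, x <= t <= r -> continuous (wdef m c2) t) by (intros; apply wdef_cont; auto; lra).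
  set (p1 := p + e * (a - T)).
  pose proof (dr_arc m Hm R0 p p1 HR) as D1.
  assert (E1 : Rabs (p1 - p) = Rabs (a - T)).
  { unfold p1. replace (p + e * (a - T) - p) with (e * (a - T)) by ring. rewrite Rabs_mult.
    destruct He as [-> | ->]; [rewrite Rabs_R1; ring|rewrite (Rabs_left (-1)) by lra; ring]. }
  rewrite E1 in D1.
  pose proof (dr_radial_line m Hm p1 R0 x ltac:(lra)) as D2.
  pose proof (dr_graph m Hm (fun t => e * hdef m c2 t) x r p1 ltac:(lra)
     ltac:(intros; apply (cont_mult (fun _ => e)); [apply continuous_const|auto])) as D3.
  rewrite RInt_scal_cont in D3 by (auto; lra). fold T in D3.
  replace (p1 + e * T) with (p + e * a) in D3 by (unfold p1; ring).
  assert (E3 : RInt (fun t => sqrt (1 + m t ^ 2 * (e * hdef m c2 t) ^ 2)) x r =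
     c2 * T + (r - x - RInt (wdef m c2) x r)).
  { rewrite <- RInt_one_minus by (auto; lra). unfold T. rewrite <- RInt_scal_cont by (auto; lra).
    rewrite <- RInt_plus_cont.
    - apply RInt_ext_le; [lra|]. intros t Ht. specialize (Hgt t ltac:(lra)).
      set (M := m t) in *. unfold wdef, hdef. fold M.
      set (s := sqrt (M ^ 2 - c2 ^ 2)). assert (Hs : 0 < s) by (apply sqrt_lt_R0; nra).
      assert (Es : s ^ 2 = M ^ 2 - c2 ^ 2) by (unfold s; rewrite <- Rsqr_pow2; apply Rsqr_sqrt; nra).
      replace (1 + M ^ 2 * (e * (c2 / (M * s))) ^ 2) with ((M / s) ^ 2).
      + rewrite sqrt_pow2 by (apply Rdiv_le_0_compat; lra).
        replace (1 - (c2 / M) ^ 2) with ((s / M) ^ 2).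
        * rewrite sqrt_pow2 by (apply Rdiv_le_0_compat; lra).
          apply (Rmult_eq_reg_r (M * s)); [|apply Rgt_not_eq, Rmult_lt_0_compat; lra].
          transitivity (M ^ 2); [field; lra|].
          transitivity (c2 ^ 2 + s ^ 2); [rewrite Es; ring|field; lra].
        * transitivity (s ^ 2 / M ^ 2); [field; lra|]. rewrite Es. field. lra.
      + transitivity (M ^ 2 / s ^ 2); [field; lra|].
        transitivity ((s ^ 2 + c2 ^ 2) / s ^ 2); [rewrite Es; field; rewrite <- Es; apply pow_nonzero; lra|].
        destruct He as [-> | ->]; field; lra.
    - lra.
    - intros; apply (cont_mult (fun _ => c2)); [apply continuous_const|auto].
    - intros; apply (cont_minus (fun _ => 1)); [apply continuous_const|auto]. }
  rewrite E3 in D3.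
  pose proof (dr_triangle m Hm (polar R0 p) (polar R0 p1) (polar r (p + e * a))).
  pose proof (dr_triangle m Hm (polar R0 p1) (polar x p1) (polar r (p + e * a))).
  lra.
Qed.

(** If [c2 < m R0], the geodesic starts at [R0] and sweeps [phi] in the limit, so the arc only
    corrects [a - phi]. If [c2 = m R0], the integrand may be singular at [R0] and the geodesic
    starts at [R0 + e/4]. It may sweep less than [phi], but then the arc costs [m R0 = c2] per
    radian, which is the price in [Phi]. *)
Lemma upper_value e : 0 < e -> exists A, R0 < A /\ forall r p s a, A <= r -> (s = 1 \/ s = -1) ->
  dr m (polar R0 p) (polar r (p + s * a)) <=
    r + Phi m phi R0 c2 R0 + m R0 * Rabs (a - phi) + e.
Proof.
  intros He. pose proof (profile_pos m Hm R0 HR) as HM.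
  destruct (tail_small _ R0 (e / 4) (has_tail_wdef m Hm HJ c2 R0 HR) ltac:(lra)) as [Y [HY1 HY2]].
  assert (EV : forall x r, R0 <= x <= r -> - RInt (wdef m c2) x r <= - W m c2 R0 + (x - R0) + W m c2 r).
  { intros x r Hx. pose proof (W_Chasles m Hm HJ c2 R0 x ltac:(lra)).
    pose proof (W_Chasles m Hm HJ c2 x r ltac:(lra)).
    pose proof (wdef_RInt_range m Hm c2 R0 x ltac:(lra)). lra. }
  assert (Hc2M : c2 <= m R0) by (pose proof (cstar_le m Hm Hinf R0 R0 ltac:(lra)); lra).
  destruct (Rle_lt_or_eq_dec c2 (m R0) Hc2M) as [Hlt|E].
  - destruct (max_turn_ge Hlt) as [_ HT].
    assert (Hge : forall t, R0 <= t -> c2 < m t).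
    { intros t Ht. destruct (Req_dec t R0) as [->|]; auto. apply max_gt; lra. }
    pose proof (has_tail_hdef m Hm HJ Hinf c2 R0 ltac:(lra) HR Hge) as TH.
    destruct (tail_approx _ _ TH (e / (4 * m R0)) ltac:(apply Rdiv_lt_0_compat; lra)) as [Z [HZ1 HZ2]].
    exists (Rmax (R0 + 1) (Rmax Y Z)).
    pose proof (Rmax_l (R0 + 1) (Rmax Y Z)). pose proof (Rmax_r (R0 + 1) (Rmax Y Z)).
    pose proof (Rmax_l Y Z). pose proof (Rmax_r Y Z).
    split; [lra|]. intros r p s a Hr Hs.
    pose proof (upper_dr R0 r p s a Hs ltac:(lra) Hlt) as HU.
    pose proof (max_turn_le R0 r ltac:(lra) Hlt) as HT2. specialize (HZ2 r ltac:(lra)).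
    set (T := RInt (hdef m c2) R0 r) in *.
    assert (Hab : Rabs (a - T) <= Rabs (a - phi) + (phi - T)).
    { replace (a - T) with ((a - phi) + (phi - T)) by ring. eapply Rle_trans; [apply Rabs_triang|].
      rewrite (Rabs_pos_eq (phi - T)); lra. }
    assert (HMT : m R0 * (phi - T) <= e / 4).
    { apply Rle_trans with (m R0 * (e / (4 * m R0))); [apply Rmult_le_compat_l; lra|].
      apply Req_le. field. lra. }
    assert (m R0 * Rabs (a - T) <= m R0 * Rabs (a - phi) + m R0 * (phi - T)).
    { rewrite <- Rmult_plus_distr_l. apply Rmult_le_compat_l; lra. }
    specialize (EV R0 r ltac:(lra)). specialize (HY2 r ltac:(lra)). fold (W m c2 r) in HY2.
    assert (c2 * T <= c2 * phi) by (apply Rmult_le_compat_l; lra).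
    unfold Phi. lra.
  - set (x := R0 + e / 4).
    exists (Rmax (x + 1) Y). pose proof (Rmax_l (x + 1) Y). pose proof (Rmax_r (x + 1) Y).
    split; [unfold x in *; lra|]. intros r p s a Hr Hs.
    assert (Hcx : c2 < m x) by (apply max_gt; unfold x; lra).
    assert (Hxr : R0 <= x <= r) by (unfold x in *; lra).
    pose proof (upper_dr x r p s a Hs Hxr Hcx) as HU.
    pose proof (max_turn_le x r Hxr Hcx) as HT2.
    set (T := RInt (hdef m c2) x r) in *.
    assert (Hab : Rabs (a - T) <= Rabs (a - phi) + (phi - T)).
    { replace (a - T) with ((a - phi) + (phi - T)) by ring. eapply Rle_trans; [apply Rabs_triang|].
      rewrite (Rabs_pos_eq (phi - T)); lra. }
    assert (m R0 * Rabs (a - T) <= m R0 * Rabs (a - phi) + m R0 * (phi - T)).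
    { rewrite <- Rmult_plus_distr_l. apply Rmult_le_compat_l; lra. }
    specialize (EV x r Hxr). specialize (HY2 r ltac:(lra)). fold (W m c2 r) in HY2.
    rewrite E in *. unfold Phi. unfold x in *. lra.
Qed.

End Max.

Lemma max_exists R0 phi : 0 < R0 -> exists c2, 0 <= c2 <= cstar m R0 /\
  forall c, 0 <= c <= cstar m R0 -> Phi m phi R0 c R0 <= Phi m phi R0 c2 R0.
Proof.
  intros HR. destruct (max_attained (fun c => Phi m phi R0 c R0) 0 (cstar m R0)) as [c2 H].
  - apply Rlt_le, cstar_pos; auto.
  - intros c _. apply (cont_Phi m Hm HJ (fun _ => phi) (fun _ => R0) (fun c => c) (fun _ => R0)); auto;
      try apply continuous_const; apply continuous_id.
  - exists c2. exact H.
Qed.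

Section FromRay.
Context (g : R -> pt) (q : pt) (t0 : R) (Ht0 : 0 < t0) (Eg : g 0 = q) (Hin : enorm (g t0) < enorm q)
  (Hray : forall s t, 0 <= s -> 0 <= t -> dr m (g s) (g t) = Rabs (t - s)).

Let R0 := enorm q.
Let R1 := enorm (g t0).

(** The length of the ray is estimated from above by [upper_value] at times when its angle is close
    to [phi], and from below by [curve_Fcap] for almost shortest curves through [g t0]. These have
    minimal radius at most [R1], so one minimizer [rho] of [Fcap] over [[0, R1]] serves them all. *)
Lemma from_ray : exists phi c2 rho, 0 <= phi <= PI /\ 0 < c2 <= cstar m R0 /\
  (forall c, 0 <= c <= cstar m R0 -> Phi m phi R0 c R0 <= Phi m phi R0 c2 R0) /\
  0 <= rho < R0 /\ Fcap m c2 phi R0 rho <= Phi m phi R0 c2 R0.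
Proof.
  assert (HR1 : 0 <= R1) by apply enorm_ge0.
  assert (HR : 0 < R0) by (fold R0 R1 in Hin; lra). fold R0 R1 in Hin.
  assert (Hq : q <> origin).
  { intros E. unfold R0 in HR. rewrite E in HR. unfold enorm, origin, dot in HR; simpl in HR.
    rewrite Rmult_0_l, Rplus_0_l, sqrt_0 in HR. lra. }
  destruct (polar_repr q Hq) as [p Hp]. fold R0 in Hp.
  (* The offset [t0 + R0 + 1] places all times after [t0] and keeps the radius positive. *)
  assert (Hrep : forall k : nat, exists a, 0 <= a <= PI /\ (enorm (g (t0 + R0 + 1 + INR k)) > 0) /\
     exists e, (e = 1 \/ e = -1) /\
     g (t0 + R0 + 1 + INR k) = polar (enorm (g (t0 + R0 + 1 + INR k))) (p + e * a)).
  { intros k. set (T := t0 + R0 + 1 + INR k). pose proof (pos_INR k).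
    pose proof (ray_far m Hm g q Eg Hray T ltac:(unfold T; lra)) as Hf. fold R0 in Hf.
    assert (Hn : g T <> origin).
    { intros E. rewrite E in Hf. unfold enorm, origin, dot in Hf; simpl in Hf.
      rewrite Rmult_0_l, Rplus_0_l, sqrt_0 in Hf. unfold T in Hf. lra. }
    destruct (polar_repr_from (g T) p Hn) as [a [e [Ha [He Hg]]]].
    exists a. split; auto. split; [unfold T in *; lra|]. exists e. split; auto. }
  destruct (choice _ Hrep) as [al Hal]. clear Hrep.
  destruct (Bolzano_Weierstrass al (fun a => 0 <= a <= PI) (compact_P3 0 PI) ltac:(intros; apply Hal))
    as [phi Hphi].
  assert (Hacc : forall e N, 0 < e -> exists k, (N <= k)%nat /\ Rabs (al k - phi) < e).
  { intros e N He. destruct (Hphi (disc phi (mkposreal e He)) N) as [k [Hk1 Hk2]].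
    - exists (mkposreal e He). intros z Hz; exact Hz.
    - exists k. split; auto. }
  assert (HphiR : 0 <= phi <= PI).
  { split; apply le_of_eps; intros e He; destruct (Hacc e 0%nat He) as [k [_ Hk]];
      pose proof (proj1 (Hal k)); apply Rabs_def2 in Hk; lra. }
  destruct (max_exists R0 phi HR) as [c2 [Hc2 Hmax]].
  pose proof (profile_pos m Hm R0 HR) as HM.
  set (V := Phi m phi R0 c2 R0).
  assert (Htime : forall e, 0 < e -> exists T r s a, t0 <= T /\ 0 < r /\ 0 <= a <= PI /\ (s = 1 \/ s = -1) /\
     enorm (g T) = r /\ g T = polar r (p + s * a) /\ Rabs (a - phi) <= e /\ T <= r + V + e).
  { intros e He. set (e1 := Rmin e (e / (2 * m R0))).
    assert (He1 : 0 < e1 /\ e1 <= e /\ m R0 * e1 <= e / 2).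
    { assert (0 < e / (2 * m R0)) by (apply Rdiv_lt_0_compat; lra).
      unfold e1. split; [apply Rmin_glb_lt; lra|]. split; [apply Rmin_l|].
      apply Rle_trans with (m R0 * (e / (2 * m R0))); [apply Rmult_le_compat_l; [lra|apply Rmin_r]|].
      apply Req_le; field; lra. }
    destruct (upper_value R0 phi c2 HR (proj1 HphiR) Hc2 Hmax (e / 2) ltac:(lra)) as [A [HA1 HA2]].
    destruct (INR_unbounded A) as [N HN].
    destruct (Hacc e1 N (proj1 He1)) as [k [Hk1 Hk2]].
    destruct (Hal k) as [Ha [Hpos [s [Hs Hg]]]].
    set (T := t0 + R0 + 1 + INR k) in *. set (r := enorm (g T)) in *.
    apply le_INR in Hk1. pose proof (pos_INR k).
    pose proof (ray_far m Hm g q Eg Hray T ltac:(unfold T; lra)) as Hf. fold R0 r in Hf.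
    exists T, r, s, (al k). repeat (split; [first [assumption|unfold T; lra|lra|reflexivity]|]).
    rewrite <- (ray_dr m g q Eg Hray T) at 1 by (unfold T; lra).
    rewrite Hp, Hg.
    specialize (HA2 r p s (al k) ltac:(unfold T in Hf; lra) Hs).
    assert (m R0 * Rabs (al k - phi) <= m R0 * e1) by (apply Rmult_le_compat_l; lra).
    fold V in HA2. lra. }
  assert (Hlow : forall T, t0 <= T -> R0 + enorm (g T) - 2 * R1 <= T).
  { intros T HT. pose proof (ray_dr m g q Eg Hray t0 ltac:(lra)) as D1.
    pose proof (Hray t0 T ltac:(lra) ltac:(lra)) as D2. rewrite Rabs_pos_eq in D2 by lra.
    pose proof (dr_radial m Hm q (g t0)) as E1. pose proof (dr_radial m Hm (g t0) (g T)) as E2.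
    fold R0 R1 in E1. fold R1 in E2. rewrite D1 in E1. rewrite D2 in E2.
    pose proof (Rle_abs (- (R1 - R0))) as F1. rewrite Rabs_Ropp in F1.
    pose proof (Rle_abs (enorm (g T) - R1)) as F2. lra. }
  assert (HV : R0 - 2 * R1 <= V).
  { apply le_of_eps. intros e He. destruct (Htime e He) as [T [r [s [a [H1 [H2 [H3 [H4 [H5 [H6 [H7 H8]]]]]]]]]]].
    specialize (Hlow T H1). lra. }
  (* For [c2 = 0] the value [V] would be at most [- R0], whereas a ray that reaches radius [R1 < R0]
     forces [V >= R0 - 2 R1 > - R0]. *)
  assert (Hc2p : 0 < c2).
  { destruct (Rle_lt_or_eq_dec 0 c2 ltac:(lra)) as [|E]; auto. exfalso.
    unfold V, Phi in HV. rewrite <- E in HV. pose proof (W_ge0 m Hm HJ 0 R0 HR). lra. }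
  destruct (min_attained (Fcap m c2 phi R0) 0 R1 HR1) as [rho [Hrho Hmin]].
  { intros; apply Fcap_cont; auto; lra. }
  exists phi, c2, rho. split; auto. split; [lra|]. split; auto. split; [lra|].
  apply le_of_eps. intros e He. fold V.
  set (e1 := Rmin (e / 4) (e / (2 * c2))).
  assert (He1 : 0 < e1 /\ e1 <= e / 4 /\ c2 * e1 <= e / 2).
  { assert (0 < e / (2 * c2)) by (apply Rdiv_lt_0_compat; lra).
    unfold e1. split; [apply Rmin_glb_lt; lra|]. split; [apply Rmin_l|].
    apply Rle_trans with (c2 * (e / (2 * c2))); [apply Rmult_le_compat_l; [lra|apply Rmin_r]|].
    apply Req_le; field; lra. }
  destruct (Htime e1 (proj1 He1)) as [T [r [s [a [H1 [H2 [H3 [H4 [H5 [H6 [H7 H8]]]]]]]]]]].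
  destruct (ray_curve m Hm g q t0 Ht0 Eg Hray T e1 H1 (proj1 He1)) as [c [C1 [C2 [C3 [C4 C5]]]]].
  destruct (curve_Fcap m Hm HJ Hinf c R0 r a c2 C1 HR H2 Hc2p H3) as [x [X1 [X2 X3]]].
  { rewrite C2. reflexivity. }
  { rewrite C3. exact H5. }
  { rewrite C2, C3, Hp, H6, dot_polar. f_equal.
    replace (p - (p + s * a)) with (- (s * a)) by ring. rewrite cos_neg.
    destruct H4 as [-> | ->]; [now rewrite Rmult_1_l|].
    replace (-1 * a) with (- a) by ring. apply cos_neg. }
  assert (Hx : x <= R1) by (specialize (X2 (/ 2) ltac:(lra)); rewrite C4 in X2; exact X2).
  specialize (Hmin x ltac:(lra)).
  assert (HF : Fcap m c2 phi R0 x <= Fcap m c2 a R0 x + c2 * e1).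
  { assert (Hce : 0 <= c2 * e1) by (apply Rmult_le_pos; lra).
    destruct (Rle_dec a phi) as [Hle|Hle].
    - rewrite Rabs_left1 in H7 by lra. pose proof (Fcap_phi m Hm Hinf c2 a phi R0 x Hc2p Hle).
      assert (c2 * (phi - a) <= c2 * e1) by (apply Rmult_le_compat_l; lra). lra.
    - pose proof (Fcap_phi m Hm Hinf c2 phi a R0 x Hc2p ltac:(lra)). lra. }
  lra.
Qed.

End FromRay.
End N.

(** * The borderline angle PI *)

Lemma RInt_pos_strict (f : R -> R) (a b : R) : a < b -> (forall x, a <= x <= b -> continuous f x) ->
  (forall x, a <= x <= b -> 0 <= f x) -> 0 < f b -> 0 < RInt f a b.
Proof.
  intros Hab Hc Hp Hb.
  destruct (proj1 (cont_eps f b) (Hc b ltac:(lra)) (f b / 2) ltac:(lra)) as [d [Hd1 Hd2]].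
  set (c := Rmax a (b - d / 2)).
  assert (Hc2 : a <= c < b /\ b - d / 2 <= c).
  { unfold c. pose proof (Rmax_l a (b - d / 2)). pose proof (Rmax_r a (b - d / 2)).
    split; [split; [auto|apply Rmax_lub_lt; lra]|auto]. }
  rewrite (RInt_Chasles_cont f a c b) by (auto; lra).
  pose proof (RInt_pos f a c ltac:(lra) ltac:(intros; apply Hc; lra) ltac:(intros; apply Hp; lra)) as H1.
  assert (H2 : f b / 2 * (b - c) <= RInt f c b).
  { rewrite <- RInt_const_R. apply RInt_le_cont; try lra.
    - intros; apply continuous_const.
    - intros; apply Hc; lra.
    - intros x Hx. specialize (Hd2 x ltac:(apply Rabs_def1; lra)). apply Rabs_def2 in Hd2. lra. }
  assert (0 < f b / 2 * (b - c)) by (apply Rmult_lt_0_compat; lra). lra.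
Qed.

Section S.
Context (m : R -> R) (Hm : profile m) (HJ : fin_invsq m) (Hinf : unbounded m).

(** The Clairaut constant used by [Fcap] at radius [x]. *)
Definition kap (c2 x : R) : R := if Rle_dec x 0 then 0 else Rmin (cstar m x) c2.

Lemma kap_range c2 x : 0 < c2 -> 0 <= x -> 0 <= kap c2 x <= c2.
Proof.
  intros Hc Hx. unfold kap. destruct (Rle_dec x 0); [lra|].
  pose proof (cstar_pos m Hm Hinf x ltac:(lra)). split; [apply Rmin_glb; lra|apply Rmin_r].
Qed.

Lemma kap_le_m c2 x t : 0 < c2 -> 0 <= x <= t -> kap c2 x <= m t.
Proof.
  intros Hc Hx. unfold kap. destruct (Rle_dec x 0).
  - destruct (Rle_lt_or_eq_dec 0 t ltac:(lra)) as [H|H].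
    + apply Rlt_le, (profile_pos m Hm); auto.
    + rewrite <- H, (profile_0 m Hm). lra.
  - eapply Rle_trans; [apply Rmin_l|]. apply (cstar_le m Hm Hinf); lra.
Qed.

Lemma W_0 x : 0 < x -> W m 0 x = 0.
Proof.
  intros Hx. apply Rle_antisym; [|apply (W_ge0 m Hm HJ); auto].
  pose proof (W_le_invsq m Hm HJ 0 x Hx). lra.
Qed.

Lemma Fcap_shift c2 a b R0 x : Fcap m c2 b R0 x = Fcap m c2 a R0 x + kap c2 x * (b - a).
Proof.
  unfold Fcap, kap. destruct (Rle_dec x 0); [ring|]. unfold Phi. ring.
Qed.

(** By how much [Fcap] decreases, at a point with Clairaut constant [k], when the starting radius goes from
    [R0] to [R1]; the decrease is larger for smaller [k]. *)
Definition bend (R1 R0 k : R) : R := (R0 - R1) - RInt (wdef m k) R1 R0.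

(** Changing the cap from [c2] to [Rmin c2 (cstar R1)] has no effect at [x <= R1], because
    [cstar x <= cstar R1]. *)
Lemma Fcap_radius c2 phi R1 R0 x : 0 < c2 -> 0 <= x <= R1 -> 0 < R1 <= R0 ->
  Fcap m (Rmin c2 (cstar m R1)) phi R1 x = Fcap m c2 phi R0 x - bend R1 R0 (kap c2 x).
Proof.
  intros Hc Hx HR. unfold Fcap, kap, bend. destruct (Rle_dec x 0) as [H|H].
  - pose proof (W_Chasles m Hm HJ 0 R1 R0 HR) as E. rewrite !W_0 in E by lra. lra.
  - replace (Rmin (cstar m x) (Rmin c2 (cstar m R1))) with (Rmin (cstar m x) c2).
    + pose proof (W_Chasles m Hm HJ (Rmin (cstar m x) c2) R1 R0 HR) as E. unfold Phi. lra.
    + pose proof (cstar_mono m Hm Hinf x R1 ltac:(lra)).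
      unfold Rmin. repeat destruct Rle_dec; lra.
Qed.

Lemma bend_decr R1 R0 k k' : 0 < R1 < R0 -> 0 <= k <= k' -> (forall t, R1 <= t <= R0 -> k' <= m t) ->
  bend R1 R0 k' <= bend R1 R0 k /\ (k < k' -> k' < m R0 -> bend R1 R0 k' < bend R1 R0 k).
Proof.
  intros HR Hk Hkm. unfold bend.
  assert (Hc : forall k x, R1 <= x <= R0 -> continuous (wdef m k) x) by
    (intros; apply (wdef_cont m Hm); lra).
  assert (Hle : forall x, R1 <= x <= R0 -> wdef m k x <= wdef m k' x).
  { intros x Hx. specialize (Hkm x Hx). pose proof (profile_pos m Hm x ltac:(lra)) as Hp.
    destruct (Rle_lt_or_eq_dec k k' ltac:(lra)) as [Hlt|E].
    - pose proof (wdef_subgrad m k k' x ltac:(lra) ltac:(lra)) as H.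
      pose proof (hdef_ge0 m k x ltac:(lra)). assert (0 <= (k' - k) * hdef m k x) by
        (apply Rmult_le_pos; lra). lra.
    - rewrite E; lra. }
  assert (E : RInt (wdef m k') R1 R0 - RInt (wdef m k) R1 R0 =
              RInt (fun x => wdef m k' x - wdef m k x) R1 R0).
  { symmetry. apply RInt_minus_cont; [lra| |]; auto. }
  split.
  - enough (0 <= RInt (fun x => wdef m k' x - wdef m k x) R1 R0) by lra.
    apply RInt_pos; [lra| |].
    + intros; apply cont_minus; auto.
    + intros x Hx; specialize (Hle x Hx); lra.
  - intros Hlt Hlt2. enough (0 < RInt (fun x => wdef m k' x - wdef m k x) R1 R0) by lra.
    apply RInt_pos_strict; [lra| | |].
    + intros; apply cont_minus; auto.
    + intros x Hx; specialize (Hle x Hx); lra.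
    + set (c := (k + k') / 2).
      pose proof (wdef_subgrad m c k' R0 ltac:(unfold c; lra) ltac:(lra)) as H.
      pose proof (wdef_subgrad m k c R0 ltac:(unfold c; lra) ltac:(unfold c; lra)) as H'.
      assert (0 <= (c - k) * hdef m k R0).
      { apply Rmult_le_pos; [unfold c; lra|]. apply hdef_ge0; lra. }
      assert (0 < hdef m c R0).
      { unfold hdef. apply Rdiv_lt_0_compat; [unfold c; lra|]. apply Rmult_lt_0_compat; [lra|].
        apply sqrt_lt_R0. assert (0 < c < m R0) by (unfold c; lra). nra. }
      assert (0 < (k' - c) * hdef m c R0) by (apply Rmult_lt_0_compat; unfold c in *; lra).
      change (0 < wdef m k' R0 - wdef m k R0). lra.
Qed.

Lemma bend_ge0 R1 R0 k : 0 < R1 <= R0 -> 0 <= bend R1 R0 k.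
Proof. intros H. unfold bend. pose proof (wdef_RInt_range m Hm k R1 R0 H). lra. Qed.

Section Crit.
Context (R0 phi c2 rho : R) (HR : 0 < R0) (Hphi : 0 <= phi <= PI) (Hc2 : 0 < c2 <= cstar m R0)
  (Hmax : forall c, 0 <= c <= cstar m R0 -> Phi m phi R0 c R0 <= Phi m phi R0 c2 R0)
  (Hrho : 0 <= rho < R0) (Hle : Fcap m c2 phi R0 rho <= Phi m phi R0 c2 R0).

Lemma Fcap_end psi : Fcap m c2 psi R0 R0 = Phi m psi R0 c2 R0.
Proof. rewrite Fcap_pos by auto. now rewrite Rmin_right by lra. Qed.

(** With constant [c2] at [rho], the value there would exceed the value at [R0] by twice the
    integral of [1 - wdef], which is positive if [c2 < m R0]. If [c2 = m R0], then [m] increases at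
    [R0] and is below [c2] just before it, so the infimum from [rho] on is below [c2]. *)
Lemma kap_rho_lt : kap c2 rho < c2.
Proof.
  unfold kap. destruct (Rle_dec rho 0) as [H|H]; [lra|].
  destruct (Rlt_dec (cstar m rho) c2) as [Hlt|Hge]; [eapply Rle_lt_trans; [apply Rmin_l|auto]|].
  exfalso. rewrite Fcap_pos, Rmin_right in Hle by lra.
  assert (Hmr : forall t, rho <= t -> c2 <= m t).
  { intros t Ht. pose proof (cstar_le m Hm Hinf rho t ltac:(lra)). lra. }
  pose proof (W_Chasles m Hm HJ c2 rho R0 ltac:(lra)) as E.
  unfold Phi in Hle.
  assert (Hc2m : c2 < m R0).
  { destruct (Rle_lt_or_eq_dec c2 (m R0) ltac:(apply Hmr; lra)) as [|E2]; auto. exfalso.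
    pose proof (max_Derive m Hm HJ Hinf R0 phi c2 HR ltac:(lra) Hmax ltac:(lra) E2) as HD.
    destruct (proj1 (cont_eps _ _) (profile_cont1 m Hm R0) (Derive m R0) HD) as [d [Hd1 Hd2]].
    set (x := Rmax rho (R0 - d / 2)).
    assert (Hx : rho <= x < R0 /\ R0 - d / 2 <= x).
    { unfold x. pose proof (Rmax_l rho (R0 - d / 2)). pose proof (Rmax_r rho (R0 - d / 2)).
      split; [split; [auto|apply Rmax_lub_lt; lra]|auto]. }
    assert (m x < m R0).
    { apply (mono_strict_of_deriv m (Derive m)); [lra|intros; apply (profile_derive m Hm)|].
      intros y Hy. specialize (Hd2 y ltac:(apply Rabs_def1; lra)). apply Rabs_def2 in Hd2. lra. }
    specialize (Hmr x ltac:(lra)). lra. }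
  assert (0 < RInt (fun x => 1 - wdef m c2 x) rho R0).
  { apply RInt_pos_strict; [lra| | |].
    - intros x Hx. apply cont_minus; [apply continuous_const|apply (wdef_cont m Hm); lra].
    - intros x Hx. pose proof (wdef_range m c2 x). lra.
    - unfold wdef. assert (0 < sqrt (1 - (c2 / m R0) ^ 2)); [|lra]. apply sqrt_lt_R0.
      assert (0 <= c2 / m R0 < 1).
      { split; [apply Rlt_le, Rdiv_lt_0_compat; lra|]. apply Rmult_lt_reg_r with (m R0); [lra|].
        unfold Rdiv. rewrite Rmult_assoc, Rinv_l by lra. lra. }
      nra. }
  rewrite RInt_one_minus in H0 by (auto; lra). lra.
Qed.

(** When the angle grows, the value at [rho] rises at rate [kap c2 rho] and the value at [R0] at the
    larger rate [c2], so the weak inequality becomes strict. *)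
Lemma crit_of_lt_PI : phi < PI -> crit m R0.
Proof.
  intros HP. exists c2, ((phi + PI) / 2), rho. split; auto. split; [lra|]. split; [lra|].
  rewrite (Fcap_shift c2 phi _ R0 rho), (Fcap_shift c2 phi _ R0 R0), Fcap_end.
  assert (E : kap c2 R0 = c2) by
    (unfold kap; destruct (Rle_dec R0 0); [lra|apply Rmin_right; lra]).
  rewrite E. pose proof kap_rho_lt.
  assert (kap c2 rho * ((phi + PI) / 2 - phi) < c2 * ((phi + PI) / 2 - phi)) by
    (apply Rmult_lt_compat_r; lra). lra.
Qed.

Lemma crit_of_lt_end r1 : phi = PI -> 0 <= r1 <= R0 -> Fcap m c2 phi R0 r1 < Phi m phi R0 c2 R0 -> crit m R0.
Proof.
  intros HP Hr1 Hlt. pose proof PI_RGT_0. set (g := Phi m phi R0 c2 R0 - Fcap m c2 phi R0 r1).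
  set (d := Rmin (PI / 2) (g / (2 * c2))).
  assert (Hd : 0 < d /\ d <= PI / 2 /\ c2 * d <= g / 2).
  { assert (0 < g / (2 * c2)) by (apply Rdiv_lt_0_compat; unfold g; lra).
    unfold d. split; [apply Rmin_glb_lt; lra|]. split; [apply Rmin_l|].
    apply Rle_trans with (c2 * (g / (2 * c2))); [apply Rmult_le_compat_l; [lra|apply Rmin_r]|].
    apply Req_le; field; lra. }
  exists c2, (PI - d), r1. split; auto. split; [lra|]. split; auto.
  rewrite (Fcap_shift c2 phi _ R0 r1), (Fcap_shift c2 phi _ R0 R0), Fcap_end.
  assert (E : kap c2 R0 = c2) by
    (unfold kap; destruct (Rle_dec R0 0); [lra|apply Rmin_right; lra]).
  rewrite E. pose proof (kap_range c2 r1 ltac:(lra) ltac:(lra)).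
  assert (0 <= kap c2 r1 * d) by (apply Rmult_le_pos; lra).
  replace (PI - d - phi) with (- d) by lra.
  fold g in Hlt. unfold g in *. lra.
Qed.

End Crit.

Lemma turn_cont rho' R0 : 0 < rho' -> 0 < Derive m rho' -> (forall x, rho' < x -> m rho' < m x) ->
  continuous (turn m rho') R0.
Proof.
  intros H1 H2 H3. unfold turn. apply cont_plus; [|apply continuous_const].
  apply (cont_comp (fun x => sqrt (x - rho')) (th m rho')).
  - cont.
  - eapply deriv_cont. apply (th_derive m Hm rho' H1 H2 H3).
Qed.

Section Improve.
Context (Hvm : forall r1 r2, 0 < r1 -> r1 <= r2 -> Gm m r2 <= Gm m r1).
Context (R0 c2 rho : R) (HR : 0 < R0) (Hc2 : 0 < c2 <= cstar m R0) (Hrho : 0 <= rho < R0).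
Let V := Phi m PI R0 c2 R0.
Context (Hle : Fcap m c2 PI R0 rho <= V) (Hkap : kap c2 rho < c2)
  (HF : forall x, 0 <= x <= R0 -> V <= Fcap m c2 PI R0 x).

(** A geodesic starting inward from radius [R0] cannot gain more than [V]: from a slightly smaller radius
    there is a ray with smaller Clairaut constant, which by comparison stays below it, but gains at most [V]. *)
Lemma gain_le rho' : 0 < rho' < R0 -> 0 < Derive m rho' -> (forall x, rho' < x -> m rho' < m x) ->
  kap c2 rho < m rho' -> Phi m (turn m rho' R0) R0 (m rho') rho' <= V.
Proof.
  intros Hr' HD Hgt Hk. apply Rnot_lt_le. intros HV.
  set (c' := m rho') in *. set (cm := Rmin c' c2).
  assert (Hcm : kap c2 rho < cm /\ cm <= c' /\ cm <= c2).
  { unfold cm. split; [apply Rmin_glb_lt; lra|]. split; [apply Rmin_l|apply Rmin_r]. }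
  assert (Hk0 : 0 <= kap c2 rho) by (apply kap_range; lra).
  assert (HC : continuous (fun x => Phi m (turn m rho' x) x c' rho') R0).
  { apply (cont_Phi m Hm HJ (turn m rho') (fun x => x) (fun _ => c') (fun _ => rho')); try lra;
      try apply continuous_const; [apply turn_cont; auto; lra|apply continuous_id]. }
  destruct (proj1 (cont_eps _ _) HC _ (Rlt_Rminus _ _ HV)) as [d [Hd1 Hd2]].
  (* [R1] is so close to [R0] that the geodesic turning at [rho'] still gains more than [V] when
     started from [R1]. *)
  set (R1 := Rmax (R0 - d / 2) ((Rmax rho rho' + R0) / 2)).
  assert (HR1 : rho < R1 /\ rho' < R1 /\ R1 < R0 /\ R0 - d / 2 <= R1).
  { unfold R1. pose proof (Rmax_l rho rho'). pose proof (Rmax_r rho rho').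
    pose proof (Rmax_lub_lt rho rho' R0 ltac:(lra) ltac:(lra)).
    pose proof (Rmax_l (R0 - d / 2) ((Rmax rho rho' + R0) / 2)).
    pose proof (Rmax_r (R0 - d / 2) ((Rmax rho rho' + R0) / 2)).
    repeat split; try lra. apply Rmax_lub_lt; lra. }
  assert (HV1 : V < Phi m (turn m rho' R1) R1 c' rho').
  { specialize (Hd2 R1 ltac:(apply Rabs_def1; lra)). apply Rabs_def2 in Hd2. lra. }
  assert (Hmt : forall t, R1 <= t -> c' < m t) by (intros; apply Hgt; lra).
  set (c1 := Rmin c2 (cstar m R1)).
  assert (Hc1 : cm <= c1 /\ c1 <= c2 /\ c1 <= cstar m R1).
  { unfold c1. split; [|split; [apply Rmin_l|apply Rmin_r]]. apply Rmin_glb; [lra|].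
    apply (cstar_ge m Hm Hinf); [lra|]. intros t Ht; specialize (Hmt t Ht); lra. }
  assert (HcmR : forall t, R1 <= t <= R0 -> cm <= m t) by (intros t Ht; specialize (Hmt t ltac:(lra)); lra).
  pose proof (Hmt R0 ltac:(lra)) as HcR0. pose proof (Hmt R1 ltac:(lra)) as HcR1.
  (* [g] is the advantage that [rho] obtains over all radii of constant at least [cm] when the
     starting radius shrinks. At most half of it is spent on lowering the angle by [e] below PI,
     where [minimizer_geodesic] applies. *)
  set (g := bend R1 R0 (kap c2 rho) - bend R1 R0 cm).
  assert (Hg : 0 < g).
  { destruct (bend_decr R1 R0 (kap c2 rho) cm ltac:(lra) ltac:(lra) HcmR) as [_ H].
    specialize (H ltac:(lra) ltac:(lra)). unfold g; lra. }
  pose proof PI_RGT_0 as HPI.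
  set (e := Rmin (PI / 2) (g / (2 * c2))).
  assert (He : 0 < e /\ e <= PI / 2 /\ c2 * e <= g / 2).
  { assert (0 < g / (2 * c2)) by (apply Rdiv_lt_0_compat; lra).
    unfold e. split; [apply Rmin_glb_lt; lra|]. split; [apply Rmin_l|].
    apply Rle_trans with (c2 * (g / (2 * c2))); [apply Rmult_le_compat_l; [lra|apply Rmin_r]|].
    apply Req_le; field; lra. }
  set (psi := PI - e).
  assert (Eval : forall x, 0 <= x <= R1 -> Fcap m c1 psi R1 x =
            Fcap m c2 PI R0 x - bend R1 R0 (kap c2 x) - kap c2 x * e).
  { intros x Hx. unfold c1. rewrite (Fcap_radius c2 psi R1 R0 x) by lra.
    rewrite (Fcap_shift c2 PI psi R0 x). unfold psi. ring. }
  assert (Hhigh : forall x, 0 <= x <= R1 -> cm <= kap c2 x -> Fcap m c1 psi R1 rho < Fcap m c1 psi R1 x).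
  { intros x Hx Hkx. rewrite !Eval by lra. specialize (HF x ltac:(lra)).
    pose proof (kap_range c2 x ltac:(lra) ltac:(lra)) as Hkr.
    pose proof (kap_le_m c2 x) as Hkm.
    destruct (bend_decr R1 R0 cm (kap c2 x) ltac:(lra) ltac:(lra)
       ltac:(intros t Ht; apply Hkm; lra)) as [H _].
    assert (kap c2 x * e <= c2 * e) by (apply Rmult_le_compat_r; lra).
    assert (0 <= kap c2 rho * e) by (apply Rmult_le_pos; lra).
    unfold g in *. lra. }
  assert (Hcs1 : 0 < cstar m R1) by (apply (cstar_pos m Hm Hinf); lra).
  destruct (minimizer_geodesic m Hm HJ Hinf R1 psi c1 rho ltac:(lra) ltac:(unfold psi; lra)
     ltac:(lra) ltac:(lra)) as [r2 Hmin].
  { apply Hhigh; [lra|]. unfold kap. destruct (Rle_dec R1 0); [lra|].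
    rewrite Rmin_comm. fold c1. lra. }
  assert (HM : minimizing m R1 psi c1 r2) by exact Hmin.
  destruct Hmin as [Hr2 [HD2 [Hgt2 [Hlt2 [Ht2 Hall]]]]].
  pose proof (profile_pos m Hm r2 ltac:(lra)) as Hpr2.
  assert (Ecs : cstar m r2 = m r2).
  { apply Rle_antisym; [apply (cstar_le m Hm Hinf); lra|].
    apply (cstar_ge m Hm Hinf); [lra|]. intros t Ht.
    destruct (Rle_lt_or_eq_dec r2 t Ht) as [H|<-]; [apply Rlt_le, Hgt2, H|lra]. }
  assert (Hk2 : kap c2 r2 = m r2).
  { unfold kap. destruct (Rle_dec r2 0); [lra|]. rewrite Ecs. apply Rmin_left; lra. }
  pose proof (Hall rho ltac:(lra)) as Hval.
  (* A minimizer of constant at least [cm] would lose against [rho]. So its constant is below [c'],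
     as the comparison requires. *)
  assert (Hlow : m r2 < cm).
  { apply Rnot_le_lt. intros H. specialize (Hhigh r2 ltac:(lra) ltac:(lra)).
    rewrite (Fcap_pos m c1 psi R1 r2), Ecs, Rmin_left in Hhigh by lra. lra. }
  destruct (geodesic_exists m Hm HJ Hinf r2 ltac:(lra) HD2 Hgt2 R1 ltac:(lra)) as [ra [ya [Ta Ga]]].
  destruct (geodesic_exists m Hm HJ Hinf rho' ltac:(lra) HD Hgt R1 ltac:(lra)) as [rb [yb [Tb Gb]]].
  assert (Hcmp : forall t, 0 <= t -> ra t <= rb t).
  { apply (compare m Hm Hvm R1 (m r2) c' ra ya rb yb); try lra.
    - apply (geo_r0 _ _ _ _ _ _ Ga).
    - apply (geo_r0 _ _ _ _ _ _ Gb).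
    - apply (geo_y0 _ _ _ _ _ _ Ga).
    - apply (geo_y0 _ _ _ _ _ _ Gb).
    - intros t. pose proof (geo_ge _ _ _ _ _ _ Ga t). lra.
    - intros t. pose proof (geo_ge _ _ _ _ _ _ Gb t). lra.
    - apply (geo_r _ _ _ _ _ _ Ga).
    - apply (geo_r _ _ _ _ _ _ Gb).
    - apply (geo_y _ _ _ _ _ _ Ga).
    - apply (geo_y _ _ _ _ _ _ Gb).
    - apply (geo_sq _ _ _ _ _ _ Ga).
    (* This geodesic is a ray, so the distance [t] is at most the length of the detour through the
       origin. *)
    - intros t Ht.
      pose proof (ray_of_min m Hm HJ Hinf R1 psi c1 r2 ra ya Ta 0 ltac:(unfold psi; lra) HM Ga 0 t
         ltac:(lra)) as Hd.
      pose proof (dr_triangle m Hm (polar (ra 0) (0 + Ta 0)) origin (polar (ra t) (0 + Ta t))) as Htri.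
      pose proof (geo_ge _ _ _ _ _ _ Ga t) as Hg0. pose proof (geo_ge _ _ _ _ _ _ Ga 0) as Hg1.
      rewrite (dr_sym m Hm origin), !(dr_origin m Hm), !enorm_polar in Htri by lra.
      rewrite (geo_r0 _ _ _ _ _ _ Ga) in *. lra. }
  set (b := Phi m (turn m rho' R1) R1 c' rho') in *.
  assert (Hva : Phi m (turn m r2 R1) R1 (m r2) r2 <= V).
  { rewrite Ht2. eapply Rle_trans; [exact Hval|]. rewrite Eval by lra.
    pose proof (bend_ge0 R1 R0 (kap c2 rho) ltac:(lra)).
    assert (0 <= kap c2 rho * e) by (apply Rmult_le_pos; lra). lra. }
  set (a := Phi m (turn m r2 R1) R1 (m r2) r2) in *.
  destruct (geo_lim _ _ _ _ _ _ Ga ((b - V) / 2) ltac:(lra)) as [Ta0 [_ HTa]].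
  destruct (geo_lim _ _ _ _ _ _ Gb ((b - V) / 2) ltac:(lra)) as [Tb0 [_ HTb]].
  set (t := Rmax 0 (Rmax Ta0 Tb0)).
  pose proof (Rmax_l 0 (Rmax Ta0 Tb0)). pose proof (Rmax_r 0 (Rmax Ta0 Tb0)).
  pose proof (Rmax_l Ta0 Tb0). pose proof (Rmax_r Ta0 Tb0).
  destruct (HTa t ltac:(unfold t; lra)) as [_ Ha]. destruct (HTb t ltac:(unfold t; lra)) as [_ Hb].
  apply Rabs_def2 in Ha, Hb. fold a in Ha. fold c' b in Hb.
  specialize (Hcmp t ltac:(unfold t; lra)). lra.
Qed.

End Improve.

Lemma level_point R0 c : 0 < R0 -> 0 < c < cstar m R0 ->
  exists r, 0 < r < R0 /\ m r = c /\ forall t, r < t -> c < m t.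
Proof.
  intros HR Hc.
  destruct (proj1 (cont_eps _ _) (profile_cont m Hm 0) c ltac:(lra)) as [d [Hd1 Hd2]].
  set (a := Rmin (d / 2) (R0 / 2)).
  assert (Ha : 0 < a /\ a <= d / 2 /\ a <= R0 / 2).
  { unfold a. split; [apply Rmin_glb_lt; lra|]. split; [apply Rmin_l|apply Rmin_r]. }
  assert (Hca : cstar m a < c).
  { pose proof (cstar_le m Hm Hinf a a ltac:(lra)).
    specialize (Hd2 a ltac:(apply Rabs_def1; lra)). rewrite (profile_0 m Hm) in Hd2.
    apply Rabs_def2 in Hd2. lra. }
  destruct (IVT_interv (fun x => cstar m x - c) a R0) as [x [Hx1 Hx2]]; try lra.
  { intros y Hy. apply continuity_pt_filterlim.
    apply (cont_minus (cstar m) (fun _ => c)); [apply (cstar_cont m Hm Hinf); lra|apply continuous_const]. }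
  destruct (last_point m Hm Hinf x ltac:(lra)) as [r [Hr1 [Hr2 Hr3]]].
  exists r. split; [split; [lra|]|split; [lra|]].
  - apply Rnot_le_lt. intros H. pose proof (cstar_le m Hm Hinf R0 r ltac:(lra)). lra.
  - intros t Ht. specialize (Hr3 t Ht). lra.
Qed.

(** Two levels are tried, at one and two thirds of the way from [c] to [cstar R0]. Were [m] critical
    at both turning radii, its derivative would be nonpositive between them by [Derive_quasiconvex],
    against the rise from the first level to the second. *)
Lemma turning_point R0 c : (forall r1 r2, 0 < r1 -> r1 <= r2 -> Gm m r2 <= Gm m r1) ->
  0 < R0 -> 0 <= c < cstar m R0 -> exists r, 0 < r < R0 /\ 0 < Derive m r /\ c < m r < cstar m R0 /\
    forall t, r < t -> m r < m t.
Proof.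
  intros Hvm HR Hc.
  destruct (level_point R0 ((2 * c + cstar m R0) / 3) HR ltac:(lra)) as [r1 [A1 [A2 A3]]].
  destruct (level_point R0 ((c + 2 * cstar m R0) / 3) HR ltac:(lra)) as [r2 [B1 [B2 B3]]].
  assert (G1 : forall t, r1 < t -> m r1 < m t) by (intros t Ht; rewrite A2; auto).
  assert (G2 : forall t, r2 < t -> m r2 < m t) by (intros t Ht; rewrite B2; auto).
  destruct (Rle_lt_or_eq_dec _ _ (Derive_ge0_of_gt m Hm r1 G1)) as [D1|D1].
  { exists r1. repeat split; auto; lra. }
  destruct (Rle_lt_or_eq_dec _ _ (Derive_ge0_of_gt m Hm r2 G2)) as [D2|D2].
  { exists r2. repeat split; auto; lra. }
  exfalso. assert (H12 : r1 <= r2) by (apply Rnot_lt_le; intros H; specialize (G2 r1 H); lra).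
  assert (m r2 <= m r1); [|lra].
  enough (- m r1 <= - m r2) by lra.
  apply (mono_of_deriv (fun x => - m x) (fun x => - Derive m x)); auto.
  - intros x _. apply (is_derive_opp m), (profile_derive m Hm).
  - intros x Hx. pose proof (Derive_quasiconvex m Hm Hvm r1 x r2 ltac:(lra) ltac:(lra) ltac:(lra) ltac:(lra)).
    lra.
Qed.

(** The angle swept outside [R0] alone is already at least PI. By the tangent line inequality the
    gain is then larger by at least [2 * al a], twice the length of the arc between radius [R0] and
    the turning point. *)
Lemma gain_of_tail R0 c2 rho' : 0 < rho' < R0 -> 0 < Derive m rho' -> (forall x, rho' < x -> m rho' < m x) ->
  0 <= c2 <= m rho' -> PI <= tail (hdef m c2) R0 ->
  Phi m PI R0 c2 R0 < Phi m (turn m rho' R0) R0 (m rho') rho'.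
Proof.
  intros Hr HD Hgt Hc HT. set (c' := m rho') in *. set (a := sqrt (R0 - rho')).
  assert (Ha : 0 < a) by (apply sqrt_lt_R0; lra).
  assert (Ers : rs rho' a = R0) by (apply rs_sqrt; lra).
  pose proof (al_th m Hm rho' ltac:(lra) HD Hgt a ltac:(lra)) as E1.
  pose proof (Thi_eq m Hm HJ Hinf rho' ltac:(lra) HD Hgt a Ha) as E2.
  pose proof (al_incr m Hm rho' ltac:(lra) HD Hgt 0 a Ha) as E3. rewrite al_0 in E3.
  rewrite Ers in E1, E2. fold c' in E1, E2.
  pose proof (W_Chasles m Hm HJ c' rho' R0 ltac:(lra)) as E4.
  assert (Hct : forall t, R0 <= t -> c' < m t) by (intros; apply Hgt; lra).
  pose proof (W_subgrad_down m Hm HJ Hinf c' c2 R0 ltac:(lra) ltac:(lra) Hct) as E5.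
  pose proof (tail_hdef_mono m Hm HJ Hinf c2 c' R0 ltac:(lra) ltac:(lra) Hct) as E6.
  assert (E7 : c2 * PI <= c2 * tail (hdef m c') R0) by (apply Rmult_le_compat_l; lra).
  unfold turn, Phi. fold a. rewrite E2, E4. lra.
Qed.

Ltac exd := repeat match goal with |- _ /\ _ => split | |- True => exact I
  | |- ex_derive _ _ => eexists; eassumption end.

Lemma bounded_on (f : R -> R) a b : a <= b -> (forall x, a <= x <= b -> continuous f x) ->
  exists B, 0 < B /\ forall x, a <= x <= b -> Rabs (f x) <= B.
Proof.
  intros Hab Hf. destruct (max_attained (fun x => Rabs (f x)) a b Hab) as [x [Hx H]].
  - intros x Hx. apply cont_abs; auto.
  - exists (Rabs (f x) + 1). pose proof (Rabs_pos (f x)). split; [lra|]. intros y Hy. specialize (H y Hy). lra.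
Qed.

Lemma incr_bound (f df : R -> R) a b A x y : (forall x, is_derive f x (df x)) ->
  (forall x, a <= x <= b -> Rabs (df x) <= A) -> a <= x -> x <= y -> y <= b ->
  Rabs (f y - f x) <= A * (y - x).
Proof.
  intros Hf HA Hx Hxy Hy.
  assert (Hd : forall k t, is_derive (fun t => A * t + k * f t) t (A + k * df t)).
  { intros k t. specialize (Hf t). auto_derive; [exd|].
    rewrite (is_derive_unique f t (df t) Hf : Derive (fun t : R => f t) t = df t). ring. }
  assert (H1 : A * x + 1 * f x <= A * y + 1 * f y).
  { apply (mono_of_deriv (fun t => A * t + 1 * f t) (fun t => A + 1 * df t)); auto.
    intros t Ht. specialize (HA t ltac:(lra)). pose proof (Rle_abs (- df t)). rewrite Rabs_Ropp in H. lra. }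
  assert (H2 : A * x + -1 * f x <= A * y + -1 * f y).
  { apply (mono_of_deriv (fun t => A * t + -1 * f t) (fun t => A + -1 * df t)); auto.
    intros t Ht. specialize (HA t ltac:(lra)). pose proof (Rle_abs (df t)). lra. }
  apply Rabs_le. lra.
Qed.

(** * Geodesics whose turning radius approaches the starting radius *)

Section TurnLimit.
Context (R0 : R) (HR : 0 < R0) (HD0 : 0 < Derive m R0) (Hgt0 : forall x, R0 < x -> m R0 < m x).

Lemma increasing_left kappa : kappa < m R0 -> exists d, 0 < d <= R0 / 2 /\ forall rho, R0 - d <= rho < R0 ->
  0 < Derive m rho /\ (forall x, rho < x -> m rho < m x) /\ kappa < m rho.
Proof.
  intros Hk.
  destruct (proj1 (cont_eps _ _) (profile_cont1 m Hm R0) (Derive m R0) HD0) as [d1 [Hd1 Hd2]].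
  destruct (proj1 (cont_eps _ _) (profile_cont m Hm R0) (m R0 - kappa) ltac:(lra)) as [d2 [Hd3 Hd4]].
  set (d := Rmin (R0 / 2) (Rmin d1 d2 / 2)).
  assert (H : 0 < d /\ d <= R0 / 2 /\ d < d1 /\ d < d2).
  { assert (0 < Rmin d1 d2) by (apply Rmin_glb_lt; auto).
    pose proof (Rmin_l d1 d2). pose proof (Rmin_r d1 d2).
    pose proof (Rmin_r (R0 / 2) (Rmin d1 d2 / 2)). pose proof (Rmin_l (R0 / 2) (Rmin d1 d2 / 2)).
    split; [apply Rmin_glb_lt; lra|]. unfold d. lra. }
  exists d. split; [lra|]. intros rho Hr.
  assert (HD : forall y, R0 - d <= y <= R0 -> 0 < Derive m y).
  { intros y Hy. specialize (Hd2 y ltac:(apply Rabs_def1; lra)). apply Rabs_def2 in Hd2. lra. }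
  assert (Hinc : forall y, rho < y <= R0 -> m rho < m y).
  { intros y Hy. apply (mono_strict_of_deriv m (Derive m)); [lra|intros; apply (profile_derive m Hm)|].
    intros z Hz; apply HD; lra. }
  split; [apply HD; lra|]. split.
  - intros x Hx. destruct (Rle_dec x R0) as [Hx2|Hx2]; [apply Hinc; lra|].
    specialize (Hinc R0 ltac:(lra)). specialize (Hgt0 x ltac:(lra)). lra.
  - specialize (Hd4 rho ltac:(apply Rabs_def1; lra)). apply Rabs_def2 in Hd4. lra.
Qed.

(** Both quotients are mean values of the derivative of m^2 over intervals of length [u], shifted
    against each other by [R0 - rho]; [A] bounds the second derivative of m^2. *)
Lemma EE_compare : exists A, 0 < A /\ forall rho u, 0 <= rho <= R0 -> 0 <= u <= 1 ->
  EE m rho (rho + u) <= EE m R0 (R0 + u) + A * (R0 - rho).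
Proof.
  set (q := fun x => m x ^ 2). set (q1 := fun x => 2 * m x * Derive m x).
  set (q2 := fun x => 2 * Derive m x * Derive m x + 2 * m x * Derive_n m 2 x).
  assert (Hq : forall x, is_derive q x (q1 x)).
  { intros x. pose proof (profile_derive m Hm x) as H. unfold q, q1.
    auto_derive; [exd|].
    change (Derive (fun z : R => m z) x) with (Derive m x). ring. }
  assert (Hq1 : forall x, is_derive q1 x (q2 x)).
  { intros x. pose proof (profile_derive m Hm x) as H. pose proof (profile_derive2 m Hm x) as H2.
    unfold q1, q2. auto_derive; [exd|].
    change (Derive (fun z : R => m z) x) with (Derive m x).
    rewrite (is_derive_unique (Derive m) x _ H2 : Derive (fun z : R => Derive m z) x = _). ring. }
  destruct (bounded_on q2 0 (R0 + 1) ltac:(lra)) as [A [HA1 HA2]].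
  { intros x _. pose proof (profile_cont m Hm x). pose proof (profile_cont1 m Hm x).
    pose proof (profile_cont2 m Hm x). unfold q2. cont. }
  exists A. split; auto. intros rho u Hr Hu.
  assert (Hv : forall v, 0 <= v <= 1 -> q1 (rho + v) <= q1 (R0 + v) + A * (R0 - rho)).
  { intros v Hv. pose proof (incr_bound q1 q2 0 (R0 + 1) A (rho + v) (R0 + v) Hq1 HA2
      ltac:(lra) ltac:(lra) ltac:(lra)) as H.
    replace (R0 + v - (rho + v)) with (R0 - rho) in H by ring.
    pose proof (Rle_abs (- (q1 (R0 + v) - q1 (rho + v)))) as H'. rewrite Rabs_Ropp in H'. lra. }
  unfold EE. destruct (Req_EM_T (rho + u) rho) as [E|E]; destruct (Req_EM_T (R0 + u) R0) as [E2|E2]; try lra.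
  - specialize (Hv 0 ltac:(lra)). rewrite !Rplus_0_r in Hv. exact Hv.
  - fold (q (rho + u)) (q rho) (q (R0 + u)) (q R0).
    assert (H : q (R0 + 0) - q (rho + 0) + A * (R0 - rho) * 0 <= q (R0 + u) - q (rho + u) + A * (R0 - rho) * u).
    { apply (mono_of_deriv (fun v => q (R0 + v) - q (rho + v) + A * (R0 - rho) * v)
        (fun v => q1 (R0 + v) - q1 (rho + v) + A * (R0 - rho))); [lra| |].
      - intros x _. pose proof (Hq (R0 + x)) as H1. pose proof (Hq (rho + x)) as H2.
        auto_derive; [exd|].
        rewrite (is_derive_unique q _ _ H1 : Derive (fun v : R => q v) _ = _),
          (is_derive_unique q _ _ H2 : Derive (fun v : R => q v) _ = _). ring.
      - intros x Hx. specialize (Hv x ltac:(lra)). lra. }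
    rewrite !Rplus_0_r, Rmult_0_r, Rplus_0_r in H.
    replace (rho + u - rho) with u by ring. replace (R0 + u - R0) with u by ring.
    assert (0 < u) by (destruct (Rle_lt_or_eq_dec 0 u ltac:(lra)); lra).
    apply div_le; auto. unfold Rdiv. rewrite Rmult_plus_distr_r, Rmult_assoc, Rinv_l by lra. lra.
Qed.

(** With [h = R0 - rho], the numerator and [m (rs rho s)] each contribute a relative error [C1 h],
    and [SS] contributes [C2 h]; hence the constant [C1 + C1 + C2]. In the parameter [s] the
    integrand is regular up to the turning point, so the estimate is uniform. *)
Lemma thd_compare : exists C d, 0 < C /\ 0 < d <= R0 / 2 /\ forall rho s, R0 - d <= rho < R0 -> 0 <= s <= 1 ->
  thd m R0 s * (1 - C * (R0 - rho)) <= thd m rho s.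
Proof.
  destruct EE_compare as [A [HA1 HA2]].
  destruct (bounded_on (Derive m) 0 (R0 + 1) ltac:(lra)) as [B [HB1 HB2]].
  { intros; apply (profile_cont1 m Hm). }
  destruct (min_attained (EE m R0) R0 (R0 + 1) ltac:(lra)) as [x0 [Hx0 Hmin]].
  { intros x _. apply (EE_cont m Hm). }
  pose proof (EE_pos m Hm R0 HR HD0 Hgt0 x0 ltac:(lra)) as He. set (e := EE m R0 x0) in *.
  pose proof (profile_pos m Hm R0 HR) as HM.
  destruct (increasing_left 0 HM) as [d [Hd1 Hd2]].
  set (C1 := B / m R0). set (C2 := A / e).
  assert (HC1 : 0 < C1) by (apply Rdiv_lt_0_compat; auto).
  assert (HC2 : 0 < C2) by (apply Rdiv_lt_0_compat; auto).
  assert (EC1 : C1 * m R0 = B) by (unfold C1; field; lra).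
  assert (EC2 : C2 * e = A) by (unfold C2; field; lra).
  exists (C1 + C1 + C2), d. split; [lra|]. split; [lra|]. intros rho s Hr Hs.
  destruct (Hd2 rho Hr) as [HD [Hgt Hp]].
  set (h := R0 - rho). assert (Hh : 0 < h) by (unfold h; lra).
  assert (Hs2 : 0 <= s ^ 2 <= 1) by (split; [apply pow2_ge_0|simpl; rewrite Rmult_1_r; nra]).
  assert (F1 : m R0 * (1 - C1 * h) <= m rho).
  { pose proof (incr_bound m (Derive m) 0 (R0 + 1) B rho R0 (profile_derive m Hm) HB2
      ltac:(lra) ltac:(lra) ltac:(lra)) as H. fold h in H.
    pose proof (Rle_abs (m R0 - m rho)). 
    replace (m R0 * (1 - C1 * h)) with (m R0 - C1 * m R0 * h) by ring. rewrite EC1. lra. }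
  assert (Hms : m R0 <= m (rs R0 s)) by (apply (m_rs_ge m R0 Hgt0)).
  assert (F2 : m (rs rho s) <= m (rs R0 s) * (1 + C1 * h)).
  { pose proof (incr_bound m (Derive m) 0 (R0 + 1) B (rs rho s) (rs R0 s) (profile_derive m Hm) HB2
      ltac:(unfold rs; lra) ltac:(unfold rs; lra) ltac:(unfold rs; lra)) as H.
    replace (rs R0 s - rs rho s) with h in H by (unfold rs, h; ring).
    pose proof (Rle_abs (- (m (rs R0 s) - m (rs rho s)))) as H'. rewrite Rabs_Ropp in H'.
    assert (C1 * m R0 * h <= C1 * m (rs R0 s) * h).
    { apply Rmult_le_compat_r; [lra|]. apply Rmult_le_compat_l; lra. }
    rewrite EC1 in H0. lra. }
  pose proof (SS_pos m Hm rho ltac:(lra) HD Hgt s) as S1.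
  pose proof (SS_pos m Hm R0 HR HD0 Hgt0 s) as S2.
  assert (F3 : SS m rho s <= SS m R0 s * (1 + C2 * h)).
  { assert (0 < C2 * h) by (apply Rmult_lt_0_compat; auto).
    apply Rsqr_incr_0; [|lra|apply Rmult_le_pos; lra]. unfold Rsqr.
    rewrite (SS_sq m Hm rho ltac:(lra) HD Hgt).
    replace (SS m R0 s * (1 + C2 * h) * (SS m R0 s * (1 + C2 * h))) with
      (SS m R0 s * SS m R0 s * (1 + C2 * h) ^ 2) by ring.
    rewrite (SS_sq m Hm R0 HR HD0 Hgt0). unfold rs.
    specialize (HA2 rho (s ^ 2) ltac:(lra) Hs2). fold h in HA2.
    specialize (Hmin (R0 + s ^ 2) ltac:(lra)).
    set (E0 := EE m R0 (R0 + s ^ 2)) in *.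
    assert (A * h <= C2 * E0 * h).
    { rewrite <- EC2. apply Rmult_le_compat_r; [lra|]. apply Rmult_le_compat_l; lra. }
    assert (0 <= E0 * (C2 * h + (C2 * h) ^ 2)).
    { apply Rmult_le_pos; [lra|]. pose proof (pow2_ge_0 (C2 * h)). lra. }
    replace (E0 * (1 + C2 * h) ^ 2) with (E0 + C2 * E0 * h + E0 * (C2 * h + (C2 * h) ^ 2)) by ring. lra. }
  pose proof (thd_pos m Hm rho ltac:(lra) HD Hgt s) as T1. pose proof (thd_pos m Hm R0 HR HD0 Hgt0 s) as T2.
  set (a := C1 * h). set (b := C2 * h).
  assert (Ha : 0 < a) by (apply Rmult_lt_0_compat; auto). assert (Hb : 0 < b) by (apply Rmult_lt_0_compat; auto).
  replace (1 - (C1 + C1 + C2) * h) with (1 - a - a - b) by (unfold a, b; ring).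
  fold a in F1, F2. fold b in F3.
  destruct (Rle_dec (1 - a - a - b) 0) as [Hn|Hn].
  { apply Rle_trans with 0; [|lra]. assert (0 <= thd m R0 s * (- (1 - a - a - b))) by (apply Rmult_le_pos; lra). lra. }
  unfold thd in *. set (p := m (rs rho s)) in *. set (p0 := m (rs R0 s)) in *.
  set (S := SS m rho s) in *. set (S0 := SS m R0 s) in *.
  assert (Hpp : 0 < p) by (apply (m_rs_pos m Hm rho); lra).
  apply le_div; [apply Rmult_lt_0_compat; lra|].
  assert (Hprod : p * S <= p0 * (1 + a) * (S0 * (1 + b))) by (apply Rmult_le_compat; lra).
  assert (Hx : 0 < 2 * m R0 / (p0 * S0)) by (apply Rdiv_lt_0_compat; [lra|apply Rmult_lt_0_compat; lra]).
  apply Rle_trans with (2 * m R0 / (p0 * S0) * (1 - a - a - b) * (p0 * (1 + a) * (S0 * (1 + b)))).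
  { apply Rmult_le_compat_l; [|auto]. apply Rmult_le_pos; lra. }
  replace (2 * m R0 / (p0 * S0) * (1 - a - a - b) * (p0 * (1 + a) * (S0 * (1 + b)))) with
    (2 * m R0 * ((1 - a - a - b) * ((1 + a) * (1 + b)))) by (field; lra).
  apply Rle_trans with (2 * (m R0 * (1 - a))); [|lra].
  replace (2 * m R0 * ((1 - a - a - b) * ((1 + a) * (1 + b)))) with
    (2 * (m R0 * ((1 - a - a - b) * ((1 + a) * (1 + b))))) by ring.
  do 2 (apply Rmult_le_compat_l; [lra|]).
  assert (0 < a * b) by (apply Rmult_lt_0_compat; auto).
  assert (0 < a * a) by (apply Rmult_lt_0_compat; auto).
  assert (0 < b * b) by (apply Rmult_lt_0_compat; auto).
  assert (0 < a * a * b) by (apply Rmult_lt_0_compat; auto).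
  assert (0 < a * b * b) by (apply Rmult_lt_0_compat; auto). lra.
Qed.

(** The turn from radius [R0] exceeds [Thi m rho] by the order of [sqrt (R0 - rho)], while [Thi m rho]
    is Lipschitz in [rho]. *)
Lemma turn_gt kappa : kappa < m R0 -> exists rho, 0 < rho < R0 /\ 0 < Derive m rho /\
  (forall x, rho < x -> m rho < m x) /\ kappa < m rho /\ Thi m R0 < turn m rho R0.
Proof.
  intros Hk. destruct thd_compare as [C [d [HC [Hd Hthd]]]].
  destruct (increasing_left kappa Hk) as [d2 [Hd2 Hinc]].
  destruct (bounded_on (Derive m) 0 (R0 + 1) ltac:(lra)) as [B [HB1 HB2]].
  { intros; apply (profile_cont1 m Hm). }
  pose proof (thd_cont m Hm R0 HR HD0 Hgt0) as Hc0.
  destruct (min_attained (thd m R0) 0 1 ltac:(lra) ltac:(intros; apply Hc0)) as [s0 [Hs0 Hmin]].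
  pose proof (thd_pos m Hm R0 HR HD0 Hgt0 s0) as Hkp. set (k := thd m R0 s0) in *.
  assert (HtL : has_tail (lipc m (m R0)) (R0 + 1)).
  { apply (has_tail_lipc m Hm HJ Hinf); [apply Rlt_le, (profile_pos m Hm); auto|lra|].
    intros t Ht; apply Hgt0; lra. }
  pose proof (tail_ge0 _ _ HtL) as HL. set (L := tail (lipc m (m R0)) (R0 + 1)) in *.
  assert (Hth1 : 0 <= th m R0 1).
  { unfold th. apply RInt_pos; [lra|intros; apply Hc0|]. intros s _.
    apply Rlt_le, (thd_pos m Hm R0 HR HD0 Hgt0). }
  (* [D] collects the losses of order s^2: in [th] at 1, in the tail beyond radius [R0 + 1], and in
     [th] at [s]. They are set against the gain [k s], and [s] will satisfy [D s <= k / 2]. *)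
  set (D := C * th m R0 1 + B * L + C * k).
  assert (HD : 0 < D).
  { unfold D. assert (0 <= C * th m R0 1) by (apply Rmult_le_pos; lra).
    assert (0 <= B * L) by (apply Rmult_le_pos; lra). assert (0 < C * k) by (apply Rmult_lt_0_compat; lra). lra. }
  set (s := Rmin (Rmin 1 (k / (2 * D))) (Rmin d d2)).
  assert (Hs : 0 < s /\ s <= 1 /\ s <= k / (2 * D) /\ s <= d /\ s <= d2).
  { assert (0 < k / (2 * D)) by (apply Rdiv_lt_0_compat; lra).
    unfold s. split; [repeat apply Rmin_glb_lt; lra|].
    pose proof (Rmin_l (Rmin 1 (k / (2 * D))) (Rmin d d2)). pose proof (Rmin_r (Rmin 1 (k / (2 * D))) (Rmin d d2)).
    pose proof (Rmin_l 1 (k / (2 * D))). pose proof (Rmin_r 1 (k / (2 * D))).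
    pose proof (Rmin_l d d2). pose proof (Rmin_r d d2). lra. }
  assert (Hss : 0 < s ^ 2 <= s) by (simpl; rewrite Rmult_1_r; split; [nra|nra]).
  set (rho := R0 - s ^ 2).
  assert (Hr : R0 - s <= rho < R0) by (unfold rho; lra).
  destruct (Hinc rho ltac:(lra)) as [HDr [Hgt Hkr]].
  exists rho. split; [lra|]. split; auto. split; auto. split; auto.
  assert (Hrp : 0 < rho) by lra.
  assert (Hth : forall a, 0 <= a <= 1 -> (1 - C * s ^ 2) * th m R0 a <= th m rho a).
  { intros a Ha. unfold th. rewrite <- RInt_scal_cont by (try lra; intros; apply Hc0).
    apply RInt_le_cont; [lra| | |].
    - intros x _. apply (cont_mult (fun _ => 1 - C * s ^ 2)); [apply continuous_const|apply Hc0].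
    - intros x _. apply (thd_cont m Hm rho Hrp HDr Hgt).
    - intros x Hx. specialize (Hthd rho x ltac:(lra) ltac:(lra)).
      replace (R0 - rho) with (s ^ 2) in Hthd by (unfold rho; ring). lra. }
  assert (Hths : k * s <= th m R0 s).
  { unfold th. replace (k * s) with (k * (s - 0)) by ring. rewrite <- RInt_const_R.
    apply RInt_le_cont; [lra|intros; apply continuous_const|intros; apply Hc0|].
    intros x Hx. apply Hmin; lra. }
  unfold turn. replace (R0 - rho) with (s ^ 2) by (unfold rho; ring). rewrite sqrt_pow2 by lra.
  unfold Thi. unfold rs. rewrite pow1.
  assert (Hm12 : m R0 - m rho <= B * s ^ 2).
  { pose proof (incr_bound m (Derive m) 0 (R0 + 1) B rho R0 (profile_derive m Hm) HB2
      ltac:(lra) ltac:(lra) ltac:(lra)) as H.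
    replace (R0 - rho) with (s ^ 2) in H by (unfold rho; ring).
    pose proof (Rle_abs (m R0 - m rho)). lra. }
  assert (Hmp : 0 < m rho < m R0) by (split; [apply (profile_pos m Hm); auto|apply Hgt; lra]).
  pose proof (tail_hdef_lip m Hm HJ Hinf (m rho) (m R0) (R0 + 1) ltac:(lra) ltac:(lra)
    ltac:(intros; apply Hgt0; lra)) as HT1. fold L in HT1.
  pose proof (has_tail_h m Hm HJ Hinf rho Hrp Hgt (rho + 1) ltac:(lra)) as Hht.
  assert (HT2 : tail (hdef m (m rho)) (R0 + 1) <= tail (hdef m (m rho)) (rho + 1)).
  { rewrite (tail_Chasles _ (rho + 1) (R0 + 1) Hht) by lra.
    assert (0 <= RInt (hdef m (m rho)) (rho + 1) (R0 + 1)); [|lra].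
    apply RInt_pos; [lra|intros; apply Hht; lra|intros; apply Hht; lra]. }
  pose proof (Hth 1 ltac:(lra)) as H1. pose proof (Hth s ltac:(lra)) as H2.
  assert (H3 : (m R0 - m rho) * L <= B * s ^ 2 * L) by (apply Rmult_le_compat_r; auto).
  assert (H4 : D * s <= k / 2).
  { apply Rle_trans with (D * (k / (2 * D))); [apply Rmult_le_compat_l; lra|]. apply Req_le; field; lra. }
  assert (H5 : D * s * s <= k / 2 * s) by (apply Rmult_le_compat_r; lra).
  assert (Hk2 : 0 < k / 2 * s) by (apply Rmult_lt_0_compat; lra).
  assert (HCs : 1 - C * s ^ 2 <= 1) by (assert (0 <= C * s ^ 2) by (apply Rmult_le_pos; lra); lra).
  assert (H6 : k * s - C * k * s ^ 2 <= th m rho s).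
  { assert (HtC : 0 <= 1 - C * s ^ 2).
    { assert (C * k * s <= D * s) by (apply Rmult_le_compat_r; [lra|]; unfold D;
        assert (0 <= C * th m R0 1) by (apply Rmult_le_pos; lra);
        assert (0 <= B * L) by (apply Rmult_le_pos; lra); lra).
      assert (k * (C * s) <= k * 1) by lra. apply Rmult_le_reg_l in H0; auto.
      assert (C * s ^ 2 <= C * s) by (apply Rmult_le_compat_l; lra). lra. }
    assert ((1 - C * s ^ 2) * (k * s) <= (1 - C * s ^ 2) * th m R0 s) by (apply Rmult_le_compat_l; auto).
    assert (C * k * (s ^ 2) * s <= C * k * s ^ 2 * 1).
    { apply Rmult_le_compat_l; [|lra]. apply Rmult_le_pos; [apply Rmult_le_pos; lra|lra]. }
    lra. }
  unfold D in *. simpl in *. lra.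
Qed.

End TurnLimit.

Lemma crit_of_max R0 phi c2 rho : (forall r1 r2, 0 < r1 -> r1 <= r2 -> Gm m r2 <= Gm m r1) ->
  0 < R0 -> 0 <= phi <= PI -> 0 < c2 <= cstar m R0 ->
  (forall c, 0 <= c <= cstar m R0 -> Phi m phi R0 c R0 <= Phi m phi R0 c2 R0) ->
  0 <= rho < R0 -> Fcap m c2 phi R0 rho <= Phi m phi R0 c2 R0 -> crit m R0.
Proof.
  intros Hvm HR Hphi Hc2 Hmax Hrho Hle.
  pose proof (kap_rho_lt R0 phi c2 rho HR Hc2 Hmax Hrho Hle) as Hk.
  destruct (Rle_lt_or_eq_dec phi PI ltac:(lra)) as [Hlt|E];
    [exact (crit_of_lt_PI R0 phi c2 rho HR Hphi Hc2 Hmax Hrho Hle Hlt)|].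
  destruct (classic (exists r1, 0 <= r1 <= R0 /\ Fcap m c2 phi R0 r1 < Phi m phi R0 c2 R0)) as [[r1 [H1 H2]]|Hno];
    [exact (crit_of_lt_end R0 phi c2 HR Hphi Hc2 r1 E H1 H2)|].
  exfalso. subst phi.
  assert (HF : forall x, 0 <= x <= R0 -> Phi m PI R0 c2 R0 <= Fcap m c2 PI R0 x).
  { intros x Hx. apply Rnot_lt_le. intros H. apply Hno. exists x; auto. }
  assert (Hgain : forall rho', 0 < rho' < R0 -> 0 < Derive m rho' -> (forall x, rho' < x -> m rho' < m x) ->
    kap c2 rho < m rho' -> Phi m (turn m rho' R0) R0 (m rho') rho' <= Phi m PI R0 c2 R0).
  { apply (gain_le Hvm R0 c2 rho); auto. }
  pose proof (cstar_le m Hm Hinf R0 R0 ltac:(lra)) as HcM.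
  destruct (Rlt_dec c2 (m R0)) as [Hlt|Hge].
  - destruct (max_turn_ge m Hm HJ Hinf R0 PI c2 HR ltac:(lra) Hmax Hlt) as [H1 H2].
    (* The constant [c2] already sweeps at least PI outside [R0], so a turning radius with a larger
       constant below [cstar R0] gains more than the maximum, against [Hgain]. *)
    destruct (turning_point R0 c2 Hvm HR ltac:(lra)) as [r [A1 [A2 [A3 A4]]]].
    pose proof (gain_of_tail R0 c2 r A1 A2 A4 ltac:(lra) H2) as H.
    pose proof (Hgain r A1 A2 A4 ltac:(lra)). lra.
  - assert (E : c2 = m R0) by lra.
    pose proof (max_Derive m Hm HJ Hinf R0 PI c2 HR ltac:(lra) Hmax ltac:(lra) E) as HD.
    assert (Hgt : forall x, R0 < x -> m R0 < m x).
    { intros x Hx. rewrite <- E. apply (max_gt m Hm HJ Hinf R0 PI c2); auto; lra. }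
    destruct (Rlt_dec (Thi m R0) PI) as [HT|HT].
    (* Moving inward from [R0] changes the bound at rate [Thi - PI < 0] in [m], so values below the
       supposed minimum occur. *)
    + destruct (left_step m Hm HJ Hinf R0 HR HD Hgt PI R0 ltac:(lra)) as [d [k [K [Hd [Hkp [HK Hstep]]]]]].
      assert (Et : turn m R0 R0 = Thi m R0).
      { unfold turn. rewrite Rminus_diag, sqrt_0, th_0. ring. }
      rewrite Et in Hstep. set (b := PI - Thi m R0).
      assert (Hb : 0 < b) by (unfold b; lra).
      assert (Hkb : 0 < k * b / (K + 1)) by (apply Rdiv_lt_0_compat; [apply Rmult_lt_0_compat; auto|lra]).
      set (s := Rmin (Rmin 1 (d / 2)) (k * b / (K + 1))).
      assert (Hs : 0 < s /\ s <= 1 /\ s <= d / 2 /\ s <= k * b / (K + 1)).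
      { unfold s. split; [repeat apply Rmin_glb_lt; lra|].
        pose proof (Rmin_l (Rmin 1 (d / 2)) (k * b / (K + 1))).
        pose proof (Rmin_r (Rmin 1 (d / 2)) (k * b / (K + 1))).
        pose proof (Rmin_l 1 (d / 2)). pose proof (Rmin_r 1 (d / 2)). lra. }
      assert (Hss : 0 < s ^ 2 <= s) by (simpl; rewrite Rmult_1_r; split; nra).
      destruct (Hstep (R0 - s ^ 2) ltac:(lra)) as [B1 [B2 [B3 B4]]].
      replace (R0 - (R0 - s ^ 2)) with (s ^ 2) in B3, B4 by ring. rewrite sqrt_pow2 in B4 by lra.
      specialize (HF (R0 - s ^ 2) ltac:(lra)).
      rewrite Fcap_pos, B2, Rmin_left in HF by lra.
      assert (F1 : k * s ^ 2 * b <= (m R0 - m (R0 - s ^ 2)) * b) by (apply Rmult_le_compat_r; lra).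
      assert (F2 : (K + 1) * s <= k * b).
      { apply Rle_trans with ((K + 1) * (k * b / (K + 1))); [apply Rmult_le_compat_l; lra|].
        apply Req_le; field; lra. }
      assert (F3 : (K + 1) * s * s ^ 2 <= k * b * s ^ 2) by (apply Rmult_le_compat_r; lra).
      assert (F4 : 0 < s * s ^ 2) by (apply Rmult_lt_0_compat; lra).
      assert (F5 : Phi m PI R0 (m R0) R0 = Phi m PI R0 c2 R0) by (rewrite E; reflexivity).
      unfold b in *. lra.
    (* Some radius [r < R0] has a turn strictly above PI. Its gain is the bound at angle PI plus
       [m r] times the excess, hence larger than the minimum. *)
    + destruct (turn_gt R0 HR HD Hgt (kap c2 rho) ltac:(lra)) as [r [A1 [A2 [A3 [A4 A5]]]]].
      pose proof (Hgain r A1 A2 A3 A4) as HG.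
      specialize (HF r ltac:(lra)).
      assert (Hcs : cstar m r = m r).
      { apply Rle_antisym; [apply (cstar_le m Hm Hinf); lra|].
        apply (cstar_ge m Hm Hinf); [lra|]. intros t Ht.
        destruct (Rle_lt_or_eq_dec r t Ht) as [H|<-]; [apply Rlt_le, A3, H|lra]. }
      assert (m r < m R0) by (apply A3; lra).
      rewrite Fcap_pos, Hcs, Rmin_left in HF by lra.
      pose proof (profile_pos m Hm r ltac:(lra)).
      assert (0 < m r * (turn m r R0 - PI)) by (apply Rmult_lt_0_compat; lra).
      unfold Phi in *. lra.
Qed.
End S.

(** * The criterion for points of [A_m], and openness in the plane *)

Lemma crit_of_A m q : von_Mangoldt m -> A_m m q -> fin_invsq m /\ unbounded m /\ crit m (enorm q).
Proof.
  intros [Hm Hvm] HA.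
  destruct (inward_of_A m Hm q HA) as [g [t0 [Ht0 [Eg [Hin Hray]]]]].
  pose proof (ray_fin_invsq m Hm g q t0 Ht0 Eg Hin Hray) as HJ.
  pose proof (unbounded_of_fin m Hm Hvm HJ) as Hinf.
  split; auto. split; auto.
  destruct (from_ray m Hm HJ Hinf g q t0 Ht0 Eg Hin Hray) as [phi [c2 [rho [H1 [H2 [H3 [H4 H5]]]]]]].
  apply (crit_of_max m Hm HJ Hinf (enorm q) phi c2 rho); auto.
  pose proof (enorm_ge0 (g t0)). lra.
Qed.

Lemma dot_le_enorm p v : dot p v <= enorm p * enorm v.
Proof.
  pose proof (dot_cs p v) as H. rewrite <- (enorm_sq p), <- (enorm_sq v) in H.
  pose proof (enorm_ge0 p). pose proof (enorm_ge0 v).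
  assert (0 <= enorm p * enorm v) by (apply Rmult_le_pos; auto).
  apply Rnot_lt_le. intros H3. nra.
Qed.

Lemma enorm_diff p q : Rabs (enorm p - enorm q) <= enorm (fst p - fst q, snd p - snd q).
Proof.
  pose proof (dot_le_enorm p q) as H. pose proof (enorm_sq p) as E1. pose proof (enorm_sq q) as E2.
  set (a := enorm p) in *. set (b := enorm q) in *. apply Rsqr_incr_0; try apply Rabs_pos; try apply enorm_ge0.
  rewrite <- Rsqr_abs. unfold Rsqr. rewrite enorm_sq. unfold dot in *. simpl. nra.
Qed.

Theorem theorem1p6 (m : R -> R) :
  von_Mangoldt m -> open_plane (A_m m).
Proof.
  intros Hv q Hq. pose proof (proj1 Hv) as Hm.
  destruct (crit_of_A m q Hv Hq) as [HJ [Hinf Hcrit]].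
  assert (HR : 0 < enorm q).
  { destruct (Rle_lt_or_eq_dec 0 (enorm q) (enorm_ge0 q)) as [|E]; auto.
    symmetry in E. apply enorm_eq0 in E. destruct Hq as [Hq _]. contradiction. }
  (* The criterion involves only the radius, and the radius is 1-Lipschitz in the Euclidean
     distance; [A_of_crit] then accepts every polar angle. *)
  destruct (crit_open m Hm HJ Hinf (enorm q) HR Hcrit) as [e [He Hopen]].
  exists e. split; auto. intros p Hp.
  destruct (Hopen (enorm p)) as [Hpos Hpc].
  { eapply Rle_lt_trans; [apply enorm_diff|exact Hp]. }
  destruct (polar_repr p) as [t Ht].
  { intros E. rewrite E in Hpos. unfold enorm, origin, dot in Hpos; simpl in Hpos.
    rewrite Rmult_0_l, Rplus_0_l, sqrt_0 in Hpos. lra. }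
  rewrite Ht. apply (A_of_crit m Hm HJ Hinf); auto.
Qed.
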